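(* There exists a positive constant $\delta_0$ such that for any $\delta\in(0,\delta_0]$ the system of ordinary differential equations on $\mathbf{R}$ (the Isobe--Kakinuma model for travelling waves) $$ \begin{cases} cH^{p_i}\eta' + \displaystyle\sum_{j=0}^N\Bigl\{\Bigl(\frac{1}{p_i+p_j+1}H^{p_i+p_j+1}\phi_j'\Bigr)' - \delta^{-2}\frac{p_ip_j}{p_i+p_j-1}H^{p_i+p_j-1}\phi_j\Bigr\}=0 \quad (i=0,1,\ldots,N),\\[1ex] c\displaystyle\sum_{j=0}^N H^{p_j}\phi_j' + \eta + \frac12\Bigl\{\Bigl(\sum_{j=0}^N H^{p_j}\phi_j'\Bigr)^2 + \delta^{-2}\Bigl(\sum_{j=0}^N p_jH^{p_j-1}\phi_j\Bigr)^2\Bigr\}=0, \end{cases} $$ with $H=1+\eta$, has a solution $(c,\eta,\phi_0,\ldots,\phi_N)=(c^\delta,\eta^\delta,\phi_0^\delta,\ldots,\phi_N^\delta)$ (with $c^\delta\in\mathbf{R}$ a constant) which satisfies $\eta^\delta,(\phi_0^\delta)'\in B_e^\infty$ and $\phi_1^\delta,\ldots,\phi_N^\delta\in B_o^\infty$. Moreover, the solution satisfies $c^\delta=1+2\gamma\delta^2$ and, for any $k\in\mathbf{N}$, $$ \begin{cases} \|\eta^\delta-4\gamma\delta^2\,\mathrm{sech}^2x\|_k+\|(\phi_0^\delta+4\gamma\delta^2\tanh x)'\|_k\le C_k\delta^4,\\ \|\phi_j^\delta+8\gamma\gamma_j\delta^4\,\mathrm{sech}^2x\tanh x\|_k\le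 C_k\delta^6\quad\text{for } j=1,\ldots,N, \end{cases} $$ where the constant $C_k$ depends on $k$ but not on $\delta$.
   Context: $N\ge1$ is an integer and $p_0,p_1,\ldots,p_N$ are fixed nonnegative integers with $0=p_0<p_1<\cdots<p_N$. The convention $\frac00=0$ is used (terms with coefficient $p_ip_j=0$ or $p_j=0$ are zero). Primes denote derivatives in $x\in\mathbf{R}$. Norms: $\|u\|=\sup_{x\in\mathbf{R}}e^{|x|}|u(x)|$ and $\|u\|_k=\sum_{j=0}^k\|u^{(j)}\|$ for $k=0,1,2,\ldots$. $B_e^k$ (resp. $B_o^k$) is the space of even (resp. odd) functions $u\in C^k(\mathbf{R})$ with $\|u\|_k<\infty$, and $B_\alpha^\infty=\bigcap_{k\ge0}B_\alpha^k$ for $\alpha=e,o$. Constants: let $A_1=\bigl(\frac{p_ip_j}{p_i+p_j-1}\bigr)_{1\le i,j\le N}$ (a positive definite symmetric matrix), $\boldsymbol{a}_0=\bigl(\frac{1}{p_1+1},\ldots,\frac{1}{p_N+1}\bigr)^{\rm T}$ and $\boldsymbol{1}=(1,\ldots,1)^{\rm T}\in\mathbf{R}^N$. Then $\boldsymbol{\gamma}=(\gamma_1,\ldots,\gamma_N)^{\rm T}=A_1^{-1}(\boldsymbol{1}-\boldsymbol{a}_0)$ and $\gamma=(\boldsymbol{1}-\boldsymbol{a}_0)\cdot A_1^{-1}(\boldsymbol{1}-\boldsymbol{a}_0)>0$. *)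

(* Defs.v *)
From HB Require Import structures.
From mathcomp Require Import all_boot all_order all_algebra.
From mathcomp Require Import all_classical all_reals all_analysis.

Set Implicit Arguments.
Unset Strict Implicit.
Unset Printing Implicit Defensive.

Import Order.TTheory GRing.Theory Num.Theory.
Import numFieldNormedType.Exports.

Local Open Scope classical_set_scope.
Local Open Scope ring_scope.

Section FunctionSpaces.
Variable R : realType.
Implicit Types (u : R -> R) (k : nat).

(* [derive1] is total, so differentiability has to be required explicitly. *)
Definition Ck k u : Prop :=
  (forall j : nat, (j < k)%N -> forall x : R, derivable (derive1n j u) x 1) /\
  continuous (derive1n k u).

(* The norms take values in [\bar R], with value +oo for functions that do not
   decay like exp (- |x|). *)
Definition wnorm u : \bar R :=
  ereal_sup (range (fun x : R => (expR `|x| * `|u x|)%:E)).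

Definition wnormk k u : \bar R := (\sum_(j < k.+1) wnorm (derive1n j u))%E.

Definition Be k : set (R -> R) :=
  [set u | [/\ forall x, u (- x) = u x, Ck k u & (wnormk k u < +oo)%E]].

Definition Bo k : set (R -> R) :=
  [set u | [/\ forall x, u (- x) = - u x, Ck k u & (wnormk k u < +oo)%E]].

Definition Be_infty : set (R -> R) := \bigcap_k Be k.
Definition Bo_infty : set (R -> R) := \bigcap_k Bo k.

Definition sech (x : R) : R := 2 / (expR x + expR (- x)).
Definition tanh (x : R) : R := (expR x - expR (- x)) / (expR x + expR (- x)).

End FunctionSpaces.

(* Indices 1, ..., N are represented by [i : 'I_N], through [lift ord0 i]. *)
Section Constants.
Variables (R : realType) (N : nat) (p : 'I_N.+1 -> nat).

(* When p i * p j = 0 the numerator vanishes, hence so does the quotient,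
   whatever the truncated subtraction returns and even if the denominator is 0:
   this is the convention 0/0 = 0. *)
Definition coefA (i j : 'I_N.+1) : R :=
  (p i * p j)%N%:R / (p i + p j - 1)%N%:R.

Definition A1 : 'M[R]_N := \matrix_(i, j) coefA (lift ord0 i) (lift ord0 j).

Definition a0 : 'cV[R]_N := \col_i ((p (lift ord0 i)).+1%:R)^-1.

Definition gammav : 'cV[R]_N := invmx A1 *m (const_mx 1 - a0).

Definition gamma : R :=
  ((const_mx 1 - a0)^T *m (invmx A1 *m (const_mx 1 - a0))) 0 0.

End Constants.

Section IsobeKakinuma.
Variables (R : realType) (N : nat) (p : 'I_N.+1 -> nat) (delta c : R).
Variables (eta : R -> R) (phi : 'I_N.+1 -> R -> R).

Definition depth (x : R) : R := 1 + eta x.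

Definition IK_flux (i j : 'I_N.+1) (x : R) : R :=
  ((p i + p j + 1)%N%:R)^-1 * depth x ^+ (p i + p j + 1) * derive1 (phi j) x.

Definition IK_mass (i : 'I_N.+1) (x : R) : Prop :=
  c * depth x ^+ p i * derive1 eta x +
  \sum_(j < N.+1)
    ((derive1 (IK_flux i j) x : R) -
     delta ^- 2 * coefA R p i j * depth x ^+ (p i + p j - 1) * phi j x) = 0.

(* If p j = 0 the term p_j H^(p_j - 1) phi_j is 0, so the truncation of the
   exponent is harmless here and in [IK_mass]. *)
Definition IK_bernoulli (x : R) : Prop :=
  c * (\sum_(j < N.+1) depth x ^+ p j * derive1 (phi j) x) + eta x +
  2^-1 * ((\sum_(j < N.+1) depth x ^+ p j * derive1 (phi j) x) ^+ 2 +
          delta ^- 2 *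
          (\sum_(j < N.+1) (p j)%:R * depth x ^+ (p j - 1) * phi j x) ^+ 2) = 0.

(* Classical solutions: every derivative occurring in the system exists. *)
Definition IK_solution : Prop :=
  [/\ forall x, derivable eta x 1,
      forall j x, derivable (phi j) x 1,
      forall j x, derivable (derive1 (phi j)) x 1,
      forall i x, IK_mass i x &
      forall x, IK_bernoulli x].

End IsobeKakinuma.

(* Main.v *)
(* Write eta = d^2 zeta, phi_0' = d^2 v, phi_j = d^4 psi_j (d = delta), and let Vs be
   the horizontal surface velocity divided by d^2.  The equations i >= 1 say
   that momenta Pi_i = b_i zeta + O(d^2), b = 1 - a_0, have derivatives
   (A_1 psi)_i + O(d^2), while the equation i = 0 and Bernoulli's law are
   algebraic.  Projecting the momenta onto the vector gamma gives a slow system,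
   equal for d = 0 to the profile equation
   gamma zeta'' = 4 gamma zeta - 3/2 zeta^2 of the KdV soliton; projecting
   onto vectors u_k that are orthogonal to b and diagonalise both quadratic forms
   of the model gives fast variables with w - d^2 lam_k w'' = ..., lam_k > 0.
   For the remainders after the soliton has been subtracted this becomes a fixed
   point problem in which every nonlinear term carries a factor d, so it is a
   contraction for small d as soon as the linear parts are inverted uniformly in d.

   The norm controls all derivatives at once, |u^(k)| <= B k! m_k exp(-|x|): it
   is submultiplicative, the fast operators commute with d/dx, and the slow ones
   have analytic coefficients.  A single contraction thus yields delta_0
   independently of k. *)
Require Import Defs.
From HB Require Import structures.
From mathcomp Require Import all_boot all_order all_algebra ring lra.
From mathcomp Require Import all_classical all_reals all_analysis.
Import Order.TTheory GRing.Theory Num.Theory.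
Import numFieldNormedType.Exports.
Set Implicit Arguments.
Unset Strict Implicit.
Unset Printing Implicit Defensive.
Local Open Scope classical_set_scope.
Local Open Scope ring_scope.

(** * Calculus on the real line *)

Section Calculus.
Context {R : realType}.
Implicit Types (f g df : R -> R) (a b c x y : R).

(** The system is quasilinear: derivatives of the unknowns are multiplied by powers of [H], so a
    direct iteration would lose derivatives, and each derivative of a fast mode costs a factor 1/dl.
    For this reason chi_j (through [vW] and [va]) is treated as unknown in its own right, and all
    forcings are algebraic in the unknowns; only fixed jets built from the soliton are ever
    differentiated. The price is that psi_j' = chi_j is not imposed: it has to be recovered at the
    fixed point from the linear system.

    The linearised KdV operator has the derivative of the soliton in its kernel, by translation
    invariance. Prescribing parities removes this kernel and also supplies the solvability condition
    of the growing slow equation.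

    The value c = 1 + 2 gamma delta^2 fixes the profile sech^2 x, which decays like exp(-2|x|). The
    homogeneous slow solutions sech^2 and cosh^2 have rate 2 and the fast ones rate at least 2 for
    small delta, so the weight exp(-|x|) stays away from resonance and all integral estimates are
    uniform in delta. *)

Lemma is_derive_eqR f x a b : is_derive x 1 f a -> a = b -> is_derive x 1 f b.
Proof. by move=> + <-. Qed.

Lemma is_derive_cstR c x : is_derive x 1 (fun=> c : R) 0.
Proof. exact: is_derive_cst. Qed.

Lemma is_derive_idR x : is_derive x 1 (fun y : R => y) 1.
Proof. exact: is_derive_id. Qed.

Lemma is_deriveDR f g x a b : is_derive x 1 f a -> is_derive x 1 g b ->
  is_derive x 1 (fun y => f y + g y) (a + b).
Proof. by move=> ? ?; exact: is_deriveD. Qed.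

Lemma is_deriveBR f g x a b : is_derive x 1 f a -> is_derive x 1 g b ->
  is_derive x 1 (fun y => f y - g y) (a - b).
Proof. by move=> ? ?; exact: is_deriveB. Qed.

Lemma is_deriveNR f x a : is_derive x 1 f a -> is_derive x 1 (fun y => - f y) (- a).
Proof. by move=> ?; exact: is_deriveN. Qed.

Lemma is_deriveMR f g x a b : is_derive x 1 f a -> is_derive x 1 g b ->
  is_derive x 1 (fun y => f y * g y) (a * g x + f x * b).
Proof.
move=> ? ?; apply: (@is_derive_eq _ _ _ (f * g)).
by rewrite addrC; congr (_ + _); rewrite [LHS]mulrC.
Qed.

Lemma is_deriveZR f x c a : is_derive x 1 f a ->
  is_derive x 1 (fun y => c * f y) (c * a).
Proof. by move=> ?; exact: is_deriveZ. Qed.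

Lemma is_derive_sumR (I : Type) (r : seq I) (P : pred I) (h : I -> R -> R)
    (dh : I -> R) x : (forall i, is_derive x 1 (h i) (dh i)) ->
  is_derive x 1 (fun y => \sum_(i <- r | P i) h i y) (\sum_(i <- r | P i) dh i).
Proof.
move=> hd; elim: r => [|i r IH].
  rewrite big_nil; have -> : (fun y => \sum_(i <- [::] | P i) h i y) = fun=> 0.
    by apply/funext => y; rewrite big_nil.
  exact: is_derive_cstR.
rewrite big_cons.
have -> : (fun y => \sum_(j <- i :: r | P j) h j y) =
    fun y => (if P i then h i y + \sum_(j <- r | P j) h j y
              else \sum_(j <- r | P j) h j y).
  by apply/funext => y; rewrite big_cons.
by case: (P i) => //; exact: is_deriveDR.
Qed.

Lemma is_derive_compR f g x a b : is_derive (g x) 1 f a -> is_derive x 1 g b ->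
  is_derive x 1 (fun y => f (g y)) (a * b).
Proof. by move=> ? ?; exact: is_derive1_comp. Qed.

Lemma is_derive_exp (c x : R) :
  is_derive x 1 (fun y => expR (c * y)) (c * expR (c * x)).
Proof.
rewrite [X in is_derive _ _ _ X]mulrC; apply: is_derive_compR.
apply: (is_derive_eqR (is_deriveZR c (is_derive_idR x))).
by rewrite mulr1.
Qed.

Lemma is_derive_cont f df : (forall x, is_derive x 1 f (df x)) -> continuous f.
Proof.
by move=> fd x; apply: differentiable_continuous; apply/derivable1_diffP;
  case: (fd x).
Qed.

Lemma is_derive_derive1 f x a : is_derive x 1 f a -> derive1 f x = a.
Proof. by move=> fd; rewrite derive1E; case: fd. Qed.

Lemma MVTR f df a b : a <= b -> (forall x, is_derive x 1 f (df x)) ->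
  exists2 c, a <= c <= b & f b - f a = df c * (b - a).
Proof.
move=> ab fd; have [|c cab e] := MVT_segment ab (fun x _ => fd x).
  by apply: continuous_subspaceT; exact: is_derive_cont fd.
by exists c; rewrite ?in_itv/= in cab *.
Qed.

Lemma derive_ge0_le f df a b : a <= b -> (forall x, is_derive x 1 f (df x)) ->
  (forall x, a <= x <= b -> 0 <= df x) -> f a <= f b.
Proof.
move=> ab fd df0; have [c cab e] := MVTR ab fd.
by rewrite -subr_ge0 e mulr_ge0 ?df0// subr_ge0.
Qed.

Lemma derive0_eq f a b : (forall x, is_derive x 1 f 0) -> f a = f b.
Proof. by move=> fd; apply: is_derive_0_is_cst. Qed.

Lemma primitive_right f (a : R) : continuous f ->
  exists F : R -> R, forall x, a < x -> is_derive x 1 F (f x).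
Proof.
move=> cf.
pose F := fun y => (\int[@lebesgue_measure R]_(t in `[a, y]) f t)%R.
exists F => x ax.
have xu : x < x + 1 by rewrite ltrDl.
have fi : (@lebesgue_measure R).-integrable `[a, x + 1] (EFin \o f).
  apply: continuous_compact_integrable; first exact: segment_compact.
  exact: continuous_subspaceT.
have := continuous_FTC1_closed xu fi ax (cf x); rewrite -/F.
move: F => F [dF eF]; apply: DeriveDef; first exact: dF.
by rewrite -derive1E.
Qed.

(** Primitives based at the points [-n] are glued: once normalised to vanish at 0 any two agree on
    their common domain, and near [x] a single one of them represents [F]. *)
Lemma primitive f : continuous f ->
  exists F : R -> R, F 0 = 0 /\ forall x, is_derive x 1 F (f x).
Proof.
move=> cf.
have /choice[G HG] : forall n : nat, exists F : R -> R,
  forall x, - n%:R < x -> is_derive x 1 F (f x).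
  by move=> n; exact: primitive_right.
have Gcst n m x : (n <= m)%N -> - n%:R < x -> 0 < n%:R :> R ->
    G n x - G n 0 = G m x - G m 0.
  move=> nm nx n0.
  have H y : - n%:R < y -> is_derive y 1 (fun z => G n z - G m z) 0.
    move=> ny; apply: is_derive_eqR.
      apply: is_deriveBR; first exact: HG ny.
      apply: HG; apply: le_lt_trans ny.
      by rewrite lerN2 ler_nat.
    by rewrite subrr.
  suff : G n x - G m x = G n 0 - G m 0 by lra.
  have gen y z : - n%:R < y -> y <= z -> G n y - G m y = G n z - G m z.
    move=> ny yz.
    have [||c _] := @MVT_segment R (fun z => G n z - G m z) (fun=> 0) y z yz.
    - move=> w; rewrite in_itv/= => /andP[yw _].
      by apply: H; apply: lt_trans yw.
    - apply: derivable_within_continuous => w.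
      rewrite in_itv/= => /andP[yw _].
      by have [] := H w (lt_le_trans ny yw).
    - lra.
  case: (leP x 0) => x0; first exact: gen.
  by symmetry; apply: gen; [lra|exact: ltW].
pose N (x : R) := (Num.truncn `|x|).+1.
have Nx x : `|x| < (N x)%:R by exact: Num.Theory.truncnS_gt.
pose F x := G (N x) x - G (N x) 0.
exists F; split; first by rewrite /F subrr.
move=> x.
have FE m y : `|y| < m%:R -> F y = G m y - G m 0.
  move=> ym; have h k : `|y| < k%:R -> - k%:R < y.
    by rewrite ltr_norml => /andP[].
  rewrite /F; case: (leqP (N y) m) => [|/ltnW] nm.
    by apply: Gcst; [exact: nm|exact: h (Nx y)|exact: le_lt_trans (Nx y)].
  by symmetry; apply: Gcst; [exact: nm|exact: h ym|exact: le_lt_trans ym].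
have d : is_derive x 1 (fun y => G (N x) y - G (N x) 0) (f x).
  have h : is_derive x 1 (G (N x)) (f x).
    by apply: HG; have := Nx x; rewrite ltr_norml => /andP[].
  exact: is_derive_eqR (is_deriveBR h (is_derive_cstR (G (N x) 0) x)) (subr0 _).
set m := N x in d.
have nE : \near x, (fun z => G m z - G m 0) x = F x.
  have : \forall y \near x, `|y - x| < (N x)%:R - `|x|.
    have e0 : 0 < (N x)%:R - `|x| by rewrite subr_gt0.
    apply/nbhs_ballP; exists ((N x)%:R - `|x|) => //= y.
    by rewrite /ball/= distrC.
  apply: filterS => y yx; symmetry; apply: FE; rewrite /m.
  rewrite -[y](subrK x); apply: (le_lt_trans (ler_normD _ _)).
  by rewrite -ltrBrDr.
exact: near_eq_is_derive nE d.
Qed.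

End Calculus.

(** * Scalar linear equations with exponentially decaying solutions *)

Section Decay.
Context {R : realType}.
Implicit Types (f F q Q : R -> R) (a b c x y z B K beta : R).

(** Comparison replaces integration in all the estimates: [Q - F] and [Q + F] are nondecreasing. *)
Lemma derive_le_diff F f Q q a b : a <= b ->
  (forall x, is_derive x 1 F (f x)) -> (forall x, is_derive x 1 Q (q x)) ->
  (forall x, a <= x <= b -> `|f x| <= q x) -> `|F b - F a| <= Q b - Q a.
Proof.
move=> ab dF dQ fq.
have h1 : Q a - F a <= Q b - F b.
  apply: (@derive_ge0_le _ (fun x => Q x - F x) (fun x => q x - f x) _ _ ab) => x.
  by move=> /fq; rewrite ler_norml => /andP[_]; lra.
have h2 : Q a + F a <= Q b + F b.
  apply: (@derive_ge0_le _ (fun x => Q x + F x) (fun x => q x + f x) _ _ ab) => x.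
  by move=> /fq; rewrite ler_norml => /andP[+ _]; lra.
by rewrite ler_norml; apply/andP; split; lra.
Qed.

Lemma exp_small beta K (e x0 : R) : 0 < beta -> 0 < e ->
  exists2 z, z <= x0 & K * expR (beta * z) < e.
Proof.
move=> b0 e0; have K1 : 0 < `|K| + 1 by rewrite ltr_wpDl.
exists (Num.min x0 (ln (e / (`|K| + 1)) / beta)); first by rewrite ge_min lexx.
apply: (@le_lt_trans _ _ (`|K| * (e / (`|K| + 1)))); last first.
  rewrite mulrCA gtr_pMr// ltr_pdivrMr//; lra.
apply: (@le_trans _ _ (`|K| * expR (beta * Num.min x0 (ln (e / (`|K| + 1)) / beta)))).
  by apply: ler_wpM2r; [exact: expR_ge0|exact: ler_norm].
apply: ler_wpM2l => //.
have : beta * Num.min x0 (ln (e / (`|K| + 1)) / beta) <= ln (e / (`|K| + 1)).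
  rewrite -ler_pdivlMl// mulrC.
  by rewrite ge_min lexx orbT.
by rewrite -ler_expR; rewrite lnK// posrE divr_gt0.
Qed.

Lemma is_derive_cexp B beta x :
  is_derive x 1 (fun x => B * expR (beta * x)) (B * (beta * expR (beta * x))).
Proof. exact: is_deriveZR (is_derive_exp _ _). Qed.

(** Integration from minus infinity. The a priori constant [K] only makes [F z] negligible for [z]
    far to the left and drops out; this is what later turns size bounds into uniqueness and
    Lipschitz bounds. *)
Lemma decay_left_bound F f beta B K : 0 < beta ->
  (forall x, is_derive x 1 F (f x)) ->
  (forall x, x <= 0 -> `|f x| <= B * beta * expR (beta * x)) ->
  (forall x, x <= 0 -> `|F x| <= K * expR (beta * x)) ->
  forall x, x <= 0 -> `|F x| <= B * expR (beta * x).
Proof.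
move=> b0 dF fB FK x x0.
have B0 : 0 <= B.
  have := fB 0 (lexx _); rewrite mulr0 expR0 mulr1 => h.
  have : 0 <= B * beta by apply: le_trans h.
  by rewrite pmulr_lge0.
rewrite leNgt; apply/negP => lt.
have [z zx hz] := exp_small K x b0 (e := `|F x| - B * expR (beta * x)) ltac:(lra).
have := FK z (le_trans zx x0).
have h1 : `|F x - F z| <= B * expR (beta * x) - B * expR (beta * z).
  apply: (derive_le_diff zx dF (is_derive_cexp B beta)) => y /andP[_ yx].
  by rewrite mulrA; apply: fB; apply: le_trans x0.
have : `|F x| <= `|F x - F z| + `|F z| by rewrite -{1}[F x](subrK (F z)) ler_normD.
have : 0 <= B * expR (beta * z) by rewrite mulr_ge0// expR_ge0.
move=> h2 h3 h4; lra.
Qed.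

(** The primitive vanishing at minus infinity. The limit of [P0] there lies above every
    [P0 x - B * expR (beta * x)] and below every [P0 x + B * expR (beta * x)], so it is the supremum
    of the first family. *)
Lemma primitive_left f beta B : 0 < beta -> continuous f ->
  (forall x, x <= 0 -> `|f x| <= B * beta * expR (beta * x)) ->
  exists P : R -> R, (forall x, is_derive x 1 P (f x)) /\
    forall x, x <= 0 -> `|P x| <= B * expR (beta * x).
Proof.
move=> b0 cf fB; have [P0 [P00 dP]] := primitive cf.
have B0 : 0 <= B.
  have := fB 0 (lexx _); rewrite mulr0 expR0 mulr1 => h.
  have : 0 <= B * beta by apply: le_trans h.
  by rewrite pmulr_lge0.
have cmp x y : x <= y -> y <= 0 -> `|P0 y - P0 x| <=
    B * expR (beta * y) - B * expR (beta * x).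
  move=> xy y0.
  apply: (derive_le_diff xy dP (is_derive_cexp B beta)) => z /andP[_ zy].
  by rewrite mulrA; apply: fB; apply: le_trans y0.
pose S := [set P0 x - B * expR (beta * x) | x in [set x : R | x <= 0]].
have ub x : x <= 0 -> ubound S (P0 x + B * expR (beta * x)).
  move=> x0 _ [y /= y0 <-].
  have px z : 0 <= B * expR (beta * z) by rewrite mulr_ge0// expR_ge0.
  have := px x; have := px y.
  by case: (leP x y) => [/cmp/(_ y0)|/ltW/cmp/(_ x0)]; rewrite ler_norml => /andP[]; lra.
have hS : has_sup S.
  split; first by exists (P0 0 - B * expR (beta * 0)), 0 => //=.
  by exists (P0 0 + B * expR (beta * 0)); apply: ub.
exists (fun x => P0 x - sup S); split=> [x|x x0].
  exact: is_derive_eqR (is_deriveBR (dP x) (is_derive_cstR _ x)) (subr0 _).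
have h1 : P0 x - B * expR (beta * x) <= sup S.
  by apply: ub_le_sup; [case: hS|exists x].
have h2 : sup S <= P0 x + B * expR (beta * x).
  by apply: ge_sup; [case: hS|exact: ub].
by rewrite ler_norml; apply/andP; split; lra.
Qed.

Definition wt (x : R) : R := expR (- `|x|).

Lemma wt_gt0 x : 0 < wt x. Proof. exact: expR_gt0. Qed.
Lemma wt_ge0 x : 0 <= wt x. Proof. exact: expR_ge0. Qed.
Lemma wtN x : wt (- x) = wt x. Proof. by rewrite /wt normrN. Qed.
Lemma wt_le1 x : wt x <= 1.
Proof. by rewrite -[leRHS]expR0 ler_expR oppr_le0. Qed.
Lemma wt_ge0E x : 0 <= x -> wt x = expR (- x).
Proof. by move=> x0; rewrite /wt ger0_norm. Qed.
Lemma wt_le0E x : x <= 0 -> wt x = expR x.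
Proof. by move=> x0; rewrite /wt ler0_norm ?opprK. Qed.

Lemma bound_ge0 f B : (forall x, `|f x| <= B * wt x) -> 0 <= B.
Proof.
move=> /(_ 0) h; rewrite -(pmulr_lge0 B (wt_gt0 0)); exact: le_trans h.
Qed.

(** For [a <= 1/2] one has [a^-1 <= 2 * (a^-1 - 1)]: hence the factor 2, uniform in [a]. *)
Lemma relax_right F f a B : 0 < a <= 2^-1 ->
  (forall x, is_derive x 1 F (expR (a^-1 * x) * (f x / a))) ->
  (forall x, `|f x| <= B * wt x) ->
  `|F 0| <= B -> forall x, 0 <= x -> `|F x| <= 2 * B * expR ((a^-1 - 1) * x).
Proof.
move=> /andP[a0 a2] dF fB F0 x x0.
have B0 := bound_ge0 fB.
have a2' : 2 <= a^-1 by rewrite -[2]invrK lef_pV2 ?posrE ?invr_gt0.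
have : `|F x - F 0| <= 2 * B * expR ((a^-1 - 1) * x) - 2 * B * expR ((a^-1 - 1) * 0).
  apply: (derive_le_diff x0 dF (is_derive_cexp (2 * B) (a^-1 - 1))) => z /andP[z0 _].
  rewrite !normrM (ger0_norm (expR_ge0 _)) [`|a^-1|]gtr0_norm ?invr_gt0//.
  have := fB z; rewrite (wt_ge0E z0) => h.
  rewrite [(a^-1 - 1) * z]mulrBl mul1r expRD.
  apply: (@le_trans _ _ (expR (a^-1 * z) * ((B * expR (- z)) / a))).
    apply: ler_wpM2l; first exact: expR_ge0.
    by apply: ler_wpM2r => //; rewrite invr_ge0 ltW.
  have : 0 <= B * (expR (a^-1 * z) * expR (- z)) by rewrite !mulr_ge0// expR_ge0.
  move: (expR (a^-1 * z)) (expR (- z)) => E1 E2.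
  move: (a^-1) a2' => ai ai2 BE.
  have : 0 <= (B * (E1 * E2)) * (ai - 2) by apply: mulr_ge0 => //; lra.
  lra.
rewrite mulr0 expR0 mulr1 => h.
have : `|F x| <= `|F x - F 0| + `|F 0| by rewrite -{1}[F x](subrK (F 0)) ler_normD.
lra.
Qed.
End Decay.

(** * The relaxation equation u + a u' = f and hyperbolic functions *)

Section ScalarODE.
Context {R : realType}.
Implicit Types (f F u : R -> R) (a b x z B K : R).

Lemma is_derive_relax f u a x : a != 0 ->
  is_derive x 1 u ((f x - u x) / a) ->
  is_derive x 1 (fun y => expR (a^-1 * y) * u y) (expR (a^-1 * x) * (f x / a)).
Proof.
move=> a0 du; apply: is_derive_eqR (is_deriveMR (is_derive_exp a^-1 x) du) _.
by rewrite mulrBl; ring.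
Qed.

Lemma relax_left_bound f a B : 0 < a -> (forall x, `|f x| <= B * wt x) ->
  forall x, x <= 0 -> `|expR (a^-1 * x) * (f x / a)| <=
    B * (a^-1 + 1) * expR ((a^-1 + 1) * x).
Proof.
move=> a0 fB x x0; have B0 := bound_ge0 fB.
rewrite !normrM (ger0_norm (expR_ge0 _)) [`|a^-1|]gtr0_norm ?invr_gt0//.
have := fB x; rewrite (wt_le0E x0) => h.
rewrite [(a^-1 + 1) * x]mulrDl mul1r expRD.
apply: (@le_trans _ _ (expR (a^-1 * x) * ((B * expR x) / a))).
  apply: ler_wpM2l; first exact: expR_ge0.
  by apply: ler_wpM2r => //; rewrite invr_ge0 ltW.
have : 0 <= B * (expR (a^-1 * x) * expR x) by rewrite !mulr_ge0// expR_ge0.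
lra.
Qed.

Lemma relax_bound_aux f u a B : 0 < a <= 2^-1 ->
  (forall x, is_derive x 1 u ((f x - u x) / a)) ->
  (forall x, `|f x| <= B * wt x) ->
  (forall x, x <= 0 -> `|expR (a^-1 * x) * u x| <= B * expR ((a^-1 + 1) * x)) ->
  forall x, `|u x| <= 2 * B * wt x.
Proof.
move=> aP du fB ul x; have B0 := bound_ge0 fB.
have /andP[a0 _] := aP; have an0 : a != 0 by rewrite gt_eqF.
case: (leP x 0) => x0.
  have := ul x x0; rewrite mulrDl mul1r expRD normrM (ger0_norm (expR_ge0 _)).
  rewrite mulrCA ler_pM2l ?expR_gt0// (wt_le0E x0) => /le_trans; apply.
  by rewrite -mulrA ler_peMl ?mulr_ge0 ?expR_ge0// ler1n.
have F0 : `|expR (a^-1 * 0) * u 0| <= B.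
  by have := ul 0 (lexx _); rewrite !mulr0 expR0 mulr1.
have := relax_right aP (fun x => is_derive_relax an0 (du x)) fB F0 (ltW x0).
rewrite mulrBl mul1r expRD normrM (ger0_norm (expR_ge0 _)).
by rewrite mulrCA ler_pM2l ?expR_gt0// (wt_ge0E (ltW x0)).
Qed.

(** The homogeneous solutions, multiples of [expR (- a^-1 * x)], outgrow the weight on the left, so
    any finite [K] excludes them. *)
Lemma relax_bound f u a B K : 0 < a <= 2^-1 ->
  (forall x, is_derive x 1 u ((f x - u x) / a)) ->
  (forall x, `|f x| <= B * wt x) -> (forall x, `|u x| <= K * wt x) ->
  forall x, `|u x| <= 2 * B * wt x.
Proof.
move=> aP du fB uK; have /andP[a0 _] := aP; have an0 : a != 0 by rewrite gt_eqF.
apply: (relax_bound_aux aP du fB).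
have b0 : 0 < a^-1 + 1 by rewrite ltr_pwDr// invr_ge0 ltW.
have dF x := is_derive_relax an0 (du x).
apply: (decay_left_bound (K := K) b0 dF (relax_left_bound a0 fB)) => x x0.
rewrite normrM (ger0_norm (expR_ge0 _)) mulrDl mul1r expRD mulrCA.
by rewrite ler_pM2l ?expR_gt0// -(wt_le0E x0).
Qed.

Lemma relax_exists f a B : 0 < a <= 2^-1 -> continuous f ->
  (forall x, `|f x| <= B * wt x) ->
  exists u : R -> R, (forall x, is_derive x 1 u ((f x - u x) / a)) /\
    forall x, `|u x| <= 2 * B * wt x.
Proof.
move=> aP cf fB; have /andP[a0 _] := aP; have an0 : a != 0 by rewrite gt_eqF.
have b0 : 0 < a^-1 + 1 by rewrite ltr_pwDr// invr_ge0 ltW.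
have cF : continuous (fun x => expR (a^-1 * x) * (f x / a)).
  move=> x; apply: cvgM; first exact: (is_derive_cont (is_derive_exp a^-1)).
  by apply: cvgM; [exact: cf|exact: cvg_cst].
have [P [dP Pl]] := primitive_left b0 cF (relax_left_bound a0 fB).
pose u x := expR (- a^-1 * x) * P x.
have PE x : expR (a^-1 * x) * u x = P x.
  by rewrite /u mulrA -expRD -mulrDl subrr mul0r expR0 mul1r.
have du x : is_derive x 1 u ((f x - u x) / a).
  apply: is_derive_eqR (is_deriveMR (is_derive_exp (- a^-1) x) (dP x)) _.
  rewrite mulrA -expRD -mulrDl addNr mul0r expR0 mul1r /u; ring.
exists u; split=> //; apply: (relax_bound_aux aP du fB) => x x0.
by rewrite PE; exact: Pl.
Qed.

Lemma exp_sum_gt0 x : 0 < expR x + expR (- x).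
Proof. by rewrite addr_gt0 ?expR_gt0. Qed.

Let hn0 x : expR x + expR (- x) != 0.
Proof. by rewrite gt_eqF// exp_sum_gt0. Qed.

Lemma sech_sqr x : sech x ^+ 2 = 1 - tanh x ^+ 2.
Proof.
have := hn0 x; rewrite /sech /tanh => h.
have e : expR x * expR (- x) = 1 by rewrite -expRD subrr expR0.
have -> : 1 - ((expR x - expR (- x)) / (expR x + expR (- x))) ^+ 2 =
  4 * (expR x * expR (- x)) / (expR x + expR (- x)) ^+ 2 by field.
by rewrite e mulr1 expr_div_n; congr (_ / _); ring.
Qed.

Lemma is_derive_expN x : is_derive x 1 (fun y : R => expR (- y)) (- expR (- x)).
Proof.
have dN := is_deriveNR (is_derive_idR x).
apply: is_derive_eqR (is_derive_compR (is_derive_expR (- x)) dN) _.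
by rewrite mulrN1.
Qed.

Lemma is_derive_tanh x : is_derive x 1 (@tanh R) (1 - tanh x ^+ 2 : R).
Proof.
have dn := is_deriveBR (is_derive_expR x) (is_derive_expN x).
have dd := is_deriveDR (is_derive_expR x) (is_derive_expN x).
have dv := @is_deriveV R (fun y => expR y + expR (- y)) x _ _ (hn0 x) dd.
rewrite /tanh; apply: is_derive_eqR (is_deriveMR dn dv) _.
rewrite /GRing.scale/=; have := hn0 x => h; field.
exact: h.
Qed.

Lemma tanhN x : tanh (- x) = - tanh x.
Proof. by rewrite /tanh opprK -mulNr opprB [X in _ / X = _]addrC. Qed.

Definition sech2 x := 1 - tanh x ^+ 2.

Lemma sech2N x : sech2 (- x) = sech2 x.
Proof. by rewrite /sech2 tanhN sqrrN. Qed.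

Lemma is_derive_sech2 x : is_derive x 1 sech2 (- 2 * tanh x * sech2 x).
Proof.
have dt := is_derive_tanh x.
apply: is_derive_eqR (is_deriveBR (is_derive_cstR 1 x) (is_deriveMR dt dt)) _.
by rewrite /sech2; ring.
Qed.

Definition cosh2 x := ((expR x + expR (- x)) / 2) ^+ 2.

Lemma cosh2_gt0 x : 0 < cosh2 x.
Proof. by rewrite exprn_gt0// divr_gt0// exp_sum_gt0. Qed.

Lemma cosh2_ge0 x : 0 <= cosh2 x. Proof. exact: ltW (cosh2_gt0 x). Qed.

Lemma sech2E x : sech2 x = (cosh2 x)^-1.
Proof.
rewrite /sech2 -sech_sqr /sech /cosh2 -exprVn invf_div; congr (_ ^+ _).
Qed.

Lemma sech2_cosh2 x : sech2 x * cosh2 x = 1.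
Proof. by rewrite sech2E mulVf// gt_eqF// cosh2_gt0. Qed.

Lemma sech2_gt0 x : 0 < sech2 x.
Proof. by rewrite sech2E invr_gt0 cosh2_gt0. Qed.

Lemma is_derive_cosh2 x : is_derive x 1 cosh2 (2 * tanh x * cosh2 x).
Proof.
have dd := is_deriveDR (is_derive_expR x) (is_derive_expN x).
have d2 := is_deriveMR dd (is_derive_cstR 2^-1 x).
apply: is_derive_eqR (is_deriveMR d2 d2) _.
rewrite /tanh /cosh2; have := hn0 x => h; field.
exact: h.
Qed.

Lemma cosh2N x : cosh2 (- x) = cosh2 x.
Proof. by rewrite /cosh2 opprK addrC. Qed.

Lemma cosh2_wt x : cosh2 x * wt x ^+ 2 <= 1.
Proof.
wlog x0 : x / 0 <= x.
  move=> H; case: (leP 0 x) => [/H//|/ltW x0].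
  by rewrite -cosh2N -wtN; apply: H; rewrite oppr_ge0.
rewrite (wt_ge0E x0) /cosh2 -exprMn -[leRHS](expr1n _ 2).
rewrite ler_pXn2r ?nnegrE// ?mulr_ge0 ?expR_ge0 ?divr_ge0 ?(ltW (exp_sum_gt0 _))//.
rewrite mulrAC mulrDl -!expRD subrr expR0.
have : expR (- x - x) <= 1 :> R by rewrite -[leRHS]expR0 ler_expR; lra.
lra.
Qed.

Lemma sech2_wt x : sech2 x <= 4 * wt x ^+ 2.
Proof.
wlog x0 : x / 0 <= x.
  move=> H; case: (leP 0 x) => [/H//|/ltW x0].
  by rewrite -sech2N -wtN; apply: H; rewrite oppr_ge0.
rewrite -[leLHS]mulr1 sech2E ler_pdivrMl ?cosh2_gt0// (wt_ge0E x0) /cosh2.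
rewrite [leRHS](_ : _ = ((expR x + expR (- x)) * expR (- x)) ^+ 2); last by field.
rewrite -[leLHS](expr1n _ 2) ler_pXn2r ?nnegrE// ?mulr_ge0 ?expR_ge0 ?(ltW (exp_sum_gt0 _))//.
by rewrite mulrDl -!expRD subrr expR0 lerDl expR_ge0.
Qed.

Lemma tanh_le1 x : `|tanh x| <= 1.
Proof.
rewrite -[leRHS](expr1n _ 1) expr1 -(@ler_pXn2r _ 2) ?nnegrE// expr1n.
by rewrite real_normK ?num_real//; have := sech2_gt0 x; rewrite /sech2; lra.
Qed.

(** [sech2] is an integrating factor. The rate 3 is 2 from [sech2] plus 1 from the weight;
    integration from the left leaves 4/3, rounded up to 2, and evenness covers the other
    half-line. *)
Lemma even_growth_bound F u B K :
  (forall x, is_derive x 1 u (2 * tanh x * u x + F x)) ->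
  (forall x, u (- x) = u x) ->
  (forall x, `|F x| <= B * wt x) -> (forall x, `|u x| <= K * wt x) ->
  forall x, `|u x| <= 2 * B * wt x.
Proof.
move=> du ue FB uK x; have B0 := bound_ge0 FB; have K0 := bound_ge0 uK.
wlog x0 : x / x <= 0.
  move=> H; case: (leP x 0) => [/H//|/ltW x0].
  by rewrite -ue -wtN; apply: H; rewrite oppr_le0.
have w3 z : z <= 0 -> wt z ^+ 2 * wt z = expR (3 * z).
  by move=> z0; rewrite (wt_le0E z0) -exprSr -expRM_natl; congr expR; rewrite mulr_natl.
have bnd (C : R) G z : z <= 0 -> `|G z| <= C * wt z ->
    `|G z * sech2 z| <= 4 * C * expR (3 * z).
  move=> z0 h; rewrite normrM (gtr0_norm (sech2_gt0 z)) -(w3 _ z0).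
  rewrite [leRHS](_ : _ = (C * wt z) * (4 * wt z ^+ 2)); last by ring.
  by apply: ler_pM => //; [exact: ltW (sech2_gt0 z)|exact: sech2_wt].
have dP z : is_derive z 1 (fun x => u x * sech2 x) (F z * sech2 z).
  apply: is_derive_eqR (is_deriveMR (du z) (is_derive_sech2 z)) _.
  ring.
have {dP} : `|u x * sech2 x| <= 4 / 3 * B * expR (3 * x).
  apply: (decay_left_bound (K := 4 * K) _ dP) => // z z0; last exact: bnd.
  have := bnd B F z z0 (FB z); move/le_trans; apply.
  by rewrite le_eqVlt; apply/orP; left; apply/eqP; field.
rewrite normrM (gtr0_norm (sech2_gt0 x)) sech2E ler_pdivrMr ?cosh2_gt0// -(w3 _ x0) => /le_trans; apply.
rewrite [leLHS](_ : _ = (4 / 3 * B * wt x) * (cosh2 x * wt x ^+ 2)); last by ring.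
apply: (@le_trans _ _ (4 / 3 * B * wt x * 1)).
  by rewrite ler_wpM2l ?mulr_ge0 ?wt_ge0 ?cosh2_wt//; lra.
have : 0 <= B * wt x by rewrite mulr_ge0 ?wt_ge0.
lra.
Qed.
End ScalarODE.

(** * The slow equations u' = 2 tanh u + F and u' = - 2 tanh u + F *)

Section SlowODE.
Context {R : realType}.
Implicit Types (f F u : R -> R) (a b x z B K : R).

Lemma is_derive_reflect f x a : is_derive (- x) 1 f a ->
  is_derive x 1 (fun y => f (- y)) (- a).
Proof.
move=> df; have dN := is_deriveNR (is_derive_idR x).
by apply: is_derive_eqR (is_derive_compR df dN) _; rewrite mulrN1.
Qed.

(* The homogeneous solutions are multiples of cosh^2, so a decaying solution exists
   only if F sech^2 has integral zero: this is why F has to be odd. *)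
Lemma even_growth_exists F B : continuous F ->
  (forall x, F (- x) = - F x) -> (forall x, `|F x| <= B * wt x) ->
  exists u : R -> R, [/\ forall x, is_derive x 1 u (2 * tanh x * u x + F x),
    forall x, u (- x) = u x & forall x, `|u x| <= 2 * B * wt x].
Proof.
move=> cF Fo FB; have B0 := bound_ge0 FB.
have w3 z : z <= 0 -> wt z ^+ 2 * wt z = expR (3 * z).
  by move=> z0; rewrite (wt_le0E z0) -exprSr -expRM_natl; congr expR; rewrite mulr_natl.
have cP : continuous (fun x => F x * sech2 x).
  move=> x; apply: cvgM; first exact: cF.
  exact: (is_derive_cont (@is_derive_sech2 R)).
have Fb x : x <= 0 -> `|F x * sech2 x| <= 4 / 3 * B * 3 * expR (3 * x).
  move=> x0; rewrite normrM (gtr0_norm (sech2_gt0 x)) -(w3 _ x0).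
  rewrite [leRHS](_ : _ = (B * wt x) * (4 * wt x ^+ 2)); last by field.
  by apply: ler_pM => //; [exact: ltW (sech2_gt0 x)|exact: sech2_wt].
have [//|P [dP Pl]] := primitive_left _ cP Fb.
have Pe x : P (- x) = P x.
  have d z : is_derive z 1 (fun y => P (- y) - P y) 0.
    apply: is_derive_eqR (is_deriveBR (is_derive_reflect (dP (- z))) (dP z)) _.
    by rewrite Fo sech2N; ring.
  by have := derive0_eq x 0 d; rewrite oppr0; lra.
pose u x := P x * cosh2 x.
have du x : is_derive x 1 u (2 * tanh x * u x + F x).
  apply: is_derive_eqR (is_deriveMR (dP x) (is_derive_cosh2 x)) _.
  by rewrite -mulrA sech2_cosh2 /u; ring.
have ue x : u (- x) = u x by rewrite /u Pe cosh2N.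
exists u; split=> // ; apply: (even_growth_bound (K := 4 / 3 * B) du ue FB) => x.
wlog x0 : x / x <= 0.
  move=> H; case: (leP x 0) => [/H//|/ltW x0].
  by rewrite -ue -wtN; apply: H; rewrite oppr_le0.
rewrite /u normrM (ger0_norm (cosh2_ge0 x)).
have := Pl x x0; rewrite -(w3 _ x0) => h.
apply: (le_trans (ler_wpM2r (cosh2_ge0 x) h)).
rewrite [leLHS](_ : _ = (4 / 3 * B * wt x) * (cosh2 x * wt x ^+ 2)); last by ring.
rewrite [leRHS](_ : _ = (4 / 3 * B * wt x) * 1); last by rewrite mulr1.
by rewrite ler_wpM2l ?mulr_ge0 ?wt_ge0 ?cosh2_wt.
Qed.

(** The homogeneous solutions are multiples of sech^2, which are even. Oddness gives [u 0 = 0], so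
    [u * cosh2] is integrated from 0 and no a priori decay is assumed. *)
Lemma odd_decay_bound F u B :
  (forall x, is_derive x 1 u (- 2 * tanh x * u x + F x)) ->
  (forall x, u (- x) = - u x) -> (forall x, `|F x| <= B * wt x) ->
  forall x, `|u x| <= 4 * B * wt x.
Proof.
move=> du uo FB x; have B0 := bound_ge0 FB.
wlog x0 : x / 0 <= x.
  move=> H; case: (leP 0 x) => [/H//|/ltW x0].
  by rewrite -normrN -uo -wtN; apply: H; rewrite oppr_ge0.
have u0 : u 0 = 0 by have := uo 0; rewrite oppr0; lra.
have dP z : is_derive z 1 (fun y => u y * cosh2 y) (F z * cosh2 z).
  apply: is_derive_eqR (is_deriveMR (du z) (is_derive_cosh2 z)) _.
  ring.
have := derive_le_diff x0 dP (is_derive_cexp B 1).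
rewrite u0 mul0r subr0 mulr0 expR0 mulr1 mul1r => /(_ _)/wrap[].
  move=> z /andP[z0 _]; rewrite !mul1r normrM (ger0_norm (cosh2_ge0 z)).
  have := FB z => h; apply: (le_trans (ler_wpM2r (cosh2_ge0 z) h)).
  rewrite -mulrA ler_wpM2l//.
  have e : wt z * expR z = 1 by rewrite (wt_ge0E z0) -expRD addNr expR0.
  rewrite [leLHS](_ : _ = expR z * (cosh2 z * wt z ^+ 2)).
    by rewrite ler_piMr ?expR_ge0 ?cosh2_wt.
  by rewrite -[LHS]mul1r -e; ring.
rewrite normrM (ger0_norm (cosh2_ge0 x)) => h.
have {}h : `|u x| * cosh2 x <= B * expR x by lra.
have -> : `|u x| = `|u x| * cosh2 x * sech2 x.
  by rewrite -mulrA [cosh2 x * _]mulrC sech2_cosh2 mulr1.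
have e : wt x * expR x = 1 by rewrite (wt_ge0E x0) -expRD addNr expR0.
apply: (@le_trans _ _ (B * expR x * (4 * wt x ^+ 2))).
  by apply: ler_pM => //; [rewrite mulr_ge0 ?cosh2_ge0|exact: ltW (sech2_gt0 x)|exact: sech2_wt].
by rewrite le_eqVlt; apply/orP; left; apply/eqP; rewrite -[RHS]mulr1 -[X in _ = _ * X]e; ring.
Qed.

Lemma odd_decay_exists F : continuous F -> (forall x, F (- x) = F x) ->
  exists u : R -> R, (forall x, is_derive x 1 u (- 2 * tanh x * u x + F x)) /\
    forall x, u (- x) = - u x.
Proof.
move=> cF Fe.
have cP : continuous (fun x => F x * cosh2 x).
  move=> x; apply: cvgM; first exact: cF.
  exact: (is_derive_cont (@is_derive_cosh2 R)).
have [P [P0 dP]] := primitive cP.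
have Po x : P (- x) = - P x.
  have d z : is_derive z 1 (fun y => P (- y) + P y) 0.
    apply: is_derive_eqR (is_deriveDR (is_derive_reflect (dP (- z))) (dP z)) _.
    by rewrite Fe cosh2N; ring.
  by have := derive0_eq x 0 d; rewrite oppr0 P0; lra.
exists (fun x => P x * sech2 x); split=> x; last by rewrite Po sech2N mulNr.
apply: is_derive_eqR (is_deriveMR (dP x) (is_derive_sech2 x)) _.
by rewrite -mulrA [cosh2 x * _]mulrC sech2_cosh2; ring.
Qed.

End SlowODE.

(** * Jets and analytic norms *)

Section Jets.
Context {R : realType}.
(* [U k] stands for the k-th derivative divided by [k!], so that the Leibniz rule
   is the product of power series. *)
Definition jet := nat -> R -> R.
Implicit Types (U V W : jet) (x y B C D : R) (k n : nat) (d e : bool).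

Definition jet_upto n U := forall k, (k < n)%N ->
  forall x, is_derive x 1 (U k) (k.+1%:R * U k.+1 x).
Definition is_jet U := forall k x, is_derive x 1 (U k) (k.+1%:R * U k.+1 x).

Lemma is_jetP U : is_jet U <-> forall n, jet_upto n U.
Proof. by split=> [h n k _|h k]; [exact: h|exact: (h k.+1)]. Qed.

Definition jcst (c : R) : jet := fun k _ => if k is 0 then c else 0.
Definition jadd U V : jet := fun k x => U k x + V k x.
Definition jscale c U : jet := fun k x => c * U k x.
Definition jmul U V : jet :=
  fun k x => \sum_(i < k.+1) U i x * V (k - i)%N x.
Definition jsum (I : finType) (F : I -> jet) : jet :=
  fun k x => \sum_i F i k x.
Definition jderiv U : jet := fun k x => k.+1%:R * U k.+1 x.

Lemma jmul0 U V x : jmul U V 0%N x = U 0%N x * V 0%N x.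
Proof. by rewrite /jmul big_ord1. Qed.

Lemma is_jet_cst c : is_jet (jcst c).
Proof.
by move=> k x; apply: is_derive_eqR (is_derive_cstR _ x) _; rewrite mulr0.
Qed.

Lemma is_jet_add U V : is_jet U -> is_jet V -> is_jet (jadd U V).
Proof.
move=> jU jV k x; apply: is_derive_eqR (is_deriveDR (jU k x) (jV k x)) _.
by rewrite mulrDr.
Qed.

Lemma is_jet_scale c U : is_jet U -> is_jet (jscale c U).
Proof.
by move=> jU k x; apply: is_derive_eqR (is_deriveZR c (jU k x)) _; rewrite mulrCA.
Qed.

Lemma is_jet_sum (I : finType) (F : I -> jet) : (forall i, is_jet (F i)) ->
  is_jet (jsum F).
Proof.
move=> jF k x; rewrite /jsum mulr_sumr.
by apply: is_derive_sumR => i; exact: jF.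
Qed.

Lemma is_jet_deriv U : is_jet U -> is_jet (jderiv U).
Proof. by move=> jU k x; exact: is_deriveZR (jU k.+1 x). Qed.

Lemma jmul_upto n U V : jet_upto n U -> jet_upto n V -> jet_upto n (jmul U V).
Proof.
move=> jU jV k kn x.
have h (i : 'I_k.+1) : is_derive x 1 (fun y => U i y * V (k - i)%N y)
   (i.+1%:R * (U i.+1 x * V (k - i)%N x) + (k - i).+1%:R * (U i x * V (k - i).+1 x)).
  have ik : (i <= k)%N by rewrite -ltnS.
  apply: is_derive_eqR (is_deriveMR (jU i _ x) (jV (k - i)%N _ x)) _.
  - exact: leq_ltn_trans ik kn.
  - by apply: leq_ltn_trans kn; exact: leq_subr.
  - by ring.
apply: is_derive_eqR (is_derive_sumR _ _ h) _.
rewrite big_split/=.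
have -> : \sum_(i < k.+1) i.+1%:R * (U i.+1 x * V (k - i)%N x) =
    \sum_(i < k.+2) i%:R * (U i x * V (k.+1 - i)%N x).
  by rewrite [RHS]big_ord_recl mul0r add0r; apply: eq_bigr => i _; rewrite /bump/= subSS.
have -> : \sum_(i < k.+1) (k - i).+1%:R * (U i x * V (k - i).+1 x) =
    \sum_(i < k.+2) (k.+1 - i)%:R * (U i x * V (k.+1 - i)%N x).
  rewrite [RHS]big_ord_recr/= subnn mul0r addr0; apply: eq_bigr => i _.
  by rewrite subSn// -ltnS.
rewrite -big_split/= /jmul mulr_sumr; apply: eq_bigr => i _.
by rewrite -mulrDl -natrD subnKC// -ltnS.
Qed.

Lemma is_jet_mul U V : is_jet U -> is_jet V -> is_jet (jmul U V).
Proof.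
by move=> /is_jetP jU /is_jetP jV; apply/is_jetP => n; exact: jmul_upto.
Qed.

Lemma is_derive_unique (f : R -> R) x a b :
  is_derive x 1 f a -> is_derive x 1 f b -> a = b.
Proof. by move=> /is_derive_derive1 <- /is_derive_derive1 <-. Qed.

(** Because of this, identities between jets are checked at order 0 only. *)
Lemma jet_ext U V : is_jet U -> is_jet V -> U 0%N =1 V 0%N -> U = V.
Proof.
move=> jU jV UV; apply/funext; elim=> [|k IH]; first exact/funext.
apply/funext => x; have := jU k x; rewrite IH => /is_derive_unique.
by move=> /(_ _ (jV k x))/mulfI; apply; rewrite pnatr_eq0.
Qed.

Lemma jet_cont U k : is_jet U -> continuous (U k).
Proof. by move=> jU; exact: is_derive_cont (jU k). Qed.

(* The factor [(k.+1)^-2] makes this sequence a convolution algebra weight. *)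
Definition mw k : R := locked (128 ^+ k / k.+1%:R ^+ 2).

Lemma mwE k : mw k = 128 ^+ k / k.+1%:R ^+ 2.
Proof. by rewrite /mw -lock. Qed.

Lemma mw_gt0 k : 0 < mw k.
Proof. by rewrite mwE divr_gt0// exprn_gt0. Qed.
Lemma mw_ge0 k : 0 <= mw k. Proof. exact: ltW (mw_gt0 k). Qed.
Lemma mw0 : mw 0 = 1. Proof. by rewrite mwE expr0 expr1n divr1. Qed.

(** The gain 32 pays for [linear_ode_bound]: the algebra constant 8 times the coefficient norm 2,
    plus the forcing, stays below it. The base is 128 = 4 * 32 because
    [(k + 2)^2 <= 4 * (k + 1)^3]. *)
Lemma mwS k : mw k <= k.+1%:R * (mw k.+1 / 32).
Proof.
rewrite !mwE [128 ^+ k.+1]exprSr; set p := 128 ^+ k.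
have p0 : 0 <= p by rewrite exprn_ge0.
have k1 : 0 < k.+1%:R :> R by rewrite ltr0n.
have k2 : 0 < k.+2%:R :> R by rewrite ltr0n.
have e : k.+2%:R = k.+1%:R + 1 :> R by rewrite -natr1.
have k1' : 1 <= k.+1%:R :> R by rewrite ler1n.
rewrite [leRHS](_ : _ = p * (4 * k.+1%:R / k.+2%:R ^+ 2)); last first.
  by rewrite e; field; rewrite gt_eqF//; lra.
apply: ler_wpM2l => //.
rewrite ler_pdivlMr ?exprn_gt0// mulrC ler_pdivrMr ?exprn_gt0// e.
set m := k.+1%:R in k1' *.
rewrite [leRHS](_ : _ = 4 * m ^+ 3); last by ring.
apply: (@le_trans _ _ ((2 * m) ^+ 2)).
  by rewrite ler_pXn2r ?nnegrE//; lra.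
rewrite exprMn [in leRHS]exprS mulrA [leLHS](_ : _ = 4 * 1 * m ^+ 2); last by ring.
by rewrite ler_wpM2r ?exprn_ge0//; lra.
Qed.

Lemma sum_invsq n : \sum_(i < n.+1) (i.+1%:R ^+ 2)^-1 <= 2 - n.+1%:R^-1 :> R.
Proof.
elim: n => [|n IH]; first by rewrite big_ord1 expr1n invr1; lra.
rewrite big_ord_recr/=; apply: (le_trans (lerD IH (lexx _))).
have k1 : 1 <= n.+1%:R :> R by rewrite ler1n.
have -> : n.+2%:R = n.+1%:R + 1 :> R by rewrite -natr1.
set m := n.+1%:R in k1 *.
have -> : 2 - m^-1 + ((m + 1) ^+ 2)^-1 = 2 - (m + 1)^-1 - (m * (m + 1) ^+ 2)^-1.
  by field; rewrite !gt_eqF//; lra.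
rewrite gerBl invr_ge0 mulr_ge0 ?exprn_ge0//; lra.
Qed.

(** With [a = i + 1] and [b = k - i + 1], the inequality [(a + b - 1)^2 <= 2 * (a^2 + b^2)] splits
    the product of two inverse squares into a sum. Each of the two resulting series is at most 2,
    whence 8 = 2 * (2 + 2). *)
Lemma mw_conv k : \sum_(i < k.+1) mw i * mw (k - i)%N <= 8 * mw k.
Proof.
have h (i : 'I_k.+1) : mw i * mw (k - i)%N <=
    2 * mw k * ((i.+1%:R ^+ 2)^-1 + ((k - i).+1%:R ^+ 2)^-1).
  have ik : (i <= k)%N by rewrite -ltnS.
  rewrite !mwE mulrACA -exprD subnKC//.
  set p := 128 ^+ k; have p0 : 0 <= p by rewrite exprn_ge0.
  have a1 : 1 <= i.+1%:R :> R by rewrite ler1n.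
  have b1 : 1 <= (k - i).+1%:R :> R by rewrite ler1n.
  have e : k.+1%:R = i.+1%:R + (k - i).+1%:R - 1 :> R.
    by rewrite -natrD addSn addnS subnKC// -[k.+2%:R]natr1 addrK.
  rewrite e; set a := i.+1%:R in a1 *; set b := (k - i).+1%:R in b1 *.
  rewrite [leRHS](_ : _ = p * ((a ^+ 2)^-1 * (b ^+ 2)^-1 *
     (2 * (a ^+ 2 + b ^+ 2) / (a + b - 1) ^+ 2))); last first.
    by field; rewrite !gt_eqF//; lra.
  apply: ler_wpM2l => //; rewrite ler_peMr// ?mulr_ge0 ?invr_ge0 ?exprn_ge0//; try lra.
  rewrite ler_pdivlMr ?exprn_gt0//; last by lra.
  have : 0 <= (a - b) ^+ 2 by rewrite sqr_ge0.
  have : (a + b - 1) ^+ 2 <= (a + b) ^+ 2 by rewrite -subr_ge0 subr_sqr; apply: mulr_ge0; lra.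
  rewrite mul1r; lra.
apply: (le_trans (ler_sum _ (fun i _ => h i))).
rewrite -mulr_sumr big_split/=.
have -> : \sum_(i < k.+1) ((k - i).+1%:R ^+ 2)^-1 = \sum_(i < k.+1) (i.+1%:R ^+ 2)^-1 :> R.
  by rewrite (reindex_inj rev_ord_inj)/=; apply: eq_bigr => i _; rewrite subSS subKn// -ltnS.
have := sum_invsq k; set s := \sum_(i < k.+1) _ => hs.
have k0 : 0 <= k.+1%:R^-1 :> R by rewrite invr_ge0.
rewrite [leRHS](_ : _ = 2 * mw k * (2 + 2)); last by ring.
have s2 : s <= 2 by apply: (le_trans hs); rewrite gerBl.
by rewrite ler_wpM2l ?mulr_ge0 ?mw_ge0// lerD.
Qed.

Definition wd d x : R := if d then wt x else 1.
Lemma wd_ge0 d x : 0 <= wd d x. Proof. by case: d => /=; rewrite ?wt_ge0. Qed.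
Lemma wd_orM d1 d2 x : wd d1 x * wd d2 x <= wd (d1 || d2) x.
Proof.
by case: d1 d2 => [] []/=; rewrite ?mul1r ?mulr1// ler_piMr ?wt_ge0 ?wt_le1.
Qed.

Definition dst d B U V := forall k x, `|U k x - V k x| <= B * mw k * wd d x.
Definition bd d B U := forall k x, `|U k x| <= B * mw k * wd d x.

Lemma bd_ge0 d B U : bd d B U -> 0 <= B.
Proof.
move=> /(_ 0%N 0); rewrite mw0 mulr1 => /(le_trans (normr_ge0 _)).
by case: d => /=; rewrite ?mulr1// pmulr_lge0 ?wt_gt0.
Qed.

Lemma dst_ge0 d B U V : dst d B U V -> 0 <= B.
Proof. by move=> h; apply: (@bd_ge0 d B (fun k x => U k x - V k x)). Qed.

Lemma bd_le d B C U : B <= C -> bd d B U -> bd d C U.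
Proof.
by move=> BC h k x; apply: (le_trans (h k x)); rewrite !ler_wpM2r ?wd_ge0 ?mw_ge0.
Qed.

Lemma dst_le d B C U V : B <= C -> dst d B U V -> dst d C U V.
Proof. by move=> BC; exact: (@bd_le d B C (fun k x => U k x - V k x)). Qed.

Lemma bd_weaken d B U : bd d B U -> bd false B U.
Proof.
move=> h k x; apply: (le_trans (h k x)); rewrite ler_wpM2l ?mulr_ge0 ?mw_ge0 ?(bd_ge0 h)//.
by case: d {h} => /=; rewrite ?wt_le1.
Qed.

Lemma bd_cst c : bd false `|c| (jcst c).
Proof.
by case=> [|k] x; rewrite /jcst ?mw0 ?mulr1// normr0 !mulr_ge0 ?mw_ge0.
Qed.

Lemma bd_add d B C U V : bd d B U -> bd d C V -> bd d (B + C) (jadd U V).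
Proof.
move=> hU hV k x; apply: (le_trans (ler_normD _ _)).
by rewrite !mulrDl lerD.
Qed.

Lemma bd_scale d B c U : bd d B U -> bd d (`|c| * B) (jscale c U).
Proof. by move=> h k x; rewrite /jscale normrM -2!mulrA ler_wpM2l// mulrA; exact: h. Qed.

Lemma bd_sum d (I : finType) (B : I -> R) (F : I -> jet) :
  (forall i, bd d (B i) (F i)) -> bd d (\sum_i B i) (jsum F).
Proof.
move=> h k x; apply: (le_trans (ler_norm_sum _ _ _)).
by rewrite !mulr_suml; apply: ler_sum => i _; exact: h.
Qed.

Lemma conv_bound n (u v : nat -> R) A B (w1 w2 : R) : 0 <= A -> 0 <= B ->
  0 <= w1 -> 0 <= w2 ->
  (forall i, (i <= n)%N -> `|u i| <= A * mw i * w1) ->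
  (forall i, (i <= n)%N -> `|v i| <= B * mw i * w2) ->
  `|\sum_(i < n.+1) u i * v (n - i)%N| <= 8 * A * B * mw n * (w1 * w2).
Proof.
move=> A0 B0 w10 w20 hu hv; apply: (le_trans (ler_norm_sum _ _ _)).
apply: (@le_trans _ _ (\sum_(i < n.+1) A * B * (w1 * w2) * (mw i * mw (n - i)%N))).
  apply: ler_sum => i _; rewrite normrM.
  rewrite [leRHS](_ : _ = (A * mw i * w1) * (B * mw (n - i) * w2)); last by ring.
  by apply: ler_pM => //; [apply: hu; rewrite -ltnS|apply: hv; exact: leq_subr].
rewrite -mulr_sumr [leRHS](_ : _ = A * B * (w1 * w2) * (8 * mw n)); last by ring.
by rewrite ler_wpM2l ?mulr_ge0// mw_conv.
Qed.

Lemma bd_mul d1 d2 B C U V : bd d1 B U -> bd d2 C V ->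
  bd (d1 || d2) (8 * B * C) (jmul U V).
Proof.
move=> hU hV k x; have B0 := bd_ge0 hU; have C0 := bd_ge0 hV.
apply: (le_trans (conv_bound (n := k) B0 C0 (wd_ge0 d1 x) (wd_ge0 d2 x)
  (fun i _ => hU i x) (fun i _ => hV i x))).
by rewrite ler_wpM2l ?wd_orM ?mulr_ge0 ?mw_ge0.
Qed.

Lemma dst_add d B C U V U' V' : dst d B U U' -> dst d C V V' ->
  dst d (B + C) (jadd U V) (jadd U' V').
Proof.
move=> h1 h2 k x; rewrite /jadd opprD addrACA.
by apply: (le_trans (ler_normD _ _)); rewrite !mulrDl lerD.
Qed.

Lemma dst_scale d B c U V : dst d B U V -> dst d (`|c| * B) (jscale c U) (jscale c V).
Proof.
by move=> h k x; rewrite /jscale -mulrBr normrM -2!mulrA ler_wpM2l// mulrA; exact: h.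
Qed.

Lemma dst_sum d (I : finType) (B : I -> R) (F G : I -> jet) :
  (forall i, dst d (B i) (F i) (G i)) -> dst d (\sum_i B i) (jsum F) (jsum G).
Proof.
move=> h k x; rewrite /jsum -sumrB; apply: (le_trans (ler_norm_sum _ _ _)).
by rewrite !mulr_suml; apply: ler_sum => i _; exact: h.
Qed.

Lemma dst_mul d1 d2 B C D E U V U' V' :
  bd d2 C V -> bd d1 B U' -> dst d1 D U U' -> dst d2 E V V' ->
  dst (d1 || d2) (8 * (D * C + B * E)) (jmul U V) (jmul U' V').
Proof.
move=> hV hU' h1 h2 k x.
have -> : jmul U V k x - jmul U' V' k x =
    jadd (jmul (fun k x => U k x - U' k x) V) (jmul U' (fun k x => V k x - V' k x)) k x.
  by rewrite /jadd /jmul -sumrB -big_split/=; apply: eq_bigr => i _; ring.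
have := bd_add (bd_mul (U := fun k x => U k x - U' k x) h1 hV)
   (bd_mul (V := fun k x => V k x - V' k x) hU' h2) k x.
by have -> : 8 * (D * C + B * E) = 8 * D * C + 8 * B * E by ring.
Qed.

Lemma dst_refl d U : dst d 0 U U.
Proof. by move=> k x; rewrite subrr normr0 !mul0r. Qed.

Definition par e U := forall x, U 0%N (- x) = (-1) ^+ e * U 0%N x.

Lemma par_cst c : par false (jcst c).
Proof. by move=> x; rewrite expr0 mul1r. Qed.
Lemma par_add e U V : par e U -> par e V -> par e (jadd U V).
Proof. by move=> h1 h2 x; rewrite /jadd h1 h2 mulrDr. Qed.
Lemma par_scale e c U : par e U -> par e (jscale c U).
Proof. by move=> h x; rewrite /jscale h mulrCA. Qed.
Lemma par_mul e1 e2 U V : par e1 U -> par e2 V -> par (e1 (+) e2) (jmul U V).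
Proof. by move=> h1 h2 x; rewrite !jmul0 h1 h2 signr_addb mulrACA. Qed.
Lemma par_sum (I : finType) e (F : I -> jet) : (forall i, par e (F i)) ->
  par e (jsum F).
Proof. by move=> h x; rewrite /jsum mulr_sumr; apply: eq_bigr => i _; exact: h. Qed.

Lemma par_jets e U : is_jet U -> par e U ->
  forall k x, U k (- x) = (-1) ^+ (e + k) * U k x.
Proof.
move=> jU pU k; pose V : jet := fun k x => (-1) ^+ (e + k) * U k (- x).
have jV : is_jet V.
  move=> n x; have dN := is_deriveNR (is_derive_idR x).
  have dU := is_derive_compR (jU n (- x)) dN.
  apply: is_derive_eqR (is_deriveZR ((-1) ^+ (e + n)) dU) _.
  by rewrite /V addnS exprS; ring.
have e2 : U = V.
  apply: jet_ext => // x; rewrite /V addn0 pU mulrA -expr2 sqrr_sign mul1r.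
  by [].
move=> x; rewrite {1}e2 /V opprK //.
Qed.

End Jets.

(** * Differential equations for jets *)

Section JetODE.
Context {R : realType}.
Local Notation jet := (@jet R).
Implicit Types (U V F A : jet) (x y a B C D K : R) (k n : nat) (d e : bool).

(** Bootstrapping: order [n] of [Phi U] depends only on the orders up to [n] of [U] and is as
    differentiable as they are, so a differentiable solution is smooth. *)
Lemma ode_jet (Phi : jet -> jet) (y0 : R -> R) :
  (forall n U V, (forall k, (k <= n)%N -> U k = V k) -> Phi U n = Phi V n) ->
  (forall n U, jet_upto n U -> jet_upto n (Phi U)) ->
  (forall x, is_derive x 1 y0 (Phi (fun=> y0) 0%N x)) ->
  exists U, [/\ is_jet U, U 0%N = y0 & jderiv U = Phi U].
Proof.
move=> causal loc d0.
(* [Phi] expects a whole jet: [ys n] is correct up to order [n] and holds the placeholder [y0]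
   above, which causality makes harmless. The solution is the diagonal. *)
pose ys := fix ys n : jet := if n is m.+1 then
    fun k => if k == m.+1 then fun x => Phi (ys m) m x / m.+1%:R else ys m k
  else fun=> y0.
pose Y : jet := fun k => ys k k.
have ysE n k : (k <= n)%N -> ys n k = Y k.
  elim: n => [|n IH]; first by rewrite leqn0 => /eqP ->.
  rewrite leq_eqVlt => /orP[/eqP -> //|]; rewrite ltnS => kn /=.
  by rewrite ifF ?IH//; apply/negbTE; rewrite neq_ltn ltnS kn.
have YS : jderiv Y = Phi Y.
  apply/funext => k; apply/funext => x; rewrite /jderiv /Y/= eqxx.
  rewrite mulrC divfK ?pnatr_eq0//; congr (_ x).
  by apply: causal => j jk; rewrite ysE.
have YSE k : Y k.+1 = fun x => k.+1%:R^-1 * Phi Y k x.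
  by apply/funext => x; rewrite -YS /jderiv mulrA mulVf ?pnatr_eq0// mul1r.
exists Y; split=> //; apply/is_jetP; elim=> // n IH k.
rewrite ltnS leq_eqVlt => /orP[/eqP ->|]; last exact: IH.
move=> x; have -> : n.+1%:R * Y n.+1 x = Phi Y n x by rewrite -YS.
case: n IH => [|n] IH.
  apply: is_derive_eqR (d0 x) _; congr (_ x); apply: causal => j.
  by rewrite leqn0 => /eqP ->.
rewrite YSE; apply: is_derive_eqR (is_deriveZR _ (loc _ _ IH n _ x)) _ => //.
by rewrite mulrA mulVf ?pnatr_eq0// mul1r.
Qed.

Lemma jmul_causal n U U' V V' : (forall k, (k <= n)%N -> U k = U' k) ->
  (forall k, (k <= n)%N -> V k = V' k) -> jmul U V n = jmul U' V' n.
Proof.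
move=> hU hV; apply/funext => x; rewrite /jmul; apply: eq_bigr => i _.
by rewrite hU ?hV ?leq_subr// -ltnS.
Qed.

Lemma jadd_upto n U V : jet_upto n U -> jet_upto n V -> jet_upto n (jadd U V).
Proof.
move=> jU jV k kn x; apply: is_derive_eqR (is_deriveDR (jU k kn x) (jV k kn x)) _.
by rewrite mulrDr.
Qed.

Lemma jscale_upto n c U : jet_upto n U -> jet_upto n (jscale c U).
Proof.
move=> jU k kn x; apply: is_derive_eqR (is_deriveZR c (jU k kn x)) _.
by rewrite mulrCA.
Qed.

Lemma linear_ode_jet A F (y0 : R -> R) : is_jet A -> is_jet F ->
  (forall x, is_derive x 1 y0 (A 0%N x * y0 x + F 0%N x)) ->
  exists U, [/\ is_jet U, U 0%N = y0 & jderiv U = jadd (jmul A U) F].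
Proof.
move=> jA jF d0; apply: (ode_jet (Phi := fun U => jadd (jmul A U) F)).
- move=> n U V UV; apply/funext => x; rewrite /jadd; congr (_ + _).
  by rewrite (jmul_causal (U' := A) (V' := V)).
- move=> n U jU; apply: jadd_upto; last by move=> k _; exact: jF.
  by apply: jmul_upto => // k _; exact: jA.
- by move=> x; rewrite /jadd jmul0.
Qed.

(** The equation expresses order [k.+1] through the orders up to [k], and [mwS] absorbs all
    constants; a bound at order 0 thus yields all orders, whether or not the values decay. *)
Lemma linear_ode_bound A F U d B Y : bd false 2 A -> bd d B F -> 0 <= Y ->
  (forall x, `|U 0%N x| <= Y * wd d x) -> jderiv U = jadd (jmul A U) F ->
  bd d (Y + B) U.
Proof.
move=> hA hF Y0 hY e; have B0 := bd_ge0 hF.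
suff H k : forall j, (j <= k)%N -> forall x, `|U j x| <= (Y + B) * mw j * wd d x.
  by move=> k; exact: (H k k (leqnn _)).
elim: k => [j|k IH j].
  rewrite leqn0 => /eqP -> x; rewrite mw0 mulr1; apply: (le_trans (hY x)).
  by rewrite ler_wpM2r ?wd_ge0// lerDl.
rewrite leq_eqVlt => /orP[/eqP -> x|]; last exact: IH.
have k0 : 0 < k.+1%:R :> R by rewrite ltr0n.
rewrite -(ler_pM2l k0) -[X in X * `|_|](ger0_norm (ltW k0)) -normrM.
have -> : k.+1%:R * U k.+1 x = jadd (jmul A U) F k x by rewrite -e.
apply: (le_trans (ler_normD _ _)).
have h1 := conv_bound (n := k) (u := fun i => A i x) (v := fun i => U i x)
  (ler0n R 2) (addr_ge0 Y0 B0) ler01 (wd_ge0 d x) (fun i _ => hA i x) (fun i ik => IH i ik x).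
apply: (le_trans (lerD h1 (hF k x))).
have m0 : 0 <= mw k * wd d x by rewrite mulr_ge0 ?mw_ge0 ?wd_ge0.
apply: (@le_trans _ _ (32 * (Y + B) * (mw k * wd d x))).
  have : 0 <= Y * (mw k * wd d x) by rewrite mulr_ge0.
  have : 0 <= B * (mw k * wd d x) by rewrite mulr_ge0.
  rewrite mul1r; lra.
have h : mw k * wd d x <= k.+1%:R * (mw k.+1 / 32) * wd d x.
  by rewrite ler_wpM2r ?wd_ge0 ?mwS.
have YB : 0 <= 32 * (Y + B) by rewrite mulr_ge0 ?addr_ge0.
apply: (le_trans (ler_wpM2l YB h)).
by rewrite le_eqVlt; apply/orP; left; apply/eqP; field.
Qed.

Lemma tanh_jet_exists : exists T : jet, [/\ is_jet T, T 0%N = @tanh R & bd false 1 T].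
Proof.
have [|||T [jT T0 eT]] :=
    @ode_jet (fun U => jadd (jcst 1) (jscale (-1) (jmul U U))) (@tanh R).
- move=> n U V UV; apply/funext => x; rewrite /jadd /jscale.
  by rewrite (jmul_causal (U' := V) (V' := V)).
- move=> n U jU; apply: jadd_upto; first by move=> k _; exact: is_jet_cst.
  by apply: jscale_upto; exact: jmul_upto.
- move=> x; rewrite /jadd /jscale jmul0/=.
  by apply: is_derive_eqR (is_derive_tanh x) _; ring.
exists T; split=> //.
suff H k : forall j, (j <= k)%N -> forall x, `|T j x| <= 1 * mw j * 1.
  by move=> k; exact: (H k k (leqnn _)).
elim: k => [j|k IH j].
  by rewrite leqn0 => /eqP -> x; rewrite mw0 !mulr1 T0 tanh_le1.
rewrite leq_eqVlt => /orP[/eqP -> x|]; last exact: IH.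
have k0 : 0 < k.+1%:R :> R by rewrite ltr0n.
rewrite -(ler_pM2l k0) -[X in X * `|_|](ger0_norm (ltW k0)) -normrM.
have -> : k.+1%:R * T k.+1 x = jderiv T k x by [].
rewrite eT; apply: (le_trans (ler_normD _ _)).
rewrite /jscale mulN1r normrN.
have h1 := conv_bound (n := k) (u := fun i => T i x) (v := fun i => T i x)
  ler01 ler01 ler01 ler01 (fun i ik => IH i ik x) (fun i ik => IH i ik x).
have h2 := bd_cst (1 : R) k x; rewrite normr1 in h2.
apply: (le_trans (lerD h2 h1)).
have := mwS (R := R) k; have := mw_ge0 (R := R) k => /=; lra.
Qed.

Definition tj : jet := sval (cid tanh_jet_exists).
Lemma is_jet_tj : is_jet tj. Proof. by rewrite /tj; case: cid => T []. Qed.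
Lemma tj0 : tj 0%N = @tanh R. Proof. by rewrite /tj; case: cid => T []. Qed.
Lemma bd_tj : bd false 1 tj. Proof. by rewrite /tj; case: cid => T []. Qed.
Lemma par_tj : par true tj.
Proof. by move=> x; rewrite tj0 tanhN expr1 mulN1r. Qed.

Definition sj : jet := jadd (jcst 1) (jscale (-1) (jmul tj tj)).
Lemma is_jet_sj : is_jet sj.
Proof.
by apply: is_jet_add (is_jet_cst _) (is_jet_scale _ (is_jet_mul is_jet_tj is_jet_tj)).
Qed.
Lemma sj0 x : sj 0%N x = sech2 x.
Proof. by rewrite /sj /jadd /jscale jmul0 tj0 /sech2 mulN1r expr2. Qed.
Lemma par_sj : par false sj.
Proof. by move=> x; rewrite !sj0 sech2N expr0 mul1r. Qed.

Lemma bd_tj2 c : `|c| <= 2 -> bd false 2 (jscale c tj).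
Proof. by move=> c2; apply: bd_le (bd_scale c bd_tj); rewrite mulr1. Qed.

Lemma bd_zero d : bd d 0 (jcst 0 : jet).
Proof. by case=> [|k] x; rewrite /jcst normr0 !mul0r. Qed.

Lemma bd_sj : bd true 4 sj.
Proof.
rewrite -[4]addr0; apply: (linear_ode_bound (A := jscale (-2) tj) (F := jcst 0)).
- by apply: bd_tj2; rewrite normrN ger0_norm.
- exact: bd_zero.
- by [].
- move=> x; rewrite sj0 (gtr0_norm (sech2_gt0 x)); apply: (le_trans (sech2_wt x)).
  by rewrite ler_wpM2l// expr2 ler_piMr ?wt_ge0 ?wt_le1.
- apply: jet_ext.
  + exact: is_jet_deriv is_jet_sj.
  + apply: is_jet_add (is_jet_cst _).
    exact: is_jet_mul (is_jet_scale _ is_jet_tj) is_jet_sj.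
  + move=> x; have := is_jet_sj 0 x.
    have -> : sj 0%N = @sech2 R by apply/funext => y; exact: sj0.
    move=> /is_derive_unique/(_ (is_derive_sech2 x)).
    by rewrite /jderiv => ->; rewrite /jadd jmul0 /jscale/= addr0 tj0 sj0.
Qed.

(** The operator has constant coefficients, so every order of [U] solves the same scalar equation
    and the uniform factor 2 applies to each. The a priori constants [K k] may grow arbitrarily with
    [k]. *)
Lemma relax_jet_bound U F a B (K : nat -> R) : 0 < a <= 2^-1 ->
  is_jet U -> is_jet F -> (forall x, U 0%N x + a * U 1%N x = F 0%N x) ->
  bd true B F -> (forall k x, `|U k x| <= K k * wt x) -> bd true (2 * B) U.
Proof.
move=> aP jU jF e hF hK k x; have /andP[a0 _] := aP.
have an0 : a != 0 by rewrite gt_eqF.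
have E : jadd U (jscale a (jderiv U)) = F.
  apply: jet_ext => //; last by move=> y; rewrite /jadd /jscale /jderiv mul1r.
  exact: is_jet_add jU (is_jet_scale _ (is_jet_deriv jU)).
have := @relax_bound _ (F k) (U k) a (B * mw k) (K k) aP _ (hF k) (hK k) x.
rewrite mulrA; apply => y; apply: is_derive_eqR (jU k y) _.
by rewrite -E /jadd /jscale /jderiv; field.
Qed.

Lemma relax_jet_exists F a B : 0 < a <= 2^-1 -> is_jet F -> bd true B F ->
  exists U, [/\ is_jet U, bd true (2 * B) U &
    forall x, U 0%N x + a * U 1%N x = F 0%N x].
Proof.
move=> aP jF hF; have /andP[a0 _] := aP.
have an0 : a != 0 by rewrite gt_eqF.
have h0 x : `|F 0%N x| <= B * wt x by have := hF 0%N x; rewrite mw0 mulr1.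
have [y0 [dy0 by0]] := relax_exists aP (jet_cont (k := 0) jF) h0.
have [|||U [jU U0 eU]] :=
    @ode_jet (fun U => jscale a^-1 (jadd F (jscale (-1) U))) y0.
- by move=> n U V UV; apply/funext => x; rewrite /jadd /jscale UV.
- move=> n U jU; apply: jscale_upto; apply: jadd_upto.
    by move=> k _; exact: jF.
  exact: jscale_upto.
- move=> x; rewrite /jadd /jscale; apply: is_derive_eqR (dy0 x) _.
  by ring.
have E : forall k x, U k x + a * (k.+1%:R * U k.+1 x) = F k x.
  move=> k x; have -> : k.+1%:R * U k.+1 x = jderiv U k x by [].
  by rewrite eU /jadd /jscale; field.
have e0 x : U 0%N x + a * U 1%N x = F 0%N x by have := E 0%N x; rewrite mul1r.
exists U; split=> //.
(* Read off the equation order by order, these constants contain powers of [a^-1]; they serve only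
   as the a priori input of [relax_jet_bound]. *)
have /choice[K hK] : forall k, exists K, forall x, `|U k x| <= K * wt x.
  elim=> [|k [K hK]]; first by exists (2 * B) => x; rewrite U0.
  have k0 : 0 < k.+1%:R :> R by rewrite ltr0n.
  exists ((B * mw k + K) / a / k.+1%:R) => x.
  have -> : U k.+1 x = (F k x - U k x) / a / k.+1%:R.
    by rewrite -(E k x); field; rewrite an0 gt_eqF.
  rewrite !normrM !normfV (gtr0_norm a0) (gtr0_norm k0).
  rewrite [leRHS](_ : _ = (B * mw k * wt x + K * wt x) / a / k.+1%:R); last by ring.
  rewrite !ler_wpM2r ?invr_ge0 ?(ltW a0)//.
  apply: (le_trans (ler_normB _ _)); apply: lerD => //; exact: hF.
exact: relax_jet_bound aP jU jF e0 hF hK.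
Qed.

Lemma slow_jderiv (c : R) U F : is_jet U -> is_jet F ->
  (forall x, U 1%N x = c * tanh x * U 0%N x + F 0%N x) ->
  jderiv U = jadd (jmul (jscale c tj) U) F.
Proof.
move=> jU jF e; apply: jet_ext.
- exact: is_jet_deriv.
- exact: is_jet_add (is_jet_mul (is_jet_scale _ is_jet_tj) jU) jF.
- by move=> x; rewrite /jderiv mul1r e /jadd jmul0 /jscale tj0.
Qed.

Lemma jet_is_derive0 U x : is_jet U -> is_derive x 1 (U 0%N) (U 1%N x).
Proof. by move=> jU; apply: is_derive_eqR (jU 0%N x) _; rewrite mul1r. Qed.

Lemma bd_wt0 B U : bd true B U -> forall x, `|U 0%N x| <= B * wt x.
Proof. by move=> h x; have := h 0%N x; rewrite mw0 mulr1. Qed.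

Lemma even_growth_jet_bound U F B K : is_jet U -> is_jet F -> par false U ->
  (forall x, U 1%N x = 2 * tanh x * U 0%N x + F 0%N x) ->
  bd true K U -> bd true B F -> bd true (3 * B) U.
Proof.
move=> jU jF pU e hU hF; have B0 := bd_ge0 hF.
have -> : 3 * B = 2 * B + B by ring.
apply: (linear_ode_bound (bd_tj2 _) hF _ _ (slow_jderiv jU jF e)).
- by rewrite ger0_norm.
- by rewrite mulr_ge0.
- apply: (even_growth_bound (F := F 0%N) (K := K)); [|move=>x; rewrite pU mul1r //|exact: bd_wt0|exact: bd_wt0].
  by move=> x; rewrite -e; exact: jet_is_derive0.
Qed.

Lemma even_growth_jet_exists F B : is_jet F -> par true F -> bd true B F ->
  exists U, [/\ is_jet U, par false U, bd true (3 * B) U &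
    forall x, U 1%N x = 2 * tanh x * U 0%N x + F 0%N x].
Proof.
move=> jF pF hF; have B0 := bd_ge0 hF.
have [|u [du ue ub]] := even_growth_exists (jet_cont (k := 0) jF) _ (bd_wt0 hF).
  by move=> x; rewrite pF expr1 mulN1r.
have [|U [jU U0 eU]] := @linear_ode_jet (jscale 2 tj) F u (is_jet_scale _ is_jet_tj) jF.
  by move=> x; rewrite /jscale tj0; exact: du.
exists U; split=> //.
- by move=> x; rewrite U0 ue mul1r.
- have -> : 3 * B = 2 * B + B by ring.
  apply: (linear_ode_bound (bd_tj2 _) hF _ _ eU).
  + by rewrite ger0_norm.
  + by rewrite mulr_ge0.
  + by rewrite U0.
- move=> x; have : jderiv U 0%N x = U 1%N x by rewrite /jderiv mul1r.
  by rewrite eU /jadd jmul0 /jscale tj0 => <-.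
Qed.

Lemma odd_decay_jet_bound U F B : is_jet U -> is_jet F -> par true U ->
  (forall x, U 1%N x = - 2 * tanh x * U 0%N x + F 0%N x) ->
  bd true B F -> bd true (5 * B) U.
Proof.
move=> jU jF pU e hF; have B0 := bd_ge0 hF.
have -> : 5 * B = 4 * B + B by ring.
apply: (linear_ode_bound (bd_tj2 _) hF _ _ (slow_jderiv jU jF e)).
- by rewrite normrN ger0_norm.
- by rewrite mulr_ge0.
- apply: (odd_decay_bound (F := F 0%N)); [|move=>x; rewrite pU expr1 mulN1r //|exact: bd_wt0].
  by move=> x; rewrite -e; exact: jet_is_derive0.
Qed.

Lemma odd_decay_jet_exists F B : is_jet F -> par false F -> bd true B F ->
  exists U, [/\ is_jet U, par true U, bd true (5 * B) U &
    forall x, U 1%N x = - 2 * tanh x * U 0%N x + F 0%N x].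
Proof.
move=> jF pF hF; have B0 := bd_ge0 hF.
have [|u [du uo]] := odd_decay_exists (jet_cont (k := 0) jF).
  by move=> x; rewrite pF mul1r.
have [|U [jU U0 eU]] := @linear_ode_jet (jscale (-2) tj) F u (is_jet_scale _ is_jet_tj) jF.
  by move=> x; rewrite /jscale tj0; exact: du.
have pU : par true U by move=> x; rewrite U0 uo expr1 mulN1r.
have e x : U 1%N x = - 2 * tanh x * U 0%N x + F 0%N x.
  have : jderiv U 0%N x = U 1%N x by rewrite /jderiv mul1r.
  by rewrite eU /jadd jmul0 /jscale tj0 => <-.
by exists U; split=> //; exact: odd_decay_jet_bound jU jF pU e hF.
Qed.

End JetODE.

(** * Limits of jets *)

Section Completeness.
Context {R : realType}.
Local Notation jet := (@jet R).
Implicit Types (U V W : jet) (x y e B C D : R) (k n : nat) (d : bool).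

Lemma is_derive_taylor (f : R -> R) x l C :
  (forall h, `|f (x + h) - f x - h * l| <= C * h ^+ 2) -> is_derive x 1 f l.
Proof.
move=> hf.
have C0 : 0 <= C by have := hf 1; rewrite expr1n mulr1; apply: le_trans.
have cv : (fun h : R => h^-1 *: ((f \o shift x) (h *: (1 : R)) - f x)) @ 0^' --> l.
  apply/cvgrPdist_le => e e0.
  have C1 : 0 < C + 1 by rewrite ltr_wpDl.
  have e1 : 0 < e / (C + 1) by rewrite divr_gt0.
  near=> h.
  have h0 : h != 0 by near: h; exact: nbhs_dnbhs_neq.
  have he : `|h| <= e / (C + 1).
    near: h; apply: dnbhs0_le => //.
  rewrite /= /GRing.scale/= mulr1 [h + x]addrC.
  have -> : l - h^-1 * (f (x + h) - f x) = - (h^-1 * (f (x + h) - f x - h * l)).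
    by field.
  rewrite normrN normrM normfV ler_pdivrMl ?normr_gt0//.
  apply: (le_trans (hf h)).
  rewrite -(real_normK (num_real h)) expr2 mulrA [leRHS]mulrC ler_wpM2r//.
  apply: (@le_trans _ _ ((C + 1) * `|h|)).
    by rewrite ler_wpM2r// lerDl.
  by rewrite mulrC -ler_pdivlMr.
apply: DeriveDef; first by apply/cvg_ex; exists l.
exact: cvg_lim cv.
Unshelve. all: by end_near. Qed.

Lemma jet_taylor U d B k x h : is_jet U -> bd d B U ->
  `|U k (x + h) - U k x - h * (k.+1%:R * U k.+1 x)|
    <= k.+1%:R * k.+2%:R * B * mw k.+2 * h ^+ 2.
Proof.
move=> jU hB; have B0 := bd_ge0 hB.
wlog d0 : d hB / d = false by move=> H; apply: (H false) => //; exact: bd_weaken hB.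
have lip z y : `|U k.+1 y - U k.+1 z| <= k.+2%:R * B * mw k.+2 * `|y - z|.
  wlog zy : y z / z <= y.
    move=> H; case: (leP z y) => [/H//|/ltW /H].
    by rewrite distrC [`|z - y|]distrC.
  have [c _ ->] := MVTR zy (jU k.+1).
  rewrite !normrM normr_nat ler_wpM2r// -mulrA ler_wpM2l//.
  by have := hB k.+2 c; rewrite d0 mulr1.
have [c [cx ->]] : exists c, `|c - x| <= `|h| /\ U k (x + h) - U k x = k.+1%:R * U k.+1 c * h.
  case: (leP 0 h) => h0.
    have xh : x <= x + h by rewrite lerDl.
    have [c /andP[c1 c2] e] := MVTR xh (jU k).
    exists c; split; last by rewrite e addrAC subrr add0r.
    by rewrite !ger0_norm//; lra.
  have xh : x + h <= x by rewrite gerDl ltW.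
  have [c /andP[c1 c2] e] := MVTR xh (jU k).
  exists c; split; first by rewrite [`|h|]ltr0_norm// ler0_norm; lra.
  by rewrite -opprB e; ring.
have -> : k.+1%:R * U k.+1 c * h - h * (k.+1%:R * U k.+1 x) =
  k.+1%:R * (h * (U k.+1 c - U k.+1 x)) by ring.
rewrite !normrM normr_nat -!mulrA ler_wpM2l//.
rewrite [leRHS](_ : _ = `|h| * (k.+2%:R * B * mw k.+2 * `|h|)); last first.
  by rewrite -(real_normK (num_real h)); ring.
rewrite ler_wpM2l//; apply: (le_trans (lip x c)).
by rewrite ler_wpM2l// !mulr_ge0// mw_ge0.
Qed.

Lemma le_eps (a b c : R) : (forall e, 0 < e -> a <= b + c * e) -> a <= b.
Proof.
move=> h; apply/ler_addgt0Pr => e e0.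
case: (leP c 0) => c0.
  apply: (le_trans (h 1 ltr01)); rewrite lerD2l mulr1; exact: le_trans (ltW e0).
have := h (e / c) (divr_gt0 e0 c0); rewrite mulrC divfK// gt_eqF//.
Qed.

Definition jlimit d B U := forall e, 0 < e ->
  exists V, [/\ is_jet V, bd d B V & dst d e V U].

Lemma jlimit_bd d B U : jlimit d B U -> bd d B U.
Proof.
move=> h k x; apply: (@le_eps _ _ (mw k * wd d x)) => e /h[V [_ hV hVU]].
have := hV k x; have := hVU k x => h1 h2.
have : `|U k x| <= `|V k x - U k x| + `|V k x|.
  by rewrite distrC -{1}[U k x](subrK (V k x)) ler_normD.
lra.
Qed.

(** The second-order Taylor remainder has a constant that is uniform on balls, so it passes to the
    limit; a quadratic remainder then identifies the derivative. *)
Lemma jlimit_jet d B U : jlimit d B U -> is_jet U.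
Proof.
move=> hl k x; apply: (@is_derive_taylor _ _ _ (k.+1%:R * k.+2%:R * B * mw k.+2)) => h.
apply: (@le_eps _ _ (mw k * 2 + `|h| * (k.+1%:R * mw k.+1))) => e e0.
have [V [jV hV hVU]] := hl e e0.
have hT := jet_taylor k x h jV hV.
have hd j z : `|V j z - U j z| <= e * mw j.
  apply: (le_trans (hVU j z)); rewrite ler_piMr ?mulr_ge0 ?mw_ge0 ?(ltW e0)//.
  by case: (d) => //=; rewrite wt_le1.
have -> : U k (x + h) - U k x - h * (k.+1%:R * U k.+1 x) =
  (V k (x + h) - V k x - h * (k.+1%:R * V k.+1 x)) - (V k (x + h) - U k (x + h))
  + (V k x - U k x) + h * (k.+1%:R * (V k.+1 x - U k.+1 x)) by ring.
apply: (le_trans (ler_normD _ _)); apply: (le_trans (lerD (ler_normD _ _) (lexx _))).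
apply: (le_trans (lerD (lerD (ler_normB _ _) (lexx _)) (lexx _))).
have h3 : `|h * (k.+1%:R * (V k.+1 x - U k.+1 x))| <= `|h| * (k.+1%:R * (e * mw k.+1)).
  by rewrite !normrM normr_nat !ler_wpM2l.
have := hd k x; have := hd k (x + h); move: hT h3 => h1 h2 h3 h4.
lra.
Qed.

Lemma eq0_eps (a c : R) : (forall e, 0 < e -> `|a| <= c * e) -> a = 0.
Proof.
move=> h; apply/eqP; rewrite -normr_le0; apply: (@le_eps _ _ c) => e /h.
by rewrite add0r.
Qed.

Lemma jlimit_par d B U p : (forall e, 0 < e ->
  exists V, [/\ par p V, bd d B V & dst d e V U]) -> par p U.
Proof.
move=> h x; apply/eqP; rewrite -subr_eq0; apply/eqP; apply: (@eq0_eps _ 2) => e e0.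
have [V [pV _ hVU]] := h e e0.
have hd z : `|V 0%N z - U 0%N z| <= e.
  apply: (le_trans (hVU 0%N z)); rewrite mw0 mulr1 ler_piMr ?(ltW e0)//.
  by case: (d) => //=; rewrite wt_le1.
have -> : U 0%N (- x) - (-1) ^+ p * U 0%N x =
  - (V 0%N (- x) - U 0%N (- x)) + (-1) ^+ p * (V 0%N x - U 0%N x).
  by rewrite pV; ring.
apply: (le_trans (ler_normD _ _)); rewrite normrN normrM normr_sign mul1r.
by have := hd x; have := hd (- x); lra.
Qed.

Lemma geometric_small (C e : R) : 0 < e -> exists n, C / 2 ^+ n < e.
Proof.
move=> e0; exists (Num.bound (`|C| / e)).
have : `|C| / e < (Num.bound (`|C| / e))%:R.
  by apply: archi_boundP; rewrite divr_ge0// ltW.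
set n := Num.bound _ => hn.
rewrite ltr_pdivrMr ?exprn_gt0//.
have h2 : n%:R <= 2 ^+ n :> R.
  by rewrite -natrX ler_nat ltnW// ltn_expl.
rewrite ltr_pdivrMr// in hn.
apply: (le_lt_trans (ler_norm C)); apply: (lt_le_trans hn).
by rewrite mulrC ler_wpM2l// ltW.
Qed.

(** The intervals of radius [C / 2 ^+ n] around [u n] are nested, and [l] is the supremum of their
    left endpoints. *)
Lemma geometric_cauchy (u : nat -> R) C :
  (forall n, `|u n.+1 - u n| <= C / 2 ^+ n.+1) ->
  exists l, forall n, `|u n - l| <= C / 2 ^+ n.
Proof.
move=> hu.
have C0 : 0 <= C.
  have := le_trans (normr_ge0 _) (hu 0%N); rewrite expr1; lra.
have p n : 0 <= C / 2 ^+ n by rewrite divr_ge0// exprn_ge0.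
have hS n : C / 2 ^+ n = C / 2 ^+ n.+1 + C / 2 ^+ n.+1.
  by rewrite exprS; field; rewrite gt_eqF// exprn_gt0.
have mono m n : (m <= n)%N -> u m - C / 2 ^+ m <= u n - C / 2 ^+ n /\
    u n + C / 2 ^+ n <= u m + C / 2 ^+ m.
  elim: n => [|n IH]; first by rewrite leqn0 => /eqP ->.
  rewrite leq_eqVlt => /orP[/eqP -> //|]; rewrite ltnS => /IH[h1 h2].
  by have := hu n; have := hS n; rewrite ler_norml => h /andP[]; split; lra.
pose S := range (fun n => u n - C / 2 ^+ n).
have ub m : ubound S (u m + C / 2 ^+ m).
  move=> _ [n _ <-]; case: (leqP n m) => [/mono[h _]|/ltnW/mono[_ h]].
    by apply: (le_trans h); have := p m; lra.
  by apply: le_trans h; have := p n; lra.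
have hS' : has_sup S.
  by split; [exists (u 0%N - C / 2 ^+ 0), 0%N|exists (u 0%N + C / 2 ^+ 0)].
exists (sup S) => n.
have h1 : u n - C / 2 ^+ n <= sup S by apply: ub_le_sup; [case: hS'|exists n].
have h2 : sup S <= u n + C / 2 ^+ n by apply: ge_sup; [case: hS'|exact: ub].
by rewrite ler_norml; apply/andP; split; lra.
Qed.

End Completeness.

(** * Fixed points *)

Section FixedPoint.
Context {R : realType} {V : Type} (pv : V -> bool).
Local Notation jet := (@jet R).
Implicit Types (Z : V -> jet) (M : R).

Definition good M Z := forall v, [/\ is_jet (Z v), par (pv v) (Z v) & bd true M (Z v)].

(** [step] is a relation since the linear solve is known through existence and estimates only. The
    contraction hypothesis covers all admissible outputs, so it also forces the chosen [T Z] to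
    coincide with the limit [Z] of the iterates. *)
Lemma contraction_fixpoint M (step : (V -> jet) -> (V -> jet) -> Prop) :
  0 <= M ->
  (forall Z, good M Z -> exists2 Z', good M Z' & step Z Z') ->
  (forall Z1 Z2 Z1' Z2' D, good M Z1 -> good M Z2 -> good M Z1' -> good M Z2' ->
     step Z1 Z1' -> step Z2 Z2' -> (forall v, dst true D (Z1 v) (Z2 v)) ->
     forall v, dst true (D / 2) (Z1' v) (Z2' v)) ->
  exists2 Z, good M Z & step Z Z.
Proof.
move=> M0 ex ct.
have /choice[T HT] : forall Z, exists Z', good M Z -> good M Z' /\ step Z Z'.
  move=> Z; case: (pselect (good M Z)) => [/ex[Z' h1 h2]|h]; first by exists Z'.
  by exists Z => /h.
pose Zn n := iter n T (fun=> jcst 0 : jet).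
have gn n : good M (Zn n).
  elim: n => [v|n IH]; last by have [] := HT _ IH.
  split; first exact: is_jet_cst; first by move=> x; rewrite mulr0.
  by apply: bd_le (bd_zero _).
have sn n : step (Zn n) (Zn n.+1) by have [] := HT _ (gn n).
(* [4 * M / 2] bounds the distance between two elements of the ball of radius [M]. *)
have dn n v : dst true (4 * M / 2 ^+ n.+1) (Zn n.+1 v) (Zn n v).
  elim: n v => [v k x|n IH v].
    have [_ _ h1] := gn 1%N v; have [_ _ h0] := gn 0%N v.
    apply: (le_trans (ler_normB _ _)); apply: (le_trans (lerD (h1 k x) (h0 k x))).
    by rewrite le_eqVlt expr1; apply/orP; left; apply/eqP; field.
  have := ct _ _ _ _ _ (gn n.+1) (gn n) (gn n.+2) (gn n.+1) (sn n.+1) (sn n) IH v.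
  by apply: dst_le; rewrite [in leRHS]exprS invfM; lra.
have lim v k x : exists l, forall n, `|Zn n v k x - l| <= 4 * M * mw k * wt x / 2 ^+ n.
  apply: geometric_cauchy => n; apply: (le_trans (dn n v k x)).
  by rewrite le_eqVlt; apply/orP; left; apply/eqP; rewrite /wd; ring.
have /choice[Z HZ] : forall v, exists U : jet, forall n, dst true (4 * M / 2 ^+ n) (Zn n v) U.
  move=> v; have /choice[U HU] : forall k, exists u : R -> R, forall x n,
      `|Zn n v k x - u x| <= 4 * M * mw k * wt x / 2 ^+ n.
    by move=> k; have /choice[u hu] := lim v k; exists u.
  exists U => n k x; apply: (le_trans (HU k x n)).
  by rewrite le_eqVlt; apply/orP; left; apply/eqP; rewrite /wd; ring.
have close v e : 0 < e -> exists n, dst true e (Zn n v) (Z v).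
  move=> e0; have [n hn] := geometric_small (4 * M) e0.
  by exists n; apply: dst_le (HZ v n); exact: ltW.
have gZ : good M Z.
  move=> v; have hl : jlimit true M (Z v).
    move=> e /(close v)[n hn]; exists (Zn n v); have [] := gn n v; split=> //.
  split; [exact: jlimit_jet hl| |exact: jlimit_bd hl].
  apply: (@jlimit_par _ true M) => e /(close v)[n hn].
  by exists (Zn n v); have [] := gn n v; split.
have [gT sT] := HT _ gZ.
exists Z => //; suff eTZ : T Z = Z by rewrite eTZ in sT.
apply/funext => v; apply/funext => k; apply/funext => x.
apply/eqP; rewrite -subr_eq0; apply/eqP; apply: (@eq0_eps _ _ (mw k * wt x)) => e e0.
have [n hn] := geometric_small (4 * M) e0.
have dZ w : dst true (4 * M / 2 ^+ n) (Z w) (Zn n w).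
  by move=> j y; rewrite distrC; exact: HZ.
have h1 := ct _ _ _ _ _ gZ (gn n) gT (gn n.+1) sT (sn n) dZ v k x.
have h2 := HZ v n.+1 k x.
have : `|T Z v k x - Z v k x| <= `|T Z v k x - Zn n.+1 v k x| + `|Zn n.+1 v k x - Z v k x|.
  by rewrite -{1}[T Z v k x](subrK (Zn n.+1 v k x)) -addrA ler_normD.
move/le_trans; apply; apply: (le_trans (lerD h1 h2)).
have w0 : 0 <= mw k * wt x by rewrite mulr_ge0 ?mw_ge0 ?wt_ge0.
apply: (@le_trans _ _ ((4 * M / 2 ^+ n) * (mw k * wt x))).
  by rewrite le_eqVlt [in X in X == _]exprS invfM /wd; apply/orP; left; apply/eqP; field; rewrite gt_eqF// exprn_gt0.
by rewrite mulrC ler_wpM2l// ltW.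
Qed.

End FixedPoint.

(** * Functionals of the unknowns *)

Section RegularFunctionals.
Context {R : realType} {V : Type} (pv : V -> bool).
Local Notation jet := (@jet R).
Local Notation good := (@good R V pv).
Implicit Types (F G : R -> (V -> jet) -> jet) (Z : V -> jet) (e d : bool) (dl M L D : R).

(** Differentiation does not preserve the norm, since [k.+1%:R * mw k.+1] is not bounded by a
    multiple of [mw k]. Bounds on all iterated derivatives are therefore part of the definition;
    they are used for the forcing [rsig], which contains the derivative of a fixed jet. *)
Definition bounded_jet e d (U : jet) :=
  [/\ is_jet U, par e U & forall m, exists2 B, 0 <= B & bd d B (iter m jderiv U)].

Lemma bounded_jet_bd e d (U : jet) : bounded_jet e d U -> exists2 B, 0 <= B & bd d B U.
Proof. by move=> [_ _ /(_ 0%N)]. Qed.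

Lemma jderiv_mul (U W : jet) : is_jet U -> is_jet W ->
  jderiv (jmul U W) = jadd (jmul (jderiv U) W) (jmul U (jderiv W)).
Proof.
move=> jU jW; apply: jet_ext.
- exact: is_jet_deriv (is_jet_mul jU jW).
- exact: is_jet_add (is_jet_mul (is_jet_deriv jU) jW) (is_jet_mul jU (is_jet_deriv jW)).
- move=> x; rewrite /jadd !jmul0 /jderiv /jmul big_ord_recl big_ord1 /= /bump /=.
  by rewrite !mul1r addrC.
Qed.

Lemma par_deriv e (U : jet) : is_jet U -> par e U -> par (~~ e) (jderiv U).
Proof.
move=> jU pU x; rewrite /jderiv !mul1r (par_jets jU pU).
by case: e {pU}; rewrite /= ?sqrrN ?expr1n.
Qed.

Definition regular e d F := forall M, 0 <= M -> exists2 L, 0 <= L &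
  forall dl Z, 0 < dl <= 1 -> good M Z ->
    [/\ is_jet (F dl Z), par e (F dl Z), bd d L (F dl Z) &
      forall Z' D, 0 <= D -> good M Z' -> (forall v, dst true D (Z v) (Z' v)) ->
        dst d (L * D) (F dl Z) (F dl Z')].

Lemma regular_cst e d (U : jet) : bounded_jet e d U -> regular e d (fun _ _ => U).
Proof.
move=> bU M M0; have [B B0 hB] := bounded_jet_bd bU; have [jU pU _] := bU.
exists B => // dl Z _ gZ; split=> // Z' D D0 gZ' h.
by apply: dst_le (dst_refl d U); rewrite mulr_ge0.
Qed.

Lemma regular_var v : regular (pv v) true (fun _ Z => Z v).
Proof.
move=> M M0; exists (M + 1); first by rewrite addr_ge0.
move=> dl Z _ gZ; have [jZ pZ bZ] := gZ v; split=> //.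
  by apply: bd_le bZ; rewrite lerDl.
move=> Z' D D0 gZ' h; apply: dst_le (h v).
by rewrite ler_peMl// lerDr.
Qed.

Lemma regular_add e d F G : regular e d F -> regular e d G ->
  regular e d (fun dl Z => jadd (F dl Z) (G dl Z)).
Proof.
move=> hF hG M M0; have [L1 L10 h1] := hF M M0; have [L2 L20 h2] := hG M M0.
exists (L1 + L2); first by rewrite addr_ge0.
move=> dl Z hd gZ; have [a1 b1 c1 d1] := h1 dl Z hd gZ.
have [a2 b2 c2 d2] := h2 dl Z hd gZ; split.
- exact: is_jet_add.
- exact: par_add.
- exact: bd_add.
- by move=> Z' D D0 gZ' h; rewrite mulrDl; apply: dst_add; [exact: d1|exact: d2].
Qed.

Lemma regular_scale e d F (c : R -> R) C :
  (forall dl, 0 < dl <= 1 -> `|c dl| <= C) -> regular e d F ->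
  regular e d (fun dl Z => jscale (c dl) (F dl Z)).
Proof.
move=> hc hF M M0; have [L1 L10 h1] := hF M M0.
have C0 : 0 <= C.
  have h : 0 < (1 : R) <= 1 by rewrite ltr01 lexx.
  exact: le_trans (normr_ge0 _) (hc 1 h).
exists (C * L1); first by rewrite mulr_ge0.
move=> dl Z hd gZ; have [a1 b1 c1 d1] := h1 dl Z hd gZ; split.
- exact: is_jet_scale.
- exact: par_scale.
- by apply: bd_le (bd_scale (c dl) c1); rewrite ler_wpM2r// hc.
- move=> Z' D D0 gZ' h; apply: dst_le (dst_scale (c dl) (d1 _ _ D0 gZ' h)).
  by rewrite -mulrA ler_wpM2r ?hc// mulr_ge0.
Qed.

Lemma regular_mul e1 e2 d1 d2 F G : regular e1 d1 F -> regular e2 d2 G ->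
  regular (e1 (+) e2) (d1 || d2) (fun dl Z => jmul (F dl Z) (G dl Z)).
Proof.
move=> hF hG M M0; have [L1 L10 h1] := hF M M0; have [L2 L20 h2] := hG M M0.
exists (16 * L1 * L2); first by rewrite !mulr_ge0.
move=> dl Z hd gZ; have [a1 b1 c1 q1] := h1 dl Z hd gZ.
have [a2 b2 c2 q2] := h2 dl Z hd gZ; split.
- exact: is_jet_mul.
- exact: par_mul.
- apply: bd_le (bd_mul c1 c2).
  have : 0 <= L1 * L2 by rewrite mulr_ge0.
  lra.
- move=> Z' D D0 gZ' h; have [_ _ c1' _] := h1 dl Z' hd gZ'.
  have := dst_mul c2 c1' (q1 _ _ D0 gZ' h) (q2 _ _ D0 gZ' h).
  by apply: dst_le; rewrite le_eqVlt; apply/orP; left; apply/eqP; ring.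
Qed.

Lemma regular_sum e d (I : finType) (F : I -> R -> (V -> jet) -> jet) :
  (forall i, regular e d (F i)) -> regular e d (fun dl Z => jsum (fun i => F i dl Z)).
Proof.
move=> hF M M0; have /choice[L hL] : forall i, exists L, 0 <= L /\
    forall dl Z, 0 < dl <= 1 -> good M Z ->
    [/\ is_jet (F i dl Z), par e (F i dl Z), bd d L (F i dl Z) &
      forall Z' D, 0 <= D -> good M Z' -> (forall v, dst true D (Z v) (Z' v)) ->
        dst d (L * D) (F i dl Z) (F i dl Z')].
  by move=> i; have [L L0 h] := hF i M M0; exists L.
exists (\sum_i L i); first by apply: sumr_ge0 => i _; case: (hL i).
move=> dl Z hd gZ; have h i : [/\ is_jet (F i dl Z), par e (F i dl Z), bd d (L i) (F i dl Z) &
      forall Z' D, 0 <= D -> good M Z' -> (forall v, dst true D (Z v) (Z' v)) ->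
        dst d (L i * D) (F i dl Z) (F i dl Z')] by have [_ q] := hL i; exact: q.
split.
- by apply: is_jet_sum => i; have [] := h i.
- by apply: par_sum => i; have [] := h i.
- by apply: bd_sum => i; have [] := h i.
- move=> Z' D D0 gZ' hD; rewrite mulr_suml; apply: dst_sum => i.
  by have [_ _ _ q] := h i; exact: q.
Qed.

Lemma regular_weaken e d F : regular e d F -> regular e false F.
Proof.
move=> hF M M0; have [L L0 h] := hF M M0; exists L => // dl Z hd gZ.
have [h1 h2 h3 h4] := h dl Z hd gZ; split=> //; first exact: bd_weaken h3.
move=> Z' D D0 gZ' hD.
exact: (@bd_weaken _ d (L * D) (fun k x => F dl Z k x - F dl Z' k x)) (h4 _ _ D0 gZ' hD).
Qed.

(* [rfun m e d] represents the functionals [F0 + dl ^+ m F1], with [F0] a fixed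
   jet and [F1] bounded and Lipschitz on balls, uniformly in [dl]; the
   indices [e] and [d] record the parity and the decay of the values. *)
Record rfun (m : nat) e d := Rfun {
  rlead : jet;
  rtail : R -> (V -> jet) -> jet;
  rleadP : bounded_jet e d rlead;
  rtailP : regular e d rtail }.

Definition reval m e d (F : rfun m e d) : R -> (V -> jet) -> jet :=
  fun dl Z => jadd (rlead F) (jscale (dl ^+ m) (rtail F dl Z)).

Definition rval m e d (F : rfun m e d) dl Z x : R := reval F dl Z 0%N x.

Lemma expr_norm_le1 m dl : 0 < dl <= 1 -> `|dl ^+ m| <= 1.
Proof.
by move=> /andP[d0 d1]; rewrite ger0_norm ?exprn_ge0 ?exprn_ile1// ltW.
Qed.

Lemma bounded_jet_weaken e d U : bounded_jet e d U -> bounded_jet e false U.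
Proof.
move=> [a1 b1 h]; split=> // m; have [B B0 c1] := h m.
by exists B => //; exact: bd_weaken c1.
Qed.

Lemma bounded_jet_deriv e d U : bounded_jet e d U -> bounded_jet (~~ e) d (jderiv U).
Proof.
move=> [a1 b1 h]; split; [exact: is_jet_deriv|exact: par_deriv|move=> m].
by rewrite -iterSr; exact: h.
Qed.

Lemma jderiv_add (U W : jet) : jderiv (jadd U W) = jadd (jderiv U) (jderiv W).
Proof. by apply/funext => k; apply/funext => x; rewrite /jderiv /jadd mulrDr. Qed.

Lemma jderiv_scale c (U : jet) : jderiv (jscale c U) = jscale c (jderiv U).
Proof. by apply/funext => k; apply/funext => x; rewrite /jderiv /jscale mulrCA. Qed.

Lemma jderiv_cst (c : R) : jderiv (jcst c) = jcst 0 :> jet.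
Proof.
by apply/funext => k; apply/funext => x; rewrite /jderiv/= mulr0; case: k.
Qed.

Lemma iter_jderiv_add m (U W : jet) :
  iter m jderiv (jadd U W) = jadd (iter m jderiv U) (iter m jderiv W).
Proof. by elim: m => //= m ->; exact: jderiv_add. Qed.

Lemma iter_jderiv_scale m c (U : jet) :
  iter m jderiv (jscale c U) = jscale c (iter m jderiv U).
Proof. by elim: m => //= m ->; exact: jderiv_scale. Qed.

Definition jbounded d (U : jet) := exists2 B, 0 <= B & bd d B U.

Lemma jbounded_add d U W : jbounded d U -> jbounded d W -> jbounded d (jadd U W).
Proof.
by move=> [B B0 h] [C C0 h']; exists (B + C); [rewrite addr_ge0|exact: bd_add].
Qed.

Lemma jbounded_scale d c U : jbounded d U -> jbounded d (jscale c U).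
Proof.
by move=> [B B0 h]; exists (`|c| * B); [rewrite mulr_ge0|exact: bd_scale].
Qed.

Lemma jbounded_cst c m : jbounded false (iter m jderiv (jcst c)).
Proof.
elim: m c => [|m IH] c; first by exists `|c| => //; exact: bd_cst.
by rewrite iterSr jderiv_cst.
Qed.

Lemma jbounded_zero d m : jbounded d (iter m jderiv (jcst 0)).
Proof.
elim: m => [|m IH]; first by exists 0 => //; exact: bd_zero.
by rewrite iterSr jderiv_cst.
Qed.

Lemma iter_jderiv_mul m d1 d2 (U W : jet) : is_jet U -> is_jet W ->
  (forall j, (j <= m)%N -> jbounded d1 (iter j jderiv U)) ->
  (forall j, (j <= m)%N -> jbounded d2 (iter j jderiv W)) ->
  forall j, (j <= m)%N -> jbounded (d1 || d2) (iter j jderiv (jmul U W)).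
Proof.
have b0 (U' W' : jet) : jbounded d1 U' -> jbounded d2 W' -> jbounded (d1 || d2) (jmul U' W').
  move=> [B B0 h] [C C0 h']; exists (8 * B * C); first by rewrite !mulr_ge0.
  exact: bd_mul.
elim: m U W => [|m IH] U W jU jW hU hW [|j] jm //; [|by apply: b0; [exact: (hU 0%N)|exact: (hW 0%N)]|].
  by apply: b0; [exact: (hU 0%N)|exact: (hW 0%N)].
rewrite iterSr jderiv_mul// iter_jderiv_add; apply: jbounded_add.
  apply: IH => //; first exact: is_jet_deriv.
    by move=> i im; rewrite -iterSr; exact: hU.
  by move=> i im; apply: hW; exact: leqW.
apply: IH => //; first exact: is_jet_deriv.
  by move=> i im; apply: hU; exact: leqW.
by move=> i im; rewrite -iterSr; exact: hW.
Qed.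

Lemma bounded_jet_cst c : bounded_jet false false (jcst c).
Proof. by split; [exact: is_jet_cst|exact: par_cst|exact: jbounded_cst]. Qed.

Lemma bounded_jet0 e d : bounded_jet e d (jcst 0).
Proof.
by split; [exact: is_jet_cst|move=> x; rewrite mulr0|exact: jbounded_zero].
Qed.

Lemma bounded_jet_add e d U W : bounded_jet e d U -> bounded_jet e d W ->
  bounded_jet e d (jadd U W).
Proof.
move=> [a1 b1 h1] [a2 b2 h2].
split; [exact: is_jet_add|exact: par_add|move=> m].
by rewrite iter_jderiv_add; apply: jbounded_add; [exact: h1|exact: h2].
Qed.

Lemma bounded_jet_scale e d c U : bounded_jet e d U -> bounded_jet e d (jscale c U).
Proof.
move=> [a1 b1 h1].
split; [exact: is_jet_scale|exact: par_scale|move=> m].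
by rewrite iter_jderiv_scale; apply: jbounded_scale; exact: h1.
Qed.

Lemma bounded_jet_mul e1 e2 d1 d2 U W : bounded_jet e1 d1 U -> bounded_jet e2 d2 W ->
  bounded_jet (e1 (+) e2) (d1 || d2) (jmul U W).
Proof.
move=> [a1 b1 h1] [a2 b2 h2].
split; [exact: is_jet_mul|exact: par_mul|move=> m].
by apply: (@iter_jderiv_mul m) => // j _; [exact: h1|exact: h2].
Qed.

Lemma bounded_jet_sum e d (I : finType) (F : I -> jet) :
  (forall i, bounded_jet e d (F i)) -> bounded_jet e d (jsum F).
Proof.
move=> h; split; first by apply: is_jet_sum => i; case: (h i).
  by apply: par_sum => i; case: (h i).
move=> m; have -> : iter m jderiv (jsum F) = jsum (fun i => iter m jderiv (F i)).
  elim: m => //= m ->; apply/funext => k; apply/funext => x.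
  by rewrite /jderiv /jsum mulr_sumr.
have /choice[B hB] : forall i, exists B, 0 <= B /\ bd d B (iter m jderiv (F i)).
  by move=> i; have [_ _ /(_ m)[B B0 hB]] := h i; exists B.
exists (\sum_i B i); first by apply: sumr_ge0 => i _; case: (hB i).
by apply: bd_sum => i; case: (hB i).
Qed.

Lemma jderiv_tj : jderiv tj = sj :> jet.
Proof.
apply: jet_ext; [exact: is_jet_deriv is_jet_tj|exact: is_jet_sj|move=> x].
rewrite /jderiv mul1r sj0; have := jet_is_derive0 x (@is_jet_tj R).
by rewrite tj0 => /is_derive_unique; apply; exact: is_derive_tanh.
Qed.

Lemma jderiv_sj : jderiv sj = jscale (-2) (jmul tj sj) :> jet.
Proof.
apply: jet_ext; first exact: is_jet_deriv is_jet_sj.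
  exact: is_jet_scale _ (is_jet_mul is_jet_tj is_jet_sj).
move=> x; rewrite /jderiv mul1r /jscale jmul0 tj0 sj0.
have := jet_is_derive0 x (@is_jet_sj R).
have -> : sj 0%N = @sech2 R by apply/funext => y; exact: sj0.
by move=> /is_derive_unique/(_ (is_derive_sech2 x)) ->; rewrite mulrA.
Qed.

Lemma bounded_jet_tj : bounded_jet true false tj.
Proof.
split; [exact: is_jet_tj|exact: par_tj|].
suff H m : forall j, (j <= m)%N -> jbounded false (iter j jderiv tj).
  by move=> m; exact: (H m m (leqnn _)).
have t0 : jbounded false tj by exists 1 => //; exact: bd_tj.
elim: m => [|m IH] [|j] //; rewrite ltnS => jm.
rewrite iterSr jderiv_tj /sj iter_jderiv_add iter_jderiv_scale.
apply: jbounded_add; first exact: jbounded_cst.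
apply: jbounded_scale.
exact: (iter_jderiv_mul is_jet_tj is_jet_tj IH IH).
Qed.

Lemma bounded_jet_sj : bounded_jet false true sj.
Proof.
split; [exact: is_jet_sj|exact: par_sj|].
suff H m : forall j, (j <= m)%N -> jbounded true (iter j jderiv sj).
  by move=> m; exact: (H m m (leqnn _)).
have s0 : jbounded true sj by exists 4 => //; exact: bd_sj.
have [_ _ ht] := bounded_jet_tj.
elim: m => [|m IH] [|j] //; rewrite ltnS => jm.
rewrite iterSr jderiv_sj iter_jderiv_scale; apply: jbounded_scale.
exact: (iter_jderiv_mul is_jet_tj is_jet_sj (fun i _ => ht i) IH).
Qed.

Lemma regular_reval m e d (F : rfun m e d) : regular e d (reval F).
Proof.
apply: regular_add; first exact: regular_cst (rleadP F).
by apply: regular_scale (rtailP F) => dl; exact: expr_norm_le1.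
Qed.

Definition rjet m e d U (hU : bounded_jet e d U) : rfun m e d :=
  Rfun m hU (regular_cst (bounded_jet0 e d)).

Definition rcst m c := rjet m (bounded_jet_cst c).

Definition rpert m0 m e d (F : rfun m0 e d) : rfun m e d :=
  Rfun m (bounded_jet0 e d) (regular_reval F).

Lemma regular_var_eq v e : pv v = e -> regular e true (fun _ Z => Z v).
Proof. by move=> <-; exact: regular_var. Qed.

Definition rvar v e (he : pv v = e) : rfun 0 e true :=
  Rfun 0 (bounded_jet0 _ _) (regular_var_eq he).

Definition radd m e d (F G : rfun m e d) : rfun m e d :=
  Rfun m (bounded_jet_add (rleadP F) (rleadP G)) (regular_add (rtailP F) (rtailP G)).

Lemma rscale_reg e d c F : regular e d F ->
  regular e d (fun dl Z => jscale c (F dl Z)).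
Proof. by apply: (regular_scale (c := fun=> c)) => dl _; exact: lexx. Qed.

Definition rscale m e d c (F : rfun m e d) : rfun m e d :=
  Rfun m (bounded_jet_scale c (rleadP F)) (rscale_reg c (rtailP F)).

Definition rsum m e d (I : finType) (F : I -> rfun m e d) : rfun m e d :=
  Rfun m (bounded_jet_sum (fun i => rleadP (F i))) (regular_sum (fun i => rtailP (F i))).

Definition rweak m e d (F : rfun m e d) : rfun m e false :=
  Rfun m (bounded_jet_weaken (rleadP F)) (regular_weaken (rtailP F)).

Lemma rlow_reg m e d F : regular e d F ->
  regular e d (fun dl Z => jscale (dl ^+ m) (F dl Z)).
Proof. by apply: regular_scale => dl; exact: expr_norm_le1. Qed.

(** Surplus powers of [dl] move into the tail, so that functionals of different orders can be added
    or multiplied. *)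
Definition rlow m m' e d (F : rfun (m + m') e d) : rfun m' e d :=
  Rfun m' (rleadP F) (rlow_reg m (rtailP F)).

Lemma rmul_bounded e1 e2 d1 d2 e d (he : e1 (+) e2 = e) (hd : d1 || d2 = d) U W :
  bounded_jet e1 d1 U -> bounded_jet e2 d2 W -> bounded_jet e d (jmul U W).
Proof. by rewrite -he -hd; exact: bounded_jet_mul. Qed.

Lemma rmul_regular m e1 e2 d1 d2 e d (he : e1 (+) e2 = e) (hd : d1 || d2 = d)
    (F : rfun m e1 d1) (G : rfun m e2 d2) :
  regular e d (fun dl Z => jadd (jmul (rlead F) (rtail G dl Z)) (jmul (rtail F dl Z) (reval G dl Z))).
Proof.
rewrite -he -hd.
exact: regular_add (regular_mul (regular_cst (rleadP F)) (rtailP G))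
  (regular_mul (rtailP F) (regular_reval G)).
Qed.

Definition rmul m e1 e2 d1 d2 e d (he : e1 (+) e2 = e) (hd : d1 || d2 = d)
    (F : rfun m e1 d1) (G : rfun m e2 d2) : rfun m e d :=
  Rfun m (rmul_bounded he hd (rleadP F) (rleadP G)) (rmul_regular he hd F G).

Fixpoint rpow m (F : rfun m false false) j : rfun m false false :=
  if j is i.+1 then rmul erefl erefl F (rpow F i) else rcst m 1.

Lemma rval_jet m e d U (hU : bounded_jet e d U) dl Z x :
  rval (rjet m hU) dl Z x = U 0%N x.
Proof. by rewrite /rval /reval /jadd /jscale /= mulr0 addr0. Qed.

Lemma rval_cst m c dl Z x : rval (rcst m c) dl Z x = c.
Proof. exact: rval_jet. Qed.

Lemma rval_pert m0 m e d (F : rfun m0 e d) dl Z x :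
  rval (rpert m F) dl Z x = dl ^+ m * rval F dl Z x.
Proof. by rewrite /rval {1}/reval /jadd /jscale /= add0r. Qed.

Lemma rval_var v e (he : pv v = e) dl Z x : rval (rvar he) dl Z x = Z v 0%N x.
Proof. by rewrite /rval /reval /jadd /jscale /= add0r expr0 mul1r. Qed.

Lemma rval_add m e d (F G : rfun m e d) dl Z x :
  rval (radd F G) dl Z x = rval F dl Z x + rval G dl Z x.
Proof. by rewrite /rval /reval /jadd /jscale /= /jadd; ring. Qed.

Lemma rval_scale m e d c (F : rfun m e d) dl Z x :
  rval (rscale c F) dl Z x = c * rval F dl Z x.
Proof. by rewrite /rval /reval /jadd /jscale /= /jscale; ring. Qed.

Lemma rval_sum m e d (I : finType) (F : I -> rfun m e d) dl Z x :
  rval (rsum F) dl Z x = \sum_i rval (F i) dl Z x.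
Proof.
rewrite /rval /reval /jadd /jscale /= /jsum mulr_sumr -big_split/=.
exact: eq_bigr.
Qed.

Lemma rval_weak m e d (F : rfun m e d) dl Z x :
  rval (rweak F) dl Z x = rval F dl Z x.
Proof. by []. Qed.

Lemma rval_low m m' e d (F : rfun (m + m') e d) dl Z x :
  rval (rlow F) dl Z x = rval F dl Z x.
Proof. by rewrite /rval /reval /jadd /jscale /= /jscale exprD; ring. Qed.

Lemma rval_mul m e1 e2 d1 d2 e d (he : e1 (+) e2 = e) (hd : d1 || d2 = d)
    (F : rfun m e1 d1) (G : rfun m e2 d2) dl Z x :
  rval (rmul he hd F G) dl Z x = rval F dl Z x * rval G dl Z x.
Proof.
rewrite /rval /reval /jadd /jscale /= /jadd !jmul0 /reval /jadd /jscale; ring.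
Qed.

Lemma rval_pow m (F : rfun m false false) j dl Z x :
  rval (rpow F j) dl Z x = rval F dl Z x ^+ j.
Proof.
elim: j => [|j IH]; first by rewrite expr0 /= rval_cst.
by rewrite /= exprS -IH rval_mul.
Qed.

End RegularFunctionals.

(** * The linear slow-fast system *)

(* Slow unknowns [h], [g]; algebraic unknowns [r], [n], [W]; for each fast mode a
   first-order pair [w], [z] and [a] = dl w'. *)
Inductive var (n : nat) :=
| vh | vg | vr | vn | vW | vw of 'I_n | vz of 'I_n | va of 'I_n.
Arguments vh {n}. Arguments vg {n}. Arguments vr {n}. Arguments vn {n}.
Arguments vW {n}.

(* Parities of the unknowns and of the right-hand sides of their equations. *)
Definition vpar n (v : var n) : bool :=
  match v with vg | vw _ => true | _ => false end.

Definition fpar n (v : var n) : bool :=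
  match v with vh | vw _ => true | _ => false end.

Section LinearSystem.
Context {R : realType} {n : nat}.
Variable lam : 'I_n -> R.
Hypothesis lam_gt0 : forall k, 0 < lam k.
Local Notation jet := (@jet R).
Implicit Types (f Z : var n -> jet) (dl B K x : R).

(* The linearised KdV system P' = k + f1, k' = (4 - 12 sech^2) P + f2 becomes
   triangular in the variables (h, g) defined by P = tanh g - h / 5 and
   k = (sech^2 - 2 tanh^2) g + 3/5 tanh h (a change of variables of determinant
   1/5), with right-hand sides 5 tanh f2 - 5 (sech^2 - 2 tanh^2) f1 and
   3 tanh f1 + f2. *)
Definition slowP1 Z : jet := jadd (jmul tj (Z vg)) (jscale (- 5^-1) (Z vh)).

Lemma slowP1_0 Z x : slowP1 Z 0%N x = tanh x * Z vg 0%N x - Z vh 0%N x / 5.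
Proof. by rewrite /slowP1 /jadd /jscale jmul0 tj0; ring. Qed.

Definition kdvpot : jet := jadd (jcst 4) (jscale (-12) sj).

Lemma kdvpot_0 x : kdvpot 0%N x = 4 - 12 * sech2 x.
Proof. by rewrite /kdvpot /jadd /jscale sj0 /=; ring. Qed.

(** The system is triangular: [vh] first, then [vg], then the algebraic unknowns. The fast modes
    decouple from these and from each other. *)
Definition solves dl f Z := forall x,
  [/\ Z vh 1%N x = 2 * tanh x * Z vh 0%N x + f vh 0%N x,
      Z vg 1%N x = - 2 * tanh x * Z vg 0%N x + (Z vh 0%N x + f vg 0%N x),
      [/\ Z vr 0%N x = slowP1 Z 0%N x + f vr 0%N x,
      Z vn 0%N x = - slowP1 Z 0%N x + f vn 0%N x &
      Z vW 0%N x = kdvpot 0%N x * slowP1 Z 0%N x + f vW 0%N x] &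
      forall k, [/\ dl * Z (vz k) 1%N x = Z (vw k) 0%N x + f (vw k) 0%N x,
        dl * lam k * Z (vw k) 1%N x = Z (vz k) 0%N x - f (vz k) 0%N x &
        Z (va k) 0%N x = Z (vz k) 0%N x / lam k + f (va k) 0%N x]].

Definition forcing B f :=
  forall v, [/\ is_jet (f v), par (fpar v) (f v) & bd true B (f v)].

Let l k : R := Num.sqrt (lam k).
Let l_gt0 k : 0 < l k. Proof. by rewrite sqrtr_gt0. Qed.
Let l_sqr k : l k ^+ 2 = lam k. Proof. by rewrite sqr_sqrtr ?ltW. Qed.

Definition fastC k : R := 2 * (1 + l k) * (1 + (l k)^-1 + (lam k)^-1) + 1.
(** The number dominates 8 * 52 * 161 + 1, the bound for [vW], which is the largest of the slow and
    algebraic ones. *)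
Definition solC : R := (7 * 10 ^+ 4) + \sum_k fastC k.

Lemma fastC_ge0 k : 0 <= fastC k.
Proof. by rewrite addr_ge0 ?mulr_ge0 ?addr_ge0 ?invr_ge0 ?(ltW (l_gt0 _)) ?(ltW (lam_gt0 _)). Qed.

Lemma solC_ge0 : 0 <= solC.
Proof. by rewrite addr_ge0// sumr_ge0// => k _; exact: fastC_ge0. Qed.

Lemma fastC_le k : fastC k <= solC.
Proof.
rewrite /solC (bigD1 k)//= addrCA lerDl addr_ge0// sumr_ge0// => j _.
exact: fastC_ge0.
Qed.

Lemma solC_ge : (7 * 10 ^+ 4) <= solC.
Proof. by rewrite lerDl sumr_ge0// => j _; exact: fastC_ge0. Qed.

Lemma bd_kdvpot : bd false 52 kdvpot.
Proof.
have := bd_add (bd_cst (4 : R)) (bd_scale (-12) (bd_weaken (@bd_sj R))).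
by apply: bd_le; rewrite normrN !ger0_norm//; lra.
Qed.

Lemma is_jet_slowP1 Z : is_jet (Z vg) -> is_jet (Z vh) -> is_jet (slowP1 Z).
Proof.
move=> jg jh; apply: is_jet_add; last exact: is_jet_scale.
by apply: is_jet_mul => //; exact: is_jet_tj.
Qed.

Lemma bd_slowP1 Z B : bd true (3 * B) (Z vh) -> bd true (20 * B) (Z vg) ->
  bd true (161 * B) (slowP1 Z).
Proof.
move=> hh hg; have B0 : 0 <= B by have := bd_ge0 hh; lra.
apply: bd_le (bd_add (bd_mul (@bd_tj R) hg) (bd_scale (- 5^-1) hh)).
rewrite normrN ger0_norm//; lra.
Qed.

Lemma is_jet_kdvpot : is_jet kdvpot.
Proof. by apply: is_jet_add; [exact: is_jet_cst|apply: is_jet_scale; exact: is_jet_sj]. Qed.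

Lemma par_slowP1 Z : par true (Z vg) -> par false (Z vh) -> par false (slowP1 Z).
Proof.
move=> pg ph; apply: par_add; last exact: par_scale.
exact: (par_mul par_tj pg).
Qed.

Lemma par_kdvpot : par false kdvpot.
Proof. by apply: par_add; [exact: par_cst|apply: par_scale; exact: par_sj]. Qed.

Lemma bd_slowW Z B F : bd true (161 * B) (slowP1 Z) -> bd true B F ->
  bd true ((7 * 10 ^+ 4) * B) (jadd (jmul kdvpot (slowP1 Z)) F).
Proof.
move=> hP hF; have B0 := bd_ge0 hF.
by apply: bd_le (bd_add (bd_mul bd_kdvpot hP) hF); lra.
Qed.

Lemma fast_bounds k B (U W F : jet) :
  bd true (2 * (1 + l k) * B) U -> bd true (2 * (1 + l k) * B) W -> bd true B F ->
  [/\ bd true (fastC k * B) (jscale 2^-1 (jadd U W)),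
      bd true (fastC k * B) (jscale (2 * l k)^-1 (jadd U (jscale (-1) W))) &
      bd true (fastC k * B) (jadd (jscale (lam k)^-1 (jscale 2^-1 (jadd U W))) F)].
Proof.
move=> hU hW hF; have B0 := bd_ge0 hF; have lk := l_gt0 k; have lk2 := lam_gt0 k.
set c := 2 * (1 + l k) * B in hU hW.
have c0 : 0 <= c by rewrite /c mulr_ge0 ?mulr_ge0 ?addr_ge0 ?(ltW lk).
have e : fastC k * B = c + c / l k + c / lam k + B by rewrite /fastC /c; ring.
have q1 : 0 <= c / l k by rewrite divr_ge0// ltW.
have q2 : 0 <= c / lam k by rewrite divr_ge0// ltW.
have h1 : bd true c (jscale 2^-1 (jadd U W)).
  by apply: bd_le (bd_scale _ (bd_add hU hW)); rewrite ger0_norm//; lra.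
split; rewrite e.
- by apply: bd_le h1; lra.
- apply: bd_le (bd_scale _ (bd_add hU (bd_scale (-1) hW))).
  rewrite normfV gtr0_norm ?mulr_gt0// normrN normr1 mul1r.
  have -> : (2 * l k)^-1 * (c + c) = c / l k by field; rewrite gt_eqF.
  lra.
- apply: bd_le (bd_add (bd_scale _ h1) hF).
  by rewrite normfV gtr0_norm// mulrC; lra.
Qed.

(** [K] does not appear in the conclusion, so for the difference of two solutions this is a
    Lipschitz estimate in terms of the forcing. *)
Lemma solves_bound dl f Z B K : 0 < dl -> (forall k, dl * l k <= 2^-1) ->
  good (@vpar n) K Z -> forcing B f -> solves dl f Z ->
  forall v, bd true (solC * B) (Z v).
Proof.
move=> dl0 dll gZ ff sZ.
have jZ v : is_jet (Z v) by case: (gZ v).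
have pZ v : par (vpar v) (Z v) by case: (gZ v).
have bZ v : bd true K (Z v) by case: (gZ v).
have jf v : is_jet (f v) by case: (ff v).
have bf v : bd true B (f v) by case: (ff v).
have B0 := bd_ge0 (bf vh).
have hh : bd true (3 * B) (Z vh).
  by apply: (even_growth_jet_bound (F := f vh) (jZ _) (jf _) (pZ vh) _ (bZ _) (bf _)) => x; case: (sZ x).
have hg : bd true (20 * B) (Z vg).
  have -> : 20 * B = 5 * (3 * B + B) by ring.
  apply: (odd_decay_jet_bound (F := jadd (Z vh) (f vg)) (jZ _) _ (pZ vg)).
  - exact: is_jet_add.
  - by move=> x; case: (sZ x).
  - exact: bd_add.
have hP := bd_slowP1 hh hg.
have jP := is_jet_slowP1 (jZ vg) (jZ vh).
have le C : C <= (7 * 10 ^+ 4) -> C * B <= solC * B.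
  by move=> h; rewrite ler_wpM2r// (le_trans h)// solC_ge.
have fast k : [/\ bd true (fastC k * B) (Z (vz k)), bd true (fastC k * B) (Z (vw k)) &
    bd true (fastC k * B) (Z (va k))].
  have lk := l_gt0 k.
  pose a := dl * l k; have a0 : 0 < a by rewrite mulr_gt0.
  (* Characteristic variables of the fast pair, with [l = sqrt lam]: [U] solves [U + a U' = F], and
     since [z] is even and [w] odd, [W] is the reflection of [U]. One relaxation equation therefore
     controls both. *)
  pose U : jet := jadd (Z (vz k)) (jscale (- l k) (Z (vw k))).
  pose W : jet := jadd (Z (vz k)) (jscale (l k) (Z (vw k))).
  pose F : jet := jadd (f (vz k)) (jscale (l k) (f (vw k))).
  have hF : bd true ((1 + l k) * B) F.
    by apply: bd_le (bd_add (bf _) (bd_scale _ (bf _))); rewrite (gtr0_norm lk); lra.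
  have hU : bd true (2 * (1 + l k) * B) U.
    rewrite -mulrA; apply: (@relax_jet_bound _ U F a _ (fun j => (K + l k * K) * mw j)) => //.
    - by rewrite a0 /=; exact: dll.
    - exact: is_jet_add (jZ _) (is_jet_scale _ (jZ _)).
    - exact: is_jet_add (jf _) (is_jet_scale _ (jf _)).
    - move=> x; have [_ _ _ /(_ k)[e1 e2 _]] := sZ x.
      rewrite /U /F /jadd /jscale.
      have -> : a * (Z (vz k) 1%N x + - l k * Z (vw k) 1%N x) =
        l k * (dl * Z (vz k) 1%N x) - dl * lam k * Z (vw k) 1%N x.
        by rewrite /a -l_sqr; ring.
      by rewrite e1 e2; ring.
    - move=> j x; have := bd_add (bZ (vz k)) (bd_scale (- l k) (bZ (vw k))) j x.
      by rewrite normrN (gtr0_norm lk).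
  have hW : bd true (2 * (1 + l k) * B) W.
    move=> j x; have := hU j (- x); rewrite /wd wtN; congr (_ <= _).
    rewrite /U /W /jadd /jscale (par_jets (jZ _) (pZ _)) (par_jets (jZ _) (pZ _)) /=.
    rewrite ?add0n ?add1n ?exprS.
    have -> : (-1) ^+ j * Z (vz k) j x + - l k * (-1 * (-1) ^+ j * Z (vw k) j x) =
      (-1) ^+ j * (Z (vz k) j x + l k * Z (vw k) j x) by ring.
    by rewrite normrM normrX normrN1 expr1n mul1r.
  have [h1 h2 h3] := fast_bounds hW hU (bf (va k)).
  have ez : jscale 2^-1 (jadd W U) = Z (vz k).
    apply/funext => j; apply/funext => x; rewrite /jscale /W /U /jadd /jscale.
    by field.
  have ew : jscale (2 * l k)^-1 (jadd W (jscale (-1) U)) = Z (vw k).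
    apply/funext => j; apply/funext => x; rewrite /jscale /W /U /jadd /jscale; field.
    by rewrite gt_eqF.
  rewrite ez in h1 h3; rewrite ew in h2; split=> //.
  suff -> : Z (va k) = jadd (jscale (lam k)^-1 (Z (vz k))) (f (va k)) by [].
  apply: jet_ext; [exact: jZ|exact: is_jet_add (is_jet_scale _ (jZ _)) (jf _)|].
  by move=> x; have [_ _ _ /(_ k)[_ _ ->]] := sZ x; rewrite /jadd /jscale mulrC.
have fle k : fastC k * B <= solC * B by rewrite ler_wpM2r// fastC_le.
case=> [|||||k|k|k].
- by apply: bd_le hh; apply: le; lra.
- by apply: bd_le hg; apply: le; lra.
- have -> : Z vr = jadd (slowP1 Z) (f vr).
    apply: jet_ext; [exact: jZ|exact: is_jet_add jP (jf _)|].
    by move=> x; have [_ _ [-> _ _] _] := sZ x.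
  by apply: bd_le (bd_add hP (bf vr)); have := le 162; lra.
- have -> : Z vn = jadd (jscale (-1) (slowP1 Z)) (f vn).
    apply: jet_ext; [exact: jZ|exact: is_jet_add (is_jet_scale _ jP) (jf _)|].
    by move=> x; have [_ _ [_ -> _] _] := sZ x; rewrite /jadd /jscale mulN1r.
  apply: bd_le (bd_add (bd_scale _ hP) (bf vn)).
  by rewrite normrN normr1; have := le 162; lra.
- have -> : Z vW = jadd (jmul kdvpot (slowP1 Z)) (f vW).
    apply: jet_ext; first exact: jZ.
      exact: is_jet_add (is_jet_mul is_jet_kdvpot jP) (jf _).
    by move=> x; have [_ _ [_ _ ->] _] := sZ x; rewrite /jadd jmul0.
  by apply: bd_le (bd_slowW hP (bf vW)); apply: le; lra.
- by have [_ h _] := fast k; apply: bd_le h.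
- by have [h _ _] := fast k; apply: bd_le h.
- by have [_ _ h] := fast k; apply: bd_le h.
Qed.

Lemma solves_exists dl f B : 0 < dl -> (forall k, dl * l k <= 2^-1) ->
  forcing B f -> exists2 Z, good (@vpar n) (solC * B) Z & solves dl f Z.
Proof.
move=> dl0 dll ff.
have jf v : is_jet (f v) by case: (ff v).
have pf v : par (fpar v) (f v) by case: (ff v).
have bf v : bd true B (f v) by case: (ff v).
have B0 := bd_ge0 (bf vh).
have [Zh [jh ph hh eh]] := even_growth_jet_exists (jf vh) (pf vh) (bf vh).
have [] := @odd_decay_jet_exists _ (jadd Zh (f vg)) (3 * B + B).
- exact: is_jet_add.
- by apply: par_add => //; exact: (pf vg).
- exact: bd_add.
move=> Zg [jg pg hg eg].
have /choice[fast Hfast] : forall k, exists zw : jet * jet,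
   [/\ is_jet zw.1 /\ is_jet zw.2, par false zw.1, par true zw.2,
      [/\ bd true (fastC k * B) zw.1, bd true (fastC k * B) zw.2 &
       bd true (fastC k * B) (jadd (jscale (lam k)^-1 zw.1) (f (va k)))] &
     forall x, dl * zw.1 1%N x = zw.2 0%N x + f (vw k) 0%N x /\
       dl * lam k * zw.2 1%N x = zw.1 0%N x - f (vz k) 0%N x].
  move=> k; have lk := l_gt0 k.
  pose a := dl * l k; have a0 : 0 < a by rewrite mulr_gt0.
  pose F : jet := jadd (f (vz k)) (jscale (l k) (f (vw k))).
  have jF : is_jet F by exact: is_jet_add (jf _) (is_jet_scale _ (jf _)).
  have hF : bd true ((1 + l k) * B) F.
    by apply: bd_le (bd_add (bf _) (bd_scale _ (bf _))); rewrite (gtr0_norm lk); lra.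
  have [|y [jy hy ey]] := @relax_jet_exists _ F a _ _ jF hF.
    by rewrite a0 /=; exact: dll.
  (* The reflection of [y], with the signs of the chain rule. Up to constants [z] and [w] are the
     even and odd parts of [y]. *)
  pose yr : jet := fun j x => (-1) ^+ j * y j (- x).
  have jyr : is_jet yr.
    move=> j x; have dN := is_deriveNR (is_derive_idR x).
    apply: is_derive_eqR (is_deriveZR ((-1) ^+ j) (is_derive_compR (jy j (- x)) dN)) _.
    by rewrite /yr exprS; ring.
  have hyr : bd true (2 * (1 + l k) * B) yr.
    move=> j x; rewrite /yr normrM normrX normrN1 expr1n mul1r.
    by have := hy j (- x); rewrite /wd wtN mulrA.
  have hy' : bd true (2 * (1 + l k) * B) y by rewrite -mulrA.
  exists (jscale 2^-1 (jadd yr y), jscale (2 * l k)^-1 (jadd yr (jscale (-1) y))).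
  split=> /=.
  - split; first exact: is_jet_scale _ (is_jet_add jyr jy).
    exact: is_jet_scale _ (is_jet_add jyr (is_jet_scale _ jy)).
  - by move=> x; rewrite /jscale /jadd /yr !expr0 opprK; ring.
  - by move=> x; rewrite /jscale /jadd /jscale /yr !expr0 opprK; ring.
  - exact: fast_bounds hyr hy' (bf (va k)).
  - move=> x.
    have e1 := ey x; have e2 := ey (- x).
    have pz := pf (vz k) x; have pw := pf (vw k) x.
    rewrite /F /jadd /jscale pz pw /= expr0 expr1 in e1 e2.
    have {}e1 : a * y 1%N x = f (vz k) 0%N x + l k * f (vw k) 0%N x - y 0%N x by rewrite -e1; ring.
    have {}e2 : a * y 1%N (- x) = f (vz k) 0%N x - l k * f (vw k) 0%N x - y 0%N (- x) by rewrite -[LHS](addKr (y 0%N (- x))) e2; ring.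
    have lk0 : l k != 0 by rewrite gt_eqF.
    rewrite /jscale /jadd /jscale /yr expr0 expr1; split.
      have -> : dl * (2^-1 * (-1 * y 1%N (- x) + y 1%N x)) =
        (2 * l k)^-1 * (a * y 1%N x - a * y 1%N (- x)) by rewrite /a; field.
      by rewrite e1 e2; field.
    have -> : dl * lam k * ((2 * l k)^-1 * (-1 * y 1%N (- x) + -1 * y 1%N x)) =
        - 2^-1 * (a * y 1%N x + a * y 1%N (- x)) by rewrite /a -l_sqr; field.
    by rewrite e1 e2; field.
have hgB : bd true (20 * B) Zg by apply: bd_le hg; lra.
(* [slowP1] reads only [vh] and [vg], so this provisional family already gives it its final
   value. *)
pose Z0 (v : var n) : jet := if v is vh then Zh else Zg.
pose Z (v : var n) : jet := match v with
  | vh => Zh | vg => Zg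
  | vr => jadd (slowP1 Z0) (f vr)
  | vn => jadd (jscale (-1) (slowP1 Z0)) (f vn)
  | vW => jadd (jmul kdvpot (slowP1 Z0)) (f vW)
  | vw k => (fast k).2 | vz k => (fast k).1
  | va k => jadd (jscale (lam k)^-1 (fast k).1) (f (va k)) end.
have eP : slowP1 Z = slowP1 Z0 by [].
have hP : bd true (161 * B) (slowP1 Z0) by exact: bd_slowP1.
have jP : is_jet (slowP1 Z0) by exact: is_jet_slowP1.
have pP : par false (slowP1 Z0) by exact: par_slowP1.
exists Z.
  have le C : C <= 7 * 10 ^+ 4 -> C * B <= solC * B.
    by move=> h; rewrite ler_wpM2r// (le_trans h)// solC_ge.
  have fle k : fastC k * B <= solC * B by rewrite ler_wpM2r// fastC_le.
  case=> [|||||k|k|k]; rewrite /Z.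
  - by split=> //; apply: bd_le hh; apply: le; lra.
  - by split=> //; apply: bd_le hgB; apply: le; lra.
  - split; [exact: is_jet_add jP (jf _)|exact: par_add pP (pf vr)|].
    by apply: bd_le (bd_add hP (bf vr)); have := le 162; lra.
  - split; first exact: is_jet_add (is_jet_scale _ jP) (jf _).
      by apply: par_add; [exact: par_scale|exact: (pf vn)].
    apply: bd_le (bd_add (bd_scale _ hP) (bf vn)).
    by rewrite normrN normr1; have := le 162; lra.
  - split.
    + exact: is_jet_add (is_jet_mul is_jet_kdvpot jP) (jf _).
    + apply: par_add; last exact: (pf vW).
      exact: (par_mul par_kdvpot pP).
    + by apply: bd_le (bd_slowW hP (bf vW)); apply: le; lra.
  - have [[_ j2] _ p2 [_ h _] _] := Hfast k; split=> //; exact: bd_le h.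
  - have [[j1 _] p1 _ [h _ _] _] := Hfast k; split=> //; exact: bd_le h.
  - have [[j1 _] p1 _ [_ _ h] _] := Hfast k; split; last exact: bd_le h.
      exact: is_jet_add (is_jet_scale _ j1) (jf _).
    by apply: par_add; [exact: par_scale|exact: (pf (va k))].
move=> x; split; [exact: eh|exact: eg| |].
  rewrite eP /Z; split=> //; first by rewrite /jadd /jscale mulN1r.
  by rewrite /jadd jmul0.
move=> k; have [_ _ _ _ /(_ x)[e1 e2]] := Hfast k.
by rewrite /Z; split=> //; rewrite /jadd /jscale mulrC.
Qed.

End LinearSystem.

Lemma var_uniform {R : realType} {n : nat} (P : var n -> R -> Prop) :
  (forall v x y, x <= y -> P v x -> P v y) ->
  (forall v, exists2 x, 0 <= x & P v x) -> exists2 x, 0 <= x & forall v, P v x.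
Proof.
move=> mono ex; have /choice[b hb] : forall v, exists x, 0 <= x /\ P v x.
  by move=> v; have [x x0 h] := ex v; exists x.
have fam (g : 'I_n -> var n) : exists2 x, 0 <= x & forall k, P (g k) x.
  exists (\sum_k b (g k)); first by apply: sumr_ge0 => k _; case: (hb (g k)).
  move=> k; have [_] := hb (g k); apply: mono.
  rewrite (bigD1 k)//= lerDl sumr_ge0// => j _; by case: (hb (g j)).
have [x1 x10 h1] := fam (@vw n); have [x2 x20 h2] := fam (@vz n).
have [x3 x30 h3] := fam (@va n).
have [h4 p4] := hb vh; have [h5 p5] := hb vg; have [h6 p6] := hb vr.
have [h7 p7] := hb vn; have [h8 p8] := hb vW.
exists (x1 + x2 + x3 + b vh + b vg + b vr + b vn + b vW).
  by rewrite !addr_ge0.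
case=> [|||||k|k|k].
- by apply: mono p4; lra.
- by apply: mono p5; lra.
- by apply: mono p6; lra.
- by apply: mono p7; lra.
- by apply: mono p8; lra.
- by apply: mono (h1 k); lra.
- by apply: mono (h2 k); lra.
- by apply: mono (h3 k); lra.
Qed.

(** * Contraction for small delta *)

Section SmallDelta.
Context {R : realType} {n : nat}.
Variable lam : 'I_n -> R.
Hypothesis lam_gt0 : forall k, 0 < lam k.
Variable f : forall v : var n, @rfun R _ (@vpar n) 1 (fpar v) true.
Local Notation jet := (@jet R).
Implicit Types (Z : var n -> jet) (dl D : R).

Definition jsub (U W : jet) : jet := jadd U (jscale (-1) W).

Lemma jsubE U W k x : jsub U W k x = U k x - W k x.
Proof. by rewrite /jsub /jadd /jscale mulN1r. Qed.

Lemma dst_bd d D U W : bd d D (jsub U W) <-> dst d D U W.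
Proof. by split=> h k x; have := h k x; rewrite jsubE. Qed.

Lemma solves_sub dl (g1 g2 Z1 Z2 : var n -> jet) :
  solves lam dl g1 Z1 -> solves lam dl g2 Z2 ->
  solves lam dl (fun v => jsub (g1 v) (g2 v)) (fun v => jsub (Z1 v) (Z2 v)).
Proof.
move=> h1 h2 x.
have eP : slowP1 (fun v => jsub (Z1 v) (Z2 v)) 0%N x = slowP1 Z1 0%N x - slowP1 Z2 0%N x.
  by rewrite !slowP1_0 !jsubE; ring.
have [a1 b1 [c1 d1 e1] k1] := h1 x; have [a2 b2 [c2 d2 e2] k2] := h2 x.
split.
- by rewrite !jsubE a1 a2; ring.
- by rewrite !jsubE b1 b2; ring.
- by rewrite eP !jsubE c1 c2 d1 d2 e1 e2; split; ring.
- move=> k; have [p1 q1 r1] := k1 k; have [p2 q2 r2] := k2 k.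
  rewrite !jsubE !mulrBr p1 p2 q1 q2 r1 r2; split; ring.
Qed.

(** The order of choices avoids circularity: [M] depends only on the leading parts of the forcing,
    [L] is taken on the ball of radius [M], and [dl0] comes last. Leading parts cancel in
    differences, which leaves a factor [dl]. *)
Lemma forcing_family_solution : exists dl0 M, [/\ 0 < dl0 <= 1, 0 <= M &
  forall dl, 0 < dl <= dl0 -> exists2 Z, good (@vpar n) M Z &
    solves lam dl (fun v => reval (f v) dl Z) Z].
Proof.
have [B0 B00 hB0] : exists2 B, 0 <= B & forall v, bd true B (rlead (f v)).
  apply: var_uniform; first by move=> v x y xy; exact: bd_le.
  by move=> v; have [B B0 h] := bounded_jet_bd (rleadP (f v)); exists B.
set C := solC lam; have C0 : 0 <= C := solC_ge0 lam_gt0.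
pose M := C * (B0 + 1); have M0 : 0 <= M by exact: mulr_ge0 C0 (addr_ge0 B00 ler01).
have [L L0 hL] : exists2 L, 0 <= L & forall v, forall dl Z, 0 < dl <= 1 ->
    good (@vpar n) M Z ->
    bd true L (rtail (f v) dl Z) /\
    forall Z' D, 0 <= D -> good (@vpar n) M Z' ->
      (forall v, dst true D (Z v) (Z' v)) ->
      dst true (L * D) (rtail (f v) dl Z) (rtail (f v) dl Z').
  apply: var_uniform.
    move=> v x y xy h dl Z hd gZ; have [h1 h2] := h dl Z hd gZ.
    split; first exact: bd_le h1.
    by move=> Z' D D0 gZ' hD; apply: dst_le (h2 _ _ D0 gZ' hD); rewrite ler_wpM2r.
  move=> v; have [L L0 h] := rtailP (f v) M0; exists L => // dl Z hd gZ.
  by have [_ _ h1 h2] := h dl Z hd gZ; split.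
(* One summand per requirement: [dl <= 1], [dl * L <= 1] for invariance of the ball,
   [dl * (2 * C * L) <= 1] for contraction by one half, and [dl * sqrt lam <= 1/2] for the fast
   modes. *)
pose S := 1 + L + 2 * C * L + \sum_k 2 * Num.sqrt (lam k).
have s0 : 0 <= \sum_k 2 * Num.sqrt (lam k).
  by apply: sumr_ge0 => k _; rewrite mulr_ge0 ?sqrtr_ge0.
have CL : 0 <= 2 * C * L by rewrite !mulr_ge0.
have S1 : 1 <= S by rewrite /S; lra.
have S0 : 0 < S by exact: lt_le_trans S1.
exists S^-1, M; split=> //; first by rewrite invr_gt0 S0 invf_le1.
move=> dl /andP[d0 dS].
have dSS : dl * S <= 1 by rewrite -ler_pdivlMr// mul1r.
have small t : 0 <= t -> t <= S -> dl * t <= 1.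
  by move=> t0 tS; apply: le_trans dSS; rewrite ler_wpM2l// ltW.
have hd : 0 < dl <= 1 by rewrite d0 (le_trans dS)// invf_le1.
have dll k : dl * Num.sqrt (lam k) <= 2^-1.
  have h : 2 * Num.sqrt (lam k) <= S.
    rewrite /S (bigD1 k)//=; set t := \sum_(i | _) _.
    have : 0 <= t by apply: sumr_ge0 => j _; rewrite mulr_ge0 ?sqrtr_ge0.
    lra.
  have := small _ _ h; rewrite mulr_ge0 ?sqrtr_ge0// => /(_ isT); lra.
have ff Z : good (@vpar n) M Z -> forcing (B0 + 1) (fun v => reval (f v) dl Z).
  move=> gZ v; have [L' _ hreg] := regular_reval (f v) M0.
  have [h1 h2 _ _] := hreg dl Z hd gZ; split=> //.
  have [hb _] := hL v dl Z hd gZ.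
  apply: bd_le (bd_add (hB0 v) (bd_scale _ hb)); rewrite lerD2l expr1.
  by rewrite (gtr0_norm d0); apply: small => //; rewrite /S; lra.
apply: (contraction_fixpoint (step := fun Z Z' => solves lam dl (fun v => reval (f v) dl Z) Z')) => //.
  by move=> Z gZ; exact: (solves_exists lam_gt0 d0 dll (ff Z gZ)).
move=> Z1 Z2 Z1' Z2' D g1 g2 g1' g2' s1 s2 hD v.
have D0 : 0 <= D := dst_ge0 (hD v).
have gd : good (@vpar n) (M + M) (fun v => jsub (Z1' v) (Z2' v)).
  move=> w; have [a1 b1 c1] := g1' w; have [a2 b2 c2] := g2' w; split.
  - exact: is_jet_add a1 (is_jet_scale _ a2).
  - by apply: par_add => //; exact: par_scale.
  - by have := bd_add c1 (bd_scale (-1) c2); rewrite normrN normr1 mul1r.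
have fd : forcing (dl * (L * D)) (fun v => jsub (reval (f v) dl Z1) (reval (f v) dl Z2)).
  move=> w; have [a1 b1 c1] := ff Z1 g1 w; have [a2 b2 c2] := ff Z2 g2 w; split.
  - exact: is_jet_add a1 (is_jet_scale _ a2).
  - by apply: par_add => //; exact: par_scale.
  - move=> k x; have [_ h] := hL w dl Z1 hd g1.
    have := dst_scale dl (h Z2 D D0 g2 hD) k x.
    by rewrite (gtr0_norm d0) jsubE /reval /jadd opprD addrACA subrr add0r expr1.
have := solves_bound lam_gt0 d0 dll gd fd (solves_sub s1 s2) v.
rewrite dst_bd; apply: dst_le.
rewrite -/C [leLHS](_ : _ = (dl * (2 * C * L)) * (D / 2)); last by field.
rewrite ler_piMl ?divr_ge0//; apply: small => //; rewrite /S; lra.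
Qed.

End SmallDelta.

(** * The matrices of the model *)

Section PolyIntegral.
Context {R : realType}.
Implicit Types (f q : {poly R}).

(* The integral of [f] over [0, 1]. *)
Definition pint01 f : R := \sum_(i < size f) f`_i / i.+1%:R.

Lemma pint01E n f : (size f <= n)%N -> pint01 f = \sum_(i < n) f`_i / i.+1%:R.
Proof.
move=> fn; rewrite /pint01 -!(big_mkord xpredT (fun i => f`_i / i.+1%:R)).
rewrite (big_cat_nat (leq0n _) fn)/= [X in _ + X]big_nat_cond [X in _ + X]big1 ?addr0//.
by move=> i /andP[/andP[fi _] _]; rewrite nth_default ?mul0r.
Qed.

Lemma pint01_lin (c : R) f q : pint01 (c *: f + q) = c * pint01 f + pint01 q.
Proof.
pose n := maxn (size (c *: f + q)) (maxn (size f) (size q)).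
rewrite !(@pint01E n) ?leq_max ?leqnn ?orbT//.
rewrite mulr_sumr -big_split/=; apply: eq_bigr => i _.
by rewrite coefD coefZ mulrDl mulrA.
Qed.

Lemma pint01D f q : pint01 (f + q) = pint01 f + pint01 q.
Proof. by rewrite -{1}[f]scale1r pint01_lin mul1r. Qed.

Lemma pint010 : pint01 0 = 0.
Proof. by rewrite /pint01 size_poly0 big_ord0. Qed.

Lemma pint01Z c f : pint01 (c *: f) = c * pint01 f.
Proof. by rewrite -[c *: f]addr0 pint01_lin pint010 addr0. Qed.

Lemma pint01_sum (I : finType) (F : I -> {poly R}) :
  pint01 (\sum_i F i) = \sum_i pint01 (F i).
Proof. exact: (big_morph _ pint01D pint010). Qed.

Lemma pint01Xn n : pint01 'X^n = n.+1%:R^-1.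
Proof.
rewrite (@pint01E n.+1) ?size_polyXn// big_ord_recr/= coefXn eqxx mul1r big1 ?add0r//.
by move=> i _; rewrite coefXn (ltn_eqF (ltn_ord i)) mul0r.
Qed.

(** An antiderivative [F] of [q ^+ 2] is nondecreasing. If the integral vanished, [F] would be zero
    on the whole of [0, 1], and the [size F] points of [rs] are more roots than its degree
    allows. *)
Lemma pint01_sqr_gt0 q : q != 0 -> 0 < pint01 (q ^+ 2).
Proof.
move=> q0; set f := q ^+ 2.
pose F := \poly_(i < (size f).+1) (f`_i.-1 / i%:R).
have dF : F^`() = f.
  apply/polyP => i; rewrite coef_deriv coef_poly ltnS -[LHS]mulr_natl.
  case: ltnP => [_|h]; last by rewrite mulr0 nth_default.
  by rewrite mulrC divfK// pnatr_eq0.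
have F0 : F.[0] = 0 by rewrite horner_coef0 coef_poly/= invr0 mulr0.
have F1 : F.[1] = pint01 f.
  rewrite horner_poly big_ord_recl/= invr0 mulr0 mul0r add0r /pint01.
  by apply: eq_bigr => i _; rewrite expr1n mulr1.
have mono (a b : R) : a <= b -> F.[a] <= F.[b].
  have d (x : R) : is_derive x 1 (horner F) f.[x] by rewrite -dF; exact: is_derive_poly.
  by move=> ab; apply: (derive_ge0_le ab d) => x _; rewrite /f horner_exp sqr_ge0.
rewrite -F1 lt_neqAle -{2}F0 mono// andbT; apply/eqP => e.
have root01 x : 0 <= x <= 1 -> root F x.
  move=> /andP[x0 x1]; rewrite /root -[_ == 0]/(F.[x] == 0) eq_le.
  by have := mono _ _ x0; have := mono _ _ x1; rewrite F0 -e => -> ->.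
have : F = 0.
  apply/eqP; apply: contraT => Fn0.
  have s0 : (0 < size F)%N by rewrite size_poly_gt0.
  have sR : 0 < (size F)%:R :> R by rewrite ltr0n.
  pose rs : seq R := [seq (i%:R / (size F)%:R) | i <- iota 0 (size F)].
  have hall : all (root F) rs.
    apply/allP => _ /mapP[i + ->]; rewrite mem_iota add0n => /andP[_ iF].
    by apply: root01; rewrite divr_ge0//= ler_pdivrMr// mul1r ler_nat ltnW.
  have hu : uniq rs.
    rewrite map_inj_uniq ?iota_uniq// => i j /(divIf (lt0r_neq0 sR))/eqP.
    by rewrite eqr_nat => /eqP.
  by have := max_poly_roots Fn0 hall hu; rewrite size_map size_iota ltnn.
move=> F00; move: dF; rewrite F00 deriv0 => /esym/eqP.
by rewrite /f expf_eq0/= (negbTE q0).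
Qed.

End PolyIntegral.

Lemma continuous_sumR {R : realType} {T : topologicalType} (I : Type) (r : seq I)
    (F : I -> T -> R) : (forall i, continuous (F i)) ->
  continuous (fun x => \sum_(i <- r) F i x).
Proof.
move=> cF x; elim: r => [|i r IH].
  have -> : (fun x => \sum_(i <- [::]) F i x) = fun=> 0.
    by apply/funext => y; rewrite big_nil.
  exact: cvg_cst.
have -> : (fun x => \sum_(j <- i :: r) F j x) =
    (fun x => F i x + \sum_(j <- r) F j x).
  by apply/funext => y; rewrite big_cons.
by apply: cvgD => //; exact: cF.
Qed.

(** * Simultaneous diagonalisation of two quadratic forms *)

Section BilinearForms.
Context {R : realType}.

Definition bform n (A : 'M[R]_n) (x y : 'rV[R]_n) : R := (x *m A *m y^T) 0 0.

Section Basics.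
Variables (n : nat).
Implicit Types (A : 'M[R]_n) (x y z : 'rV[R]_n) (c : R).

Lemma bformE A x y : bform A x y = \sum_i \sum_j x 0 i * A i j * y 0 j.
Proof.
rewrite /bform mxE exchange_big/=; apply: eq_bigr => j _.
by rewrite !mxE mulr_suml.
Qed.

Lemma bformDl A x y z : bform A (x + y) z = bform A x z + bform A y z.
Proof. by rewrite /bform !mulmxDl mxE. Qed.
Lemma bformDr A x y z : bform A x (y + z) = bform A x y + bform A x z.
Proof. by rewrite /bform linearD mulmxDr mxE. Qed.
Lemma bformZl A c x y : bform A (c *: x) y = c * bform A x y.
Proof. by rewrite /bform -!scalemxAl mxE. Qed.
Lemma bformZr A c x y : bform A x (c *: y) = c * bform A x y.
Proof. by rewrite /bform linearZ/= -scalemxAr mxE. Qed.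
Lemma bformC A x y : A^T = A -> bform A x y = bform A y x.
Proof.
move=> sA; have e : (y *m A *m x^T)^T = x *m A *m y^T.
  by rewrite !trmx_mul trmxK sA mulmxA.
by rewrite /bform -e mxE.
Qed.

Definition posdef A := A^T = A /\ forall x, x != 0 -> 0 < bform A x x.

Lemma bform_continuous A : continuous (fun x => bform A x x).
Proof.
have -> : (fun x => bform A x x) = (fun x => \sum_i \sum_j x 0 i * A i j * x 0 j).
  by apply/funext => x; exact: bformE.
apply: continuous_sumR => i; apply: continuous_sumR => j x.
apply: (@continuousM _ _ (fun x : 'rV[R]_n => x 0 i * A i j) (fun x => x 0 j)).
  apply: (@continuousM _ _ (fun x : 'rV[R]_n => x 0 i) (fun=> A i j)).
    exact: coord_continuous.
  exact: cst_continuous.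
exact: coord_continuous.
Qed.
End Basics.

(* [u] maximises the Rayleigh quotient of [M] with respect to [A]. *)
Lemma rayleigh n (A M : 'M[R]_n.+1) : posdef A -> M^T = M ->
  exists2 u, bform A u u = 1 &
    forall y, bform A u y = 0 -> bform M u y = 0.
Proof.
move=> [sA pA] sM.
pose S := [set x : 'rV[R]_n.+1 | `|x| = 1].
have nz x : `|x| = 1 -> x != 0.
  move=> h; apply/eqP => e; move: h; rewrite e normr0 => /esym/eqP.
  by rewrite oner_eq0.
have S0 : S !=set0.
  exists (`|const_mx 1 : 'rV[R]_n.+1|^-1 *: const_mx 1); rewrite /S/= normrZ.
  have h : `|const_mx 1 : 'rV[R]_n.+1| != 0.
    apply/eqP => /normr0_eq0/matrixP/(_ 0 0); rewrite !mxE => /eqP.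
    by rewrite oner_eq0.
  by rewrite normfV normr_id mulVf.
have cS : compact S.
  apply: bounded_closed_compact.
    by exists 1; split; [exact: num_real|move=> e e1 x /= ->; exact: ltW].
  have -> : S = (fun x => `|x|) @^-1` [set 1] by [].
  by apply: closed_comp; [move=> x _; exact: norm_continuous|exact: closed_eq].
pose f x := bform M x x / bform A x x.
have cf : {within S, continuous f}.
  apply: continuous_in_subspaceT => x; rewrite inE => /nz x0.
  apply: (@continuousM _ _ (fun x => bform M x x) (fun x => (bform A x x)^-1)).
    exact: (@bform_continuous _ M).
  apply: (@continuousV _ _ (fun x => bform A x x)); first by rewrite gt_eqF// pA.
  exact: (@bform_continuous _ A).
have [v + vmax] := compact_EVT_max S0 cS cf.
rewrite inE => /nz v0; have Av := pA v v0.
set mu := f v in vmax.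
have hmax x : bform M x x <= mu * bform A x x.
  have [->|x0] := eqVneq x 0.
    by rewrite /bform !mul0mx !mxE mulr0.
  have nx : `|x| != 0 by apply/eqP => /normr0_eq0/eqP; apply/negP.
  have : `|x|^-1 *: x \in S by rewrite inE/S/= normrZ normfV normr_id mulVf.
  move=> /vmax; have Ax := pA x x0.
  have -> : f (`|x|^-1 *: x) = bform M x x / bform A x x.
    by rewrite /f !bformZl !bformZr; field; rewrite nx gt_eqF.
  by rewrite ler_pdivrMr.
have hv y : bform A v y = 0 -> bform M v y = 0.
  move=> e.
  have h t : 2 * t * bform M v y <= t ^+ 2 * (mu * bform A y y - bform M y y).
    have := hmax (v + t *: y).
    rewrite !(bformDl, bformDr, bformZl, bformZr) (bformC y v sA) (bformC y v sM) e.
    have : bform M v v = mu * bform A v v by rewrite /mu /f divfK// gt_eqF.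
    lra.
  set b := bform M v y in h *; set K := _ - _ in h.
  have K0 : 0 <= K.
    have := h 1; have := h (-1); rewrite sqrrN expr1n; lra.
  apply/eqP; apply: contraT => b0.
  (* The minimiser [b / K] of the quadratic is replaced by [b / (K + 1)], since [K] may vanish; the
     inequality still fails there unless [b = 0]. *)
  have := h (b / (K + 1)).
  have K1 : 0 < K + 1 by lra.
  rewrite -subr_ge0.
  have -> : (b / (K + 1)) ^+ 2 * K - 2 * (b / (K + 1)) * b =
     - (b ^+ 2 / (K + 1) ^+ 2 * (K + 2)) by field; rewrite gt_eqF.
  have b2 : 0 < b ^+ 2 by rewrite exprn_even_gt0.
  have K2 : 0 < (K + 1) ^+ 2 by rewrite exprn_gt0.
  by rewrite oppr_ge0 leNgt mulr_gt0 ?divr_gt0//; lra.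
pose s := (Num.sqrt (bform A v v))^-1.
have s0 : s != 0 by rewrite invr_eq0 sqrtr_eq0 -ltNge.
exists (s *: v).
  rewrite bformZl bformZr mulrA -expr2 /s exprVn sqr_sqrtr ?ltW// mulVf//.
  by rewrite gt_eqF.
move=> y; rewrite !bformZl => /eqP; rewrite mulf_eq0 (negbTE s0)/= => /eqP/hv ->.
by rewrite mulr0.
Qed.

Lemma rayleigh_sub n r (W : 'M[R]_(r, n)) (A M : 'M[R]_n) : (0 < r)%N ->
  row_free W -> posdef A -> M^T = M ->
  exists u, [/\ (u <= W)%MS, bform A u u = 1 &
    forall y, (y <= W)%MS -> bform A u y = 0 -> bform M u y = 0].
Proof.
case: r W => // r W _ fW [sA pA] sM.
have bW B x y : bform (W *m B *m W^T) x y = bform B (x *m W) (y *m W).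
  by rewrite /bform trmx_mul !mulmxA.
have pW : posdef (W *m A *m W^T).
  split; first by rewrite !trmx_mul trmxK sA mulmxA.
  move=> x x0; rewrite bW pA//; apply/negP => /eqP e.
  by move: x0; rewrite -(mulmx_free_eq0 x fW) e eqxx.
have sW : (W *m M *m W^T)^T = W *m M *m W^T by rewrite !trmx_mul trmxK sM mulmxA.
have [u u1 hu] := rayleigh pW sW.
exists (u *m W); split; [exact: submxMl|by rewrite -bW|].
by move=> y /submxP[z ->]; rewrite -!bW; exact: hu.
Qed.

Let ltn_succ k m : (k < m.+1)%N -> k = m \/ (k < m)%N.
Proof. by rewrite ltnS leq_eqVlt => /orP[/eqP ->|]; [left|right]. Qed.

(** Rayleigh quotients are maximised successively on the complement of [b] and of the vectors
    already found. The last clause is the induction invariant: it makes every later vector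
    [M]-orthogonal to the earlier ones. *)
Lemma orthogonal_family n (A M : 'M[R]_n) (b : 'cV[R]_n) m :
  posdef A -> M^T = M -> (m < n)%N ->
  exists u : nat -> 'rV[R]_n,
    [/\ forall k, (k < m)%N -> (u k *m b) 0 0 = 0,
        forall k l, (k < m)%N -> (l < m)%N -> bform A (u k) (u l) = (k == l)%:R,
        forall k l, (k < m)%N -> (l < m)%N -> k != l -> bform M (u k) (u l) = 0 &
        forall k y, (k < m)%N -> (y *m b) 0 0 = 0 ->
          (forall l, (l < m)%N -> bform A (u l) y = 0) -> bform M (u k) y = 0].
Proof.
move=> pA sM; elim: m => [_|m IH mn]; first by exists (fun=> 0); split.
have [u [ub uA uM uW]] := IH (ltnW mn).
have [sA _] := pA.
(* The kernel of [C] is this complement: the last column encodes [b], the others [A]-orthogonality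
   to the [u j]. With [m.+1 < n] columns the kernel is nonzero. *)
pose C : 'M[R]_(n, m.+1) := \matrix_(i, j) if j == ord_max then b i 0 else (A *m (u j)^T) i 0.
have subC y : (y <= kermx C)%MS ->
    (y *m b) 0 0 = 0 /\ forall l, (l < m)%N -> bform A (u l) y = 0.
  move=> /sub_kermxP h; split.
    have /matrixP/(_ 0 ord_max) := h; rewrite !mxE => e.
    by rewrite -[RHS]e; apply: eq_bigr => i _; rewrite mxE eqxx.
  move=> l lm; have /matrixP/(_ 0 (Ordinal (leqW lm))) := h; rewrite !mxE => e.
  rewrite bformC// /bform -mulmxA mxE -[RHS]e; apply: eq_bigr => i _.
  rewrite [C _ _]mxE ifF//; apply/negbTE; rewrite -val_eqE/= neq_ltn lm//.
have rC : (0 < \rank (kermx C))%N.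
  by rewrite mxrank_ker subn_gt0 (leq_ltn_trans (rank_leq_col C)).
have [v [vC v1 hv]] := rayleigh_sub rC (row_base_free _) pA sM.
rewrite eq_row_base in vC; have [vb vu] := subC v vC.
pose u' k := if k == m then v else u k.
have u'E k : (k < m)%N -> u' k = u k by move=> km; rewrite /u' ltn_eqF.
have u'm : u' m = v by rewrite /u' eqxx.
exists u'; split.
- by move=> k; rewrite ltnS leq_eqVlt => /orP[/eqP ->|km]; rewrite ?u'm ?u'E ?ub.
- move=> k l /ltn_succ[->|km] /ltn_succ[->|lm].
  + by rewrite u'm v1 eqxx.
  + by rewrite u'm u'E// bformC// vu// gtn_eqF.
  + by rewrite u'm u'E// vu// ltn_eqF.
  + by rewrite !u'E// uA.
- move=> k l /ltn_succ[->|km] /ltn_succ[->|lm].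
  + by rewrite eqxx.
  + by move=> _; rewrite u'm u'E// bformC//; apply: uW.
  + by move=> _; rewrite u'm u'E//; apply: uW.
  + by rewrite !u'E//; exact: uM.
- move=> k y km yb yA.
  have yu l : (l < m)%N -> bform A (u l) y = 0.
    by move=> lm; rewrite -u'E// yA// ltnW.
  move: km; rewrite ltnS leq_eqVlt => /orP[/eqP ->|km]; last first.
    by rewrite u'E//; exact: uW.
  rewrite u'm; apply: hv; last by rewrite -u'm yA.
  rewrite eq_row_base; apply/sub_kermxP/matrixP => i j; rewrite ord1 [RHS]mxE.
  case: (eqVneq j ord_max) => [->|jm].
    rewrite mxE -[RHS]yb mxE; apply: eq_bigr => l _; rewrite mxE eqxx//.
  have jlt : (j < m)%N.
    by move: (ltn_ord j) jm; rewrite ltnS leq_eqVlt -val_eqE/= => /orP[->|].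
  rewrite -[RHS](yu j jlt) bformC// /bform -mulmxA !mxE; apply: eq_bigr => l _.
  by rewrite [C _ _]mxE (negbTE jm).
Qed.

End BilinearForms.

(** * Gram matrices, the vector gamma and the fast modes *)

Section IKConstants.
Context {R : realType} {n : nat}.
Variable p : 'I_n.+2 -> nat.
Hypotheses (hp0 : p ord0 = 0%N)
  (hp : forall i j : 'I_n.+2, (i < j)%N -> (p i < p j)%N).
Local Notation N := n.+1.

(* [cA] and [cM] are the Gram matrices in L^2(0, 1) of the derivatives of X^(p_i)
   and of the functions X^(p_i) - a_i, hence positive definite. *)
Definition pj (i : 'I_N) : nat := p (lift ord0 i).
Definition ca (i : 'I_N) : R := ((pj i).+1%:R)^-1.
Definition cb (i : 'I_N) : R := 1 - ca i.
Definition cA (i j : 'I_N) : R := coefA R p (lift ord0 i) (lift ord0 j).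
Definition cM (i j : 'I_N) : R := ((pj i + pj j).+1%:R)^-1 - ca i * ca j.
Definition cg : R := gamma R p.
Definition cgv (i : 'I_N) : R := gammav R p i 0.

Lemma pj_gt0 i : (0 < pj i)%N.
Proof. by rewrite -hp0; apply: hp. Qed.

Lemma pj_inj : injective pj.
Proof.
move=> i j e; apply/val_inj; case: (ltngtP i j) => // h.
- by have := @hp (lift ord0 i) (lift ord0 j); rewrite /= /bump !add1n ltnS -/(pj i) -/(pj j) e ltnn => /(_ h).
- by have := @hp (lift ord0 j) (lift ord0 i); rewrite /= /bump !add1n ltnS -/(pj i) -/(pj j) e ltnn => /(_ h).
Qed.

Let scaleMscale (a b : R) (f q : {poly R}) : (a *: f) * (b *: q) = (a * b) *: (f * q).
Proof. by rewrite -scalerAl -scalerAr scalerA. Qed.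

Let MA : 'M[R]_N := A1 R p.
Let MM : 'M[R]_N := \matrix_(i, j) cM i j.

Lemma cAC i j : cA i j = cA j i.
Proof. by rewrite /cA /coefA addnC mulnC. Qed.

Lemma cA_posdef : posdef MA.
Proof.
split; first by apply/matrixP => i j; rewrite !mxE; exact: cAC.
move=> y y0; rewrite bformE.
pose q : {poly R} := \sum_i (y 0 i * (pj i)%:R) *: 'X^((pj i).-1).
have -> : \sum_i \sum_j y 0 i * MA i j * y 0 j = pint01 (q ^+ 2).
  rewrite expr2 {1}/q mulr_suml pint01_sum; apply: eq_bigr => i _.
  rewrite /q mulr_sumr pint01_sum; apply: eq_bigr => j _.
  rewrite scaleMscale -exprD pint01Z pint01Xn mxE /coefA -/(pj i) -/(pj j).
  have -> : ((pj i).-1 + (pj j).-1).+1 = (pj i + pj j - 1)%N.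
    by have := pj_gt0 i; have := pj_gt0 j; case: (pj i) (pj j) => [|a] [|b]//= _ _; rewrite addSn addnS subn1.
  by rewrite natrM; ring.
apply: pint01_sqr_gt0; apply/eqP => q0; move: y0 => /eqP; apply.
apply/rowP => i; rewrite mxE.
have := congr1 (fun f : {poly R} => f`_(pj i).-1) q0.
rewrite coef0 /q coef_sum (bigD1 i)//= coefZ coefXn eqxx mulr1 big1 ?addr0.
  move=> /eqP; rewrite mulf_eq0 pnatr_eq0 => /orP[/eqP //|].
  by have := pj_gt0 i; case: (pj i).
move=> j ji; rewrite coefZ coefXn; case: eqP => [e|_]; last by rewrite mulr0.
exfalso; move: ji => /eqP; apply; apply: pj_inj.
by rewrite -(prednK (pj_gt0 j)) -e prednK ?pj_gt0.
Qed.

Lemma cM_posdef : posdef MM.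
Proof.
split; first by apply/matrixP => i j; rewrite !mxE /cM addnC mulrC.
move=> y y0; rewrite bformE.
pose q : {poly R} := \sum_i y 0 i *: ('X^(pj i) - (ca i)%:P).
have -> : \sum_i \sum_j y 0 i * MM i j * y 0 j = pint01 (q ^+ 2).
  rewrite expr2 {1}/q mulr_suml pint01_sum; apply: eq_bigr => i _.
  rewrite /q mulr_sumr pint01_sum; apply: eq_bigr => j _.
  rewrite scaleMscale pint01Z.
  have -> : ('X^(pj i) - (ca i)%:P) * ('X^(pj j) - (ca j)%:P) =
    'X^(pj i + pj j) + (- ca j *: 'X^(pj i) + (- ca i *: 'X^(pj j) + (ca i * ca j) *: 'X^0)).
    by rewrite exprD expr0 -!mul_polyC polyCM !polyCN; ring.
  rewrite !pint01D !pint01Z !pint01Xn !mxE /cM /ca invr1; ring.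
apply: pint01_sqr_gt0; apply/eqP => q0; move: y0 => /eqP; apply.
apply/rowP => i; rewrite mxE.
have := congr1 (fun f : {poly R} => f`_(pj i)) q0.
have pi0 : (pj i == 0)%N = false by apply/negbTE; rewrite -lt0n pj_gt0.
rewrite coef0 /q coef_sum (bigD1 i)//= coefZ coefB coefXn eqxx coefC pi0 subr0 mulr1 big1 ?addr0//.
move=> j ji; rewrite coefZ coefB coefXn coefC pi0 subr0.
case: eqP => [/pj_inj e|_]; last by rewrite mulr0.
by rewrite e eqxx in ji.
Qed.

Lemma posdef_unit m (A : 'M[R]_m) : posdef A -> A \in unitmx.
Proof.
move=> [_ pA]; rewrite -row_free_unit -kermx_eq0; apply/eqP/row_matrixP => i.
rewrite row0; apply/eqP; apply: contraT => /pA.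
rewrite /bform; have /sub_kermxP -> : (row i (kermx A) <= kermx A)%MS by exact: row_sub.
by rewrite mul0mx mxE ltxx.
Qed.

Let bcol : 'cV[R]_N := const_mx 1 - a0 R p.

Lemma bcolE i : bcol i 0 = cb i. Proof. by rewrite !mxE. Qed.

Lemma cA_cgv i : \sum_j cA i j * cgv j = cb i.
Proof.
have e : MA *m gammav R p = bcol by rewrite /gammav mulmxA mulmxV ?mul1mx// posdef_unit//; exact: cA_posdef.
by rewrite -bcolE -e mxE; apply: eq_bigr => j _; rewrite mxE.
Qed.

Lemma cb_cgv : \sum_j cb j * cgv j = cg.
Proof.
rewrite /cg /gamma -/(gammav R p) mxE; apply: eq_bigr => j _.
by rewrite mxE -bcolE.
Qed.

Lemma cb_gt0 i : 0 < cb i.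
Proof.
by rewrite /cb /ca subr_gt0 invf_lt1 ?ltr0n// ltr1n ltnS pj_gt0.
Qed.

Lemma cg_gt0 : 0 < cg.
Proof.
have [sA pA] := cA_posdef.
have -> : cg = bform MA (gammav R p)^T (gammav R p)^T.
  rewrite bformE -cb_cgv; apply: eq_bigr => i _; rewrite -cA_cgv mulr_suml.
  by apply: eq_bigr => j _; rewrite ![(gammav R p)^T _ _]mxE [MA _ _]mxE /cA /cgv; ring.
apply: pA; apply/eqP => e.
have : cb 0 = 0.
  rewrite -cA_cgv big1// => j _; rewrite /cgv.
  by have /matrixP/(_ 0 j) := e; rewrite !mxE => ->; rewrite mulr0.
by move=> h; have := cb_gt0 0; rewrite h ltxx.
Qed.

(** As [b = A gamma], orthogonality of [u k] to [b] is [A]-orthogonality to the vector gamma, so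
    gamma and the [u k] form an [A]-orthogonal basis; this gives the last clause. Gamma is not asked
    to be [M]-orthogonal to the [u k], which is the origin of the coupling [cm]. *)
Lemma fast_modes : exists (u : 'I_n -> 'I_N -> R) (lam : 'I_n -> R),
  [/\ forall k, 0 < lam k,
      forall k, \sum_i u k i * cb i = 0,
      forall k l, \sum_i u k i * (\sum_j cA i j * u l j) = (k == l)%:R,
      forall k l, \sum_i u k i * (\sum_j cM i j * u l j) = lam k * (k == l)%:R &
      forall G : 'I_N -> R, \sum_i cgv i * G i = 0 ->
        (forall k, \sum_i u k i * G i = 0) -> forall i, G i = 0].
Proof.
have [sA pA] := cA_posdef; have [sM pM] := cM_posdef.
have [u [ub uA uM _]] := orthogonal_family bcol cA_posdef sM (ltnSn n).
have sumE (B : 'M[R]_N) x y : bform B x y = \sum_i x 0 i * (\sum_j B i j * y 0 j).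
  rewrite bformE; apply: eq_bigr => i _; rewrite mulr_sumr.
  by apply: eq_bigr => j _; rewrite mulrA.
have ub' k : (k < n)%N -> \sum_i u k 0 i * cb i = 0.
  move=> kn; have := ub k kn; rewrite mxE => e; apply: etrans e.
  by apply: eq_bigr => i _; rewrite bcolE.
exists (fun k i => u k 0 i), (fun k => bform MM (u k) (u k)).
have eA k l : (k < n)%N -> (l < n)%N ->
    \sum_i u k 0 i * (\sum_j cA i j * u l 0 j) = (k == l)%:R.
  move=> kn ln; rewrite -uA// sumE; apply: eq_bigr => i _; congr (_ * _).
  by apply: eq_bigr => j _; rewrite mxE.
split.
- move=> k; apply: pM; apply/eqP => e; have := uA k k (ltn_ord k) (ltn_ord k).
  by rewrite eqxx e /bform !mul0mx mxE => /eqP; rewrite eq_sym oner_eq0.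
- by move=> k; exact: ub'.
- by move=> k l; rewrite eA.
- move=> k l.
  have -> : \sum_i u k 0 i * (\sum_j cM i j * u l 0 j) = bform MM (u k) (u l).
    by rewrite sumE; apply: eq_bigr => i _; congr (_ * _); apply: eq_bigr => j _; rewrite mxE.
  by have [->|kl] := eqVneq k l; rewrite ?mulr1// mulr0 uM.
move=> G Gg Gu.
pose B : 'M[R]_N := \matrix_(i, j) (if unlift ord0 i is Some k then u k 0 j else cgv j).
have Bg : MA *m B^T = \matrix_(i, l) (if unlift ord0 l is Some k then \sum_j cA i j * u k 0 j else cb i).
  apply/matrixP => i l; rewrite !mxE; case: (unliftP ord0 l) => [k|] e.
    by apply: eq_bigr => j _; rewrite !mxE e liftK.
  by rewrite -cA_cgv; apply: eq_bigr => j _; rewrite !mxE e unlift_none.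
have BAB : B *m (MA *m B^T) = diag_mx (\row_i (if unlift ord0 i is Some k then 1 else cg)).
  rewrite Bg; apply/matrixP => i l; rewrite !mxE.
  under eq_bigr do rewrite !mxE.
  case: (unliftP ord0 i) => [k|] ei; case: (unliftP ord0 l) => [m|] el.
  - rewrite eA//; rewrite ei el (inj_eq (@lift_inj _ _)) -val_eqE/=.
    by case: eqP => _; rewrite ?mulr1n ?mulr0n.
  - by rewrite ub'// ei el -val_eqE/= mulr0n.
  - rewrite ei el -val_eqE/= mulr0n.
    rewrite -[RHS](ub' m)//; under eq_bigr do rewrite mulr_sumr.
    rewrite exchange_big/=; apply: eq_bigr => j _.
    rewrite -cA_cgv mulr_sumr; apply: eq_bigr => i' _; rewrite cAC; ring.
  - rewrite ei el eqxx mulr1n -cb_cgv; apply: eq_bigr => j _; exact: mulrC.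
have Bunit : B \in unitmx.
  have : B *m (MA *m B^T) \in unitmx.
    rewrite BAB unitmxE det_diag unitfE; apply/prodf_neq0 => i _; rewrite mxE.
    by case: unlift => [k|]; rewrite ?oner_eq0 ?gt_eqF ?cg_gt0.
  by rewrite unitmx_mul => /andP[].
have BG : B *m (\col_i G i) = 0.
  apply/matrixP => i j; rewrite !mxE; under eq_bigr do rewrite !mxE.
  by case: (unlift ord0 i) => [k|]; [exact: Gu|exact: Gg].
move=> i; have : \col_i G i = 0 by rewrite -(mulKmx Bunit (\col_i G i)) BG mulmx0.
by move=> /matrixP/(_ i 0); rewrite !mxE.
Qed.

End IKConstants.

(** * The model as a fixed-point problem *)

(* With z0 = 4 gamma sech^2, z1 = z0', z2 = z0'' and dl = delta:
   zeta = z0 + dl^2 r,  Vs = - z0 + dl^2 n,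
   psi_j = gamma_j (z1 + dl^2 k) + dl^2 sum_k w_k u_kj,
   chi_j = psi_j' = gamma_j (z2 + dl^2 W) + dl sum_k a_k u_kj,
   where k is the second slow variable attached to [slowP1]. *)
Section Functionals.
Context {R : realType} {n : nat}.
Variable p : 'I_n.+2 -> nat.
Variables (u : 'I_n -> 'I_n.+1 -> R) (lam : 'I_n -> R).
Local Notation N := n.+1.
Local Notation jet := (@jet R).
Local Notation rf m e d := (@rfun R (var n) (@vpar n) m e d).
Local Notation q := (pj p).
Local Notation a := (@ca R n p).
Local Notation b := (@cb R n p).
Local Notation A := (@cA R n p).
Local Notation Mh := (@cM R n p).
Local Notation g := (@cg R n p).
Local Notation gv := (@cgv R n p).
Local Notation "F '#*' G" := (rmul erefl erefl F G) (at level 40).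
Local Notation X v := (@rvar R (var n) (@vpar n) v _ erefl).
Local Notation low1 F := (@rlow R (var n) (@vpar n) 1 1 _ _ F).
Local Notation low0 F := (@rlow R (var n) (@vpar n) 1 0 _ _ F).

Definition z0j : jet := jscale (4 * g) sj.
Definition z1j : jet := jscale (- 8 * g) (jmul tj sj).
Definition z2j : jet := jscale (4 * g) (jadd (jscale 4 sj) (jscale (- 6) (jmul sj sj))).
Definition kcg : jet := jadd sj (jscale (- 2) (jmul tj tj)).

Definition z0B : bounded_jet false true z0j := bounded_jet_scale _ bounded_jet_sj.
Definition z1B : bounded_jet true true z1j :=
  bounded_jet_scale _ (bounded_jet_mul bounded_jet_tj bounded_jet_sj).
Definition z2B : bounded_jet false true z2j :=
  bounded_jet_scale _ (bounded_jet_add (bounded_jet_scale _ bounded_jet_sj)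
    (bounded_jet_scale _ (bounded_jet_mul bounded_jet_sj bounded_jet_sj))).
Definition kcgB : bounded_jet false false kcg :=
  bounded_jet_add (bounded_jet_weaken bounded_jet_sj)
    (bounded_jet_scale _ (bounded_jet_mul bounded_jet_tj bounded_jet_tj)).
Definition kdvpotB : bounded_jet false false (@kdvpot R) :=
  bounded_jet_add (bounded_jet_cst 4)
    (bounded_jet_scale _ (bounded_jet_weaken bounded_jet_sj)).

Lemma z0j0 x : z0j 0%N x = 4 * g * sech2 x.
Proof. by rewrite /z0j /jscale sj0. Qed.
Lemma z1j0 x : z1j 0%N x = - 8 * g * (tanh x * sech2 x).
Proof. by rewrite /z1j /jscale jmul0 tj0 sj0. Qed.
Lemma z2j0 x : z2j 0%N x = 4 * g * (4 * sech2 x - 6 * sech2 x ^+ 2).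
Proof. by rewrite /z2j /jscale /jadd /jscale jmul0 sj0; ring. Qed.
Lemma kcg0 x : kcg 0%N x = sech2 x - 2 * tanh x ^+ 2.
Proof. by rewrite /kcg /jadd /jscale jmul0 tj0 sj0; ring. Qed.

Definition rzeta : rf 2 false true := locked
  (radd (rjet _ 2 z0B) (rpert 2 (X vr))).
Definition rH : rf 2 false false := locked
  (radd (rcst _ 2 1) (rpert 2 (rweak rzeta))).
Definition rVs : rf 2 false true := locked
  (radd (rscale (-1) (rjet _ 2 z0B)) (rpert 2 (X vn))).
(* H^m = 1 + dl^2 zeta G_m and G_m = m + dl^2 zeta K_m: these sums carry out the
   divisions by dl^2. *)
Definition rG m : rf 2 false false := locked
  (rsum (fun l : 'I_m => rpow rH l)).
Definition rK m : rf 2 false false := locked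
  (rsum (fun l : 'I_m => rG l)).
Definition rkk : rf 0 true true := locked
  (radd (rjet _ 0 kcgB #* X vg)
       (rjet _ 0 (bounded_jet_scale (3 / 5) bounded_jet_tj) #* X vh)).
Definition rpsi j : rf 2 true true := locked
  (radd (rjet _ 2 (bounded_jet_scale (gv j) z1B))
    (rpert 2 (radd (rscale (gv j) rkk) (rsum (fun k => rscale (u k j) (X (vw k))))))).
(** The index is 1 rather than 2 because [va] stands for dl w' and enters with a single power of
    [dl]. *)
Definition rchi j : rf 1 false true := locked
  (radd (rjet _ 1 (bounded_jet_scale (gv j) z2B))
    (radd (low1 (rpert 2 (rscale (gv j) (X vW))))
      (rpert 1 (rsum (fun k => rscale (u k j) (X (va k))))))).
Definition rc : rf 2 false false := locked
  (radd (rcst _ 2 1) (rpert 2 (rcst _ 0 (2 * g)))).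
(** What the i-th momentum contains besides [b i * zeta] and [dl^2 * M chi], divided by [dl^2]. The
    division is exact: since [a i * q i = b i], the constant term of [rG (q i)] cancels against
    [b i], and [rK] is the quotient. *)
Definition rR i : rf 2 false true := locked
  (radd (rscale (a i) (radd (rscale (2 * g) (rG (q i) #* rzeta))
                           (rzeta #* (rzeta #* rK (q i)))))
    (rpert 2 (low0 (low1 rzeta #* rsum (fun j =>
       rscale (Mh i j) (low1 (rG (q i + q j).+1) #* rchi j)))))).
Definition rS i : rf 2 true true := locked
  (rsum (fun j => rscale (A i j) (rG (q i + q j - 1) #* (rzeta #* rpsi j)))).
Definition rX i : rf 1 false true := locked
  (radd (rsum (fun j => rscale (Mh i j) (rchi j))) (low1 (rR i))).
(** The correction of [r] for which the gamma-component of the momenta is exactly gamma times z0 +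
    dl^2 P, with P = [slowP1]. *)
Definition rrho : rf 1 false true := locked
  (rscale (- g^-1) (rsum (fun i => rscale (gv i) (rX i)))).
Definition rWz : rf 2 true true := locked
  (rsum (fun j => rscale (q j)%:R (rpow rH (q j - 1) #* rpsi j))).
(** Bernoulli's law solved for the sum of the remainders [r + n]: the soliton parts of zeta and Vs
    cancel, and a factor [dl^2] is divided out. *)
Definition rnu : rf 1 false true := locked
  (low1 (radd (rscale (- 2 * g) rVs) (radd (rscale (- 2^-1) (rVs #* rVs))
     (rscale (- 2^-1) (rpert 2 (rWz #* rWz)))))).
Definition rsrcP : rf 1 true true := locked
  (low1 (rscale g^-1 (rsum (fun i => rscale (gv i) (rS i))))).
(** The linear terms in [r] and [n] of the KdV-like equation are rewritten through [slowP1]; the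
    errors made, [rrho] and [rnu], reappear with the factors [kdvpot] and z0 / gamma. The other
    terms carry the nonlinearity and the corrections of higher order. *)
Definition rsrcK : rf 1 false true := locked
  (radd (rjet _ 1 kdvpotB #* rrho)
   (rscale g^-1
     (radd (rjet _ 1 z0B #* rnu)
     (radd (low1 (rpert 2 (radd (rscale (-1) (X vr #* X vr))
                                (rscale (- 2^-1) (X vn #* X vn)))))
     (radd (low1 (radd (rscale (4 * g ^+ 2) rzeta)
           (radd (rscale (- 2^-1) (rzeta #* (rVs #* rVs)))
                 (rscale (- 2^-1) (rH #* (rWz #* rWz))))))
       (rsum (fun j => rscale (- b j)
          (radd (rscale (2 * g) (rchi j))
             (low1 (rc #* (rzeta #* rG (q j).+1)) #* rchi j))))))))).

Definition cm k : R := \sum_i u k i * (\sum_j Mh i j * gv j).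
(** The limit for dl = 0 of the [u k]-component of the momenta divided by [dl^2]. Subtracting it
    makes the remaining part [dl * z]; being a fixed jet, it may be differentiated in [rsig]. *)
Definition p0j k : jet :=
  jadd (jscale (cm k) z2j) (jsum (fun i => jscale (u k i) (rlead (rR i)))).
Definition p0B k : bounded_jet false true (p0j k) :=
  bounded_jet_add (bounded_jet_scale _ z2B)
    (bounded_jet_sum (fun i => bounded_jet_scale _ (rleadP (rR i)))).
Definition rsig k : rf 1 true true := locked
  (radd (low1 (rsum (fun i => rscale (u k i) (rS i))))
    (rscale (-1) (rjet _ 1 (bounded_jet_deriv (p0B k))))).
Definition rR1 i : rf 0 false true := Rfun 0 (bounded_jet0 _ _) (rtailP (rR i)).
Definition rtau k : rf 0 false true := locked
  (radd (rscale (cm k) (X vW)) (rsum (fun i => rscale (u k i) (rR1 i)))).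
Definition rsrc_h : rf 1 true true := locked
  (radd (rscale 5 (rjet _ 1 bounded_jet_tj #* rsrcK))
       (rscale (- 5) (rjet _ 1 kcgB #* rsrcP))).
Definition rsrc_g : rf 1 false true := locked
  (radd (rscale 3 (rjet _ 1 bounded_jet_tj #* rsrcP)) rsrcK).

Definition rforcing (v : var n) : rf 1 (fpar v) true :=
  match v with
  | vh => rsrc_h | vg => rsrc_g | vr => rrho | vn => radd rnu (rscale (-1) rrho) | vW => rsrcK
  | vw k => rsig k | vz k => rpert 1 (rtau k)
  | va k => rscale (- (lam k)^-1) (rpert 1 (rtau k))
  end.

End Functionals.

(** * From the fixed point to the Isobe-Kakinuma system *)

Section Verification.
Context {R : realType} {n : nat}.
Variable p : 'I_n.+2 -> nat.
Hypotheses (hp0 : p ord0 = 0%N)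
  (hp : forall i j : 'I_n.+2, (i < j)%N -> (p i < p j)%N).
Variables (u : 'I_n -> 'I_n.+1 -> R) (lam : 'I_n -> R).
Local Notation N := n.+1.
Local Notation jet := (@jet R).
Local Notation q := (pj p).
Local Notation a := (@ca R n p).
Local Notation b := (@cb R n p).
Local Notation A := (@cA R n p).
Local Notation Mh := (@cM R n p).
Local Notation g := (@cg R n p).
Local Notation gv := (@cgv R n p).
Hypotheses (lam_gt0 : forall k, 0 < lam k)
  (ub : forall k, \sum_i u k i * b i = 0)
  (uA : forall k l, \sum_i u k i * (\sum_j A i j * u l j) = (k == l)%:R)
  (uM : forall k l, \sum_i u k i * (\sum_j Mh i j * u l j) = lam k * (k == l)%:R)
  (span : forall G : 'I_N -> R, \sum_i gv i * G i = 0 ->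
     (forall k, \sum_i u k i * G i = 0) -> forall i, G i = 0).
Variables (dl M : R) (Z : var n -> jet).
Hypotheses (dl01 : 0 < dl <= 1) (M0 : 0 <= M) (gZ : good (@vpar n) M Z)
  (sZ : solves lam dl (fun v => reval (rforcing p u lam v) dl Z) Z).

Let g0 : g != 0. Proof. by rewrite gt_eqF// cg_gt0. Qed.

Definition rvalE := (@rval_add, @rval_scale, @rval_sum, @rval_mul, @rval_low,
  @rval_pert, @rval_jet, @rval_cst, @rval_var, @rval_weak, @rval_pow).

Local Notation val F := (rval F dl Z).
Local Notation zeta := (val (rzeta p)).
Local Notation H := (val (rH p)).
Local Notation Vs := (val (rVs p)).
Local Notation G m := (val (rG p m)).
Local Notation K m := (val (rK p m)).
Local Notation psi j := (val (rpsi p u j)).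
Local Notation chi j := (val (rchi p u j)).
Local Notation Wz := (val (rWz p u)).
Local Notation P1 x := (slowP1 Z 0%N x).
Local Notation rho x := (Z vr 0%N x).
Local Notation nu x := (Z vn 0%N x).
Local Notation z0 x := (4 * g * sech2 x).
Local Notation c := (1 + 2 * g * dl ^+ 2).

Lemma val_zeta x : zeta x = z0 x + dl ^+ 2 * rho x.
Proof. by rewrite /rzeta -lock !rvalE z0j0. Qed.

Lemma val_Vs x : Vs x = - z0 x + dl ^+ 2 * nu x.
Proof. by rewrite /rVs -lock !rvalE z0j0 mulN1r. Qed.

Lemma val_H x : H x = 1 + dl ^+ 2 * zeta x.
Proof. by rewrite {1}/rH -lock !rvalE. Qed.

Lemma val_G m x : H x ^+ m = 1 + dl ^+ 2 * zeta x * G m x.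
Proof.
rewrite /rG -lock rval_sum; under eq_bigr do rewrite rval_pow.
have := subrX1 (H x) m; rewrite {2}val_H => h.
have -> : dl ^+ 2 * zeta x = 1 + dl ^+ 2 * zeta x - 1 by ring.
by rewrite -h; ring.
Qed.

Lemma val_K m x : G m x = m%:R + dl ^+ 2 * zeta x * K m x.
Proof.
rewrite {1}/rG -lock rval_sum; under eq_bigr do rewrite rval_pow val_G.
rewrite big_split/= sumr_const card_ord; congr (_ + _).
by rewrite -mulr_sumr /rK -lock rval_sum.
Qed.

Lemma val_c x : val (rc p) x = c.
Proof. by rewrite /rc -lock !rvalE; ring. Qed.

Lemma val_kk x : val rkk x =
  (sech2 x - 2 * tanh x ^+ 2) * Z vg 0%N x + 3 / 5 * tanh x * Z vh 0%N x.
Proof. by rewrite /rkk -lock !rvalE kcg0 /jscale tj0. Qed.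

Lemma val_psi j x : psi j x = gv j * (z1j p 0%N x + dl ^+ 2 * val rkk x) +
  dl ^+ 2 * \sum_k u k j * Z (vw k) 0%N x.
Proof.
rewrite /rpsi -lock rval_add rval_pert rval_add rval_scale rval_sum rval_jet /jscale.
rewrite (eq_bigr (fun k => u k j * Z (vw k) 0%N x)); first ring.
by move=> k _; rewrite !rvalE.
Qed.

Lemma val_chi j x : chi j x = gv j * (z2j p 0%N x + dl ^+ 2 * Z vW 0%N x) +
  dl * \sum_k u k j * Z (va k) 0%N x.
Proof.
rewrite /rchi -lock rval_add rval_add rval_low !rval_pert rval_scale rval_sum rval_jet rval_var /jscale.
rewrite (eq_bigr (fun k => u k j * Z (va k) 0%N x)); first ring.
by move=> k _; rewrite !rvalE.
Qed.

Lemma aq i : a i * (q i)%:R = b i.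
Proof.
rewrite /cb /ca -natr1; field.
by rewrite gt_eqF// ltr_wpDl.
Qed.

Lemma eq_vr x : rho x = P1 x + val (rrho p u) x.
Proof. by have [_ _ [h _ _] _] := sZ x. Qed.

Lemma eq_vn x : nu x = - rho x + val (rnu p u) x.
Proof.
have [_ _ [_ h _] _] := sZ x; rewrite h eq_vr.
rewrite -[reval _ _ _ _ _]/(val (radd (rnu p u) (rscale (-1) (rrho p u))) x) !rvalE.
by rewrite mulN1r; ring.
Qed.

Lemma val_nu x : val (rnu p u) x =
  - 2 * g * Vs x - 2^-1 * Vs x ^+ 2 - 2^-1 * dl ^+ 2 * Wz x ^+ 2.
Proof. by rewrite /rnu -lock !rvalE; ring. Qed.

Lemma bernoulli_scaled x : c * Vs x + zeta x + 2^-1 * (dl ^+ 2 * Vs x ^+ 2 + dl ^+ 4 * Wz x ^+ 2) = 0.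
Proof.
have h := eq_vn x; rewrite val_nu in h.
have e := val_Vs x.
have -> : c * Vs x = Vs x + dl ^+ 2 * (2 * g * Vs x) by ring.
by rewrite {1}e val_zeta h; ring.
Qed.

Lemma b_u k : \sum_j b j * u k j = 0.
Proof. by rewrite -[RHS](ub k); apply: eq_bigr => j _; rewrite mulrC. Qed.

Lemma sum_comb (f : 'I_N -> R) (X Y : R) (w : 'I_n -> R) :
  \sum_j f j * (gv j * X + Y * \sum_k u k j * w k) =
  (\sum_j f j * gv j) * X + Y * \sum_k (\sum_j f j * u k j) * w k.
Proof.
rewrite mulr_suml mulr_sumr.
under [X in _ = _ + X]eq_bigr do rewrite mulr_suml mulr_sumr.
rewrite exchange_big/= -big_split/=; apply: eq_bigr => j _.
rewrite mulrDr mulrA mulrCA mulr_sumr mulr_sumr; congr (_ + _).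
by apply: eq_bigr => k _; ring.
Qed.

Lemma b_chi x : \sum_j b j * chi j x = g * (z2j p 0%N x + dl ^+ 2 * Z vW 0%N x).
Proof.
under eq_bigr do rewrite val_chi.
rewrite sum_comb cb_cgv big1 ?mulr0 ?addr0// => k _.
by rewrite b_u mul0r.
Qed.

Lemma b_psi x : \sum_j b j * psi j x = g * (z1j p 0%N x + dl ^+ 2 * val rkk x).
Proof.
under eq_bigr do rewrite val_psi.
rewrite sum_comb cb_cgv big1 ?mulr0 ?addr0// => k _.
by rewrite b_u mul0r.
Qed.

(* This is the combination c (equation i = 0) - H (Bernoulli), divided by dl^2. *)
Lemma kdv_eq x : c * (\sum_j b j * H x ^+ (q j).+1 * chi j x) =
  (4 * g + 4 * g ^+ 2 * dl ^+ 2) * zeta x - zeta x ^+ 2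
  - 2^-1 * H x * Vs x ^+ 2 - 2^-1 * dl ^+ 2 * H x * Wz x ^+ 2.
Proof.
pose T := \sum_j b j * (2 * g + c * zeta x * G (q j).+1 x) * chi j x.
have -> : c * (\sum_j b j * H x ^+ (q j).+1 * chi j x) =
    \sum_j b j * chi j x + dl ^+ 2 * T.
  rewrite /T !mulr_sumr -big_split/=; apply: eq_bigr => j _.
  by rewrite val_G; ring.
rewrite b_chi.
have [_ _ [_ _ ->] _] := sZ x.
have -> : reval (rforcing p u lam vW) dl Z 0%N x = kdvpot 0%N x * val (rrho p u) x +
  g^-1 * (z0 x * val (rnu p u) x + dl ^+ 2 * (- rho x ^+ 2 - 2^-1 * nu x ^+ 2) +
    4 * g ^+ 2 * zeta x - 2^-1 * zeta x * Vs x ^+ 2 - 2^-1 * H x * Wz x ^+ 2 - T).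
  rewrite -[reval _ _ _ _ _]/(val (rsrcK p u) x) /rsrcK -lock.
  rewrite !(rval_add, rval_scale, rval_mul, rval_low, rval_pert, rval_jet, rval_var) rval_sum z0j0.
  have -> : \sum_j val (rscale (- b j) (radd (rscale (2 * g) (rchi p u j))
      (rmul erefl erefl (@rlow _ _ _ 1 1 _ _ (rmul erefl erefl (rc p) (rmul erefl erefl (rzeta p) (rG p (q j).+1)))) (rchi p u j)))) x = - T.
    rewrite /T -sumrN; apply: eq_bigr => j _.
    by rewrite !(rval_add, rval_scale, rval_mul, rval_low) val_c; ring.
  by congr (_ + _ * _); ring.
have er : val (rrho p u) x = rho x - P1 x by rewrite eq_vr; ring.
have en : val (rnu p u) x = nu x + rho x by rewrite eq_vn; ring.
rewrite er en kdvpot_0 z2j0 val_H val_zeta val_Vs.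
have gg := g0; set s := sech2 x; field.
exact: gg.
Qed.

(** Equation i = 0, integrated once, is recovered by undoing the combination behind [kdv_eq] with
    the help of Bernoulli's law; this requires division by [c]. *)
Lemma mass0 x : c != 0 -> c * zeta x + H x * Vs x =
  dl ^+ 2 * \sum_j b j * H x ^+ (q j).+1 * chi j x.
Proof.
move=> c0; apply: (mulfI c0).
rewrite [RHS]mulrCA kdv_eq mulrDr [c * (H x * Vs x)]mulrCA.
have -> : c * Vs x = - (zeta x + 2^-1 * (dl ^+ 2 * Vs x ^+ 2 + dl ^+ 4 * Wz x ^+ 2)).
  by have := bernoulli_scaled x; lra.
by rewrite !val_H; field.
Qed.

Lemma val_R i x : dl ^+ 2 * val (rR p u i) x =
  c * a i * zeta x * G (q i) x - b i * zeta x +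
  dl ^+ 2 * \sum_j Mh i j * (H x ^+ (q i + q j).+1 - 1) * chi j x.
Proof.
rewrite /rR -lock rval_add rval_pert !rval_scale !rval_add !rval_scale !rval_low.
rewrite !rval_mul !rval_low rval_sum.
have -> : \sum_j Mh i j * (H x ^+ (q i + q j).+1 - 1) * chi j x =
    dl ^+ 2 * (zeta x * \sum_j Mh i j * (G (q i + q j).+1 x * chi j x)).
  rewrite !mulr_sumr; apply: eq_bigr => j _.
  by rewrite val_G; ring.
rewrite (eq_bigr (fun j => Mh i j * (G (q i + q j).+1 x * chi j x))); last first.
  by move=> j _; rewrite rval_scale rval_mul rval_low.
have e := val_K (q i) x; have e2 := aq i.
rewrite -e2.
have -> : c * a i * zeta x * G (q i) x - a i * (q i)%:R * zeta x =
   a i * (2 * g * dl ^+ 2 * (G (q i) x * zeta x)) + a i * zeta x * (G (q i) x - (q i)%:R) by ring.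
have -> : G (q i) x - (q i)%:R = dl ^+ 2 * zeta x * K (q i) x by rewrite {1}e; ring.
ring.
Qed.

Lemma val_S i x : \sum_j A i j * psi j x + dl ^+ 2 * val (rS p u i) x =
  \sum_j A i j * H x ^+ (q i + q j - 1) * psi j x.
Proof.
rewrite /rS -lock rval_sum mulr_sumr -big_split/=; apply: eq_bigr => j _.
by rewrite rval_scale !rval_mul val_G; ring.
Qed.

Lemma val_X i x : val (rX p u i) x = \sum_j Mh i j * chi j x + val (rR p u i) x.
Proof.
rewrite /rX -lock rval_add rval_low rval_sum; congr (_ + _).
by apply: eq_bigr => j _; rewrite rval_scale.
Qed.

(** Up to scaling and an additive constant, the total flux of equation i, including c a_i H^(p_i +
    1), after elimination of phi_0' by equation i = 0; see [momentum_flux]. *)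
Definition momentum i x : R := b i * zeta x + dl ^+ 2 * val (rX p u i) x.

Lemma momentumE i x : momentum i x = c * a i * zeta x * G (q i) x +
  dl ^+ 2 * \sum_j Mh i j * H x ^+ (q i + q j).+1 * chi j x.
Proof.
have e := val_R i x.
rewrite /momentum val_X [X in _ + X]mulrDr e.
have -> : \sum_j Mh i j * (H x ^+ (q i + q j).+1 - 1) * chi j x =
    \sum_j Mh i j * H x ^+ (q i + q j).+1 * chi j x - \sum_j Mh i j * chi j x.
  by rewrite -sumrB; apply: eq_bigr => j _; ring.
ring.
Qed.

Lemma gv_momentum x : \sum_i gv i * momentum i x = g * (z0 x + dl ^+ 2 * P1 x).
Proof.
have er := eq_vr x; have ez := val_zeta x.
have e : val (rrho p u) x = - g^-1 * \sum_i gv i * val (rX p u i) x.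
  rewrite /rrho -lock rval_scale rval_sum; congr (_ * _).
  by apply: eq_bigr => i _; rewrite rval_scale.
have -> : \sum_i gv i * momentum i x =
    g * zeta x + dl ^+ 2 * \sum_i gv i * val (rX p u i) x.
  rewrite -cb_cgv mulr_suml mulr_sumr -big_split/=; apply: eq_bigr => i _.
  by rewrite /momentum; ring.
have -> : \sum_i gv i * val (rX p u i) x = - g * val (rrho p u) x.
  by rewrite e mulrA mulNr mulrN mulfV ?opprK ?mul1r.
have -> : val (rrho p u) x = rho x - P1 x by rewrite er; ring.
by rewrite ez; ring.
Qed.

Lemma val_R_split i x :
  val (rR p u i) x = rlead (rR p u i) 0%N x + dl ^+ 2 * val (rR1 p u i) x.
Proof.
by rewrite {1}/rval {1}/reval /jadd /jscale /rval /reval /jadd /jscale /= add0r expr0 mul1r.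
Qed.

Lemma val_tau k x : val (rtau p u k) x =
  cm p u k * Z vW 0%N x + \sum_i u k i * val (rR1 p u i) x.
Proof.
rewrite /rtau -lock rval_add rval_scale rval_var rval_sum; congr (_ + _).
by apply: eq_bigr => i _; rewrite rval_scale.
Qed.

Lemma fast_alpha k x : lam k * Z (va k) 0%N x = Z (vz k) 0%N x - dl * val (rtau p u k) x.
Proof.
have [_ _ _ /(_ k)[_ _ ->]] := sZ x.
rewrite -[reval _ _ _ _ _]/(val (rscale (- (lam k)^-1) (rpert 1 (rtau p u k))) x).
rewrite rval_scale rval_pert expr1; field.
by rewrite gt_eqF.
Qed.

(** [zeta] drops out because [u k] is orthogonal to [b]. [M]-orthogonality isolates [lam k * a_k],
    which [fast_alpha] trades for [z_k]. *)
Lemma u_momentum k x : \sum_i u k i * momentum i x =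
  dl ^+ 2 * (p0j p u k 0%N x + dl * Z (vz k) 0%N x).
Proof.
have -> : \sum_i u k i * momentum i x = zeta x * (\sum_i u k i * b i) +
    dl ^+ 2 * (\sum_i u k i * \sum_j Mh i j * chi j x + \sum_i u k i * val (rR p u i) x).
  rewrite -big_split mulr_sumr mulr_sumr -big_split/=; apply: eq_bigr => i _.
  by rewrite /momentum val_X; ring.
rewrite ub mulr0 add0r; congr (_ * _).
have -> : \sum_i u k i * \sum_j Mh i j * chi j x =
    cm p u k * (z2j p 0%N x + dl ^+ 2 * Z vW 0%N x) + dl * (lam k * Z (va k) 0%N x).
  have e i : \sum_j Mh i j * chi j x = (\sum_j Mh i j * gv j) * (z2j p 0%N x + dl ^+ 2 * Z vW 0%N x)
      + dl * \sum_l (\sum_j Mh i j * u l j) * Z (va l) 0%N x.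
    by under eq_bigr do rewrite val_chi; exact: sum_comb.
  under eq_bigr do rewrite e mulrDr mulrA.
  rewrite big_split/= -mulr_suml; congr (_ + _).
  under eq_bigr do rewrite mulrCA mulr_sumr.
  rewrite -mulr_sumr; congr (_ * _); rewrite exchange_big/=.
  rewrite (bigD1 k)//= [X in _ + X]big1 ?addr0 => [|l lk].
    by under eq_bigr do rewrite mulrA; rewrite -mulr_suml uM eqxx mulr1.
  by under eq_bigr do rewrite mulrA; rewrite -mulr_suml uM eq_sym (negbTE lk) mulr0 mul0r.
rewrite fast_alpha val_tau.
under [X in _ + X = _]eq_bigr do rewrite val_R_split mulrDr.
rewrite big_split/=.
have -> : \sum_i u k i * (dl ^+ 2 * val (rR1 p u i) x) =
    dl ^+ 2 * \sum_i u k i * val (rR1 p u i) x.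
  by rewrite mulr_sumr; apply: eq_bigr => i _; ring.
by rewrite /p0j /jadd /jscale /jsum; ring.
Qed.

Lemma reval_jet m e d (F : @rfun R (var n) (@vpar n) m e d) : is_jet (reval F dl Z).
Proof. by have [L _ h] := regular_reval F M0; have [] := h dl Z dl01 gZ. Qed.

Lemma val_derive m e d (F : @rfun R (var n) (@vpar n) m e d) (x : R) :
  is_derive x 1 (val F) (reval F dl Z 1%N x).
Proof. exact: jet_is_derive0 (reval_jet F). Qed.

Lemma Z_derive v (x : R) : is_derive x 1 (Z v 0%N) (Z v 1%N x).
Proof. by apply: jet_is_derive0; case: (gZ v). Qed.

Lemma bjet_derive e d U (x : R) : bounded_jet e d U -> is_derive x 1 (U 0%N) (U 1%N x).
Proof. by move=> [jU _ _]; exact: jet_is_derive0. Qed.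

Lemma slow_h x : Z vh 1%N x = 2 * tanh x * Z vh 0%N x +
  (5 * tanh x * val (rsrcK p u) x - 5 * (sech2 x - 2 * tanh x ^+ 2) * val (rsrcP p u) x).
Proof.
have [-> _ _ _] := sZ x; congr (_ + _).
rewrite -[reval _ _ _ _ _]/(val (rsrc_h p u) x) /rsrc_h -lock rval_add !rval_scale !rval_mul !rval_jet.
by rewrite tj0 kcg0; ring.
Qed.

Lemma slow_g x : Z vg 1%N x = - 2 * tanh x * Z vg 0%N x + Z vh 0%N x +
  (3 * tanh x * val (rsrcP p u) x + val (rsrcK p u) x).
Proof.
have [_ -> _ _] := sZ x; rewrite -addrA; congr (_ + (_ + _)).
rewrite -[reval _ _ _ _ _]/(val (rsrc_g p u) x) /rsrc_g -lock rval_add !rval_scale !rval_mul !rval_jet.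
by rewrite tj0; ring.
Qed.

Lemma slow_W x : Z vW 0%N x = (4 - 12 * sech2 x) * P1 x + val (rsrcK p u) x.
Proof. by have [_ _ [_ _ ->] _] := sZ x; rewrite kdvpot_0. Qed.

(** Together with [derive_P1] this undoes the triangular change of variables: [W], so far given only
    by an algebraic equation, is the derivative of the second slow variable. *)
Lemma derive_kk (x : R) : is_derive x 1 (val rkk) (Z vW 0%N x).
Proof.
have -> : val rkk = fun x => (sech2 x - 2 * (tanh x * tanh x)) * Z vg 0%N x + (3 / 5 * tanh x) * Z vh 0%N x.
  by apply/funext => y; rewrite val_kk expr2.
have ds := is_derive_sech2 x; have dt := is_derive_tanh x.
have dg := Z_derive vg x; have dh := Z_derive vh x.
have d1 := is_deriveMR (is_deriveBR ds (is_deriveZR 2 (is_deriveMR dt dt))) dg.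
have d2 := is_deriveMR (is_deriveZR (3 / 5) dt) dh.
apply: is_derive_eqR (is_deriveDR d1 d2) _.
by rewrite slow_h slow_g slow_W slowP1_0 /sech2; field.
Qed.

Lemma derive_P1 (x : R) : is_derive x 1 (slowP1 Z 0%N) (val rkk x + val (rsrcP p u) x).
Proof.
have -> : slowP1 Z 0%N = fun x => tanh x * Z vg 0%N x - 5^-1 * Z vh 0%N x.
  by apply/funext => y; rewrite slowP1_0; ring.
have dt := is_derive_tanh x.
have dg := Z_derive vg x; have dh := Z_derive vh x.
apply: is_derive_eqR (is_deriveBR (is_deriveMR dt dg) (is_deriveZR 5^-1 dh)) _.
by rewrite slow_h slow_g val_kk /sech2; field.
Qed.

Lemma derive_z0 (x : R) : is_derive x 1 (fun x => z0 x) (z1j p 0%N x).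
Proof.
apply: is_derive_eqR (is_deriveZR (4 * g) (is_derive_sech2 x)) _.
by rewrite z1j0; ring.
Qed.

Lemma derive_z1 (x : R) : is_derive x 1 (z1j p 0%N) (z2j p 0%N x).
Proof.
have -> : z1j p 0%N = fun x => - 8 * g * (tanh x * sech2 x).
  by apply/funext => y; exact: z1j0.
apply: is_derive_eqR (is_deriveZR (- 8 * g) (is_deriveMR (is_derive_tanh x) (is_derive_sech2 x))) _.
by rewrite z2j0 /sech2; ring.
Qed.

Lemma derive_w k (x : R) : is_derive x 1 (Z (vw k) 0%N) (dl^-1 * Z (va k) 0%N x).
Proof.
have d0 : dl != 0 by case/andP: dl01 => h _; rewrite gt_eqF.
have l0 : lam k != 0 by rewrite gt_eqF.
apply: is_derive_eqR (Z_derive (vw k) x) _.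
have h := fast_alpha k x.
have [_ _ _ /(_ k)[_ e _]] := sZ x.
rewrite -[reval _ _ _ _ _]/(val (rpert 1 (rtau p u k)) x) rval_pert expr1 -h in e.
apply: (mulfI l0); apply: (mulfI d0); rewrite mulrA e.
by field.
Qed.

(** Consistency of the independently introduced [chi]: the slow part is [derive_kk], the fast part
    is the relation w' = a / dl. *)
Lemma derive_psi j (x : R) : is_derive x 1 (psi j) (chi j x).
Proof.
have d0 : dl != 0 by case/andP: dl01 => h _; rewrite gt_eqF.
have -> : psi j = fun x => gv j * (z1j p 0%N x + dl ^+ 2 * val rkk x) +
  dl ^+ 2 * \sum_k u k j * Z (vw k) 0%N x.
  by apply/funext => y; exact: val_psi.
have d1 := is_deriveZR (gv j) (is_deriveDR (derive_z1 x) (is_deriveZR (dl ^+ 2) (derive_kk x))).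
have d2 : is_derive x 1 (fun x => \sum_k u k j * Z (vw k) 0%N x)
    (\sum_k u k j * (dl^-1 * Z (va k) 0%N x)).
  by apply: is_derive_sumR => k; apply: is_deriveZR; exact: derive_w.
apply: is_derive_eqR (is_deriveDR d1 (is_deriveZR (dl ^+ 2) d2)) _.
rewrite val_chi; congr (_ + _).
have -> : \sum_k u k j * (dl^-1 * Z (va k) 0%N x) = dl^-1 * \sum_k u k j * Z (va k) 0%N x.
  by rewrite mulr_sumr; apply: eq_bigr => k _; ring.
by field.
Qed.

Definition dmomentum i x : R := b i * reval (rzeta p) dl Z 1%N x + dl ^+ 2 * reval (rX p u i) dl Z 1%N x.

Lemma derive_momentum0 i (x : R) : is_derive x 1 (momentum i) (dmomentum i x).
Proof.
exact: is_deriveDR (is_deriveZR (b i) (val_derive (rzeta p) x))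
  (is_deriveZR (dl ^+ 2) (val_derive (rX p u i) x)).
Qed.

Lemma val_srcP x : val (rsrcP p u) x = g^-1 * \sum_i gv i * val (rS p u i) x.
Proof.
rewrite /rsrcP -lock rval_low rval_scale rval_sum; congr (_ * _).
by apply: eq_bigr => i _; rewrite rval_scale.
Qed.

Lemma val_sig k x : val (rsig p u k) x =
  \sum_i u k i * val (rS p u i) x - p0j p u k 1%N x.
Proof.
rewrite /rsig -lock rval_add rval_low rval_scale rval_jet rval_sum /jderiv mul1r mulN1r.
by congr (_ - _); apply: eq_bigr => i _; rewrite rval_scale.
Qed.

Lemma gv_A_psi x : \sum_i gv i * (\sum_j A i j * psi j x) = \sum_j b j * psi j x.
Proof.
under eq_bigr do rewrite mulr_sumr.
rewrite exchange_big/=; apply: eq_bigr => j _.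
rewrite -(cA_cgv hp0 hp) mulr_suml; apply: eq_bigr => i _; rewrite cAC; ring.
Qed.

Lemma u_A_psi k x : \sum_i u k i * (\sum_j A i j * psi j x) = dl ^+ 2 * Z (vw k) 0%N x.
Proof.
have e i : \sum_j A i j * psi j x = (\sum_j A i j * gv j) * (z1j p 0%N x + dl ^+ 2 * val rkk x)
    + dl ^+ 2 * \sum_l (\sum_j A i j * u l j) * Z (vw l) 0%N x.
  by under eq_bigr do rewrite val_psi; exact: sum_comb.
under eq_bigr do rewrite e (cA_cgv hp0 hp) mulrDr mulrA.
rewrite big_split/= -mulr_suml ub mul0r add0r.
under eq_bigr do rewrite mulrCA mulr_sumr.
rewrite -mulr_sumr; congr (_ * _); rewrite exchange_big/=.
rewrite (bigD1 k)//= [X in _ + X]big1 ?addr0 => [|l lk].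
  by under eq_bigr do rewrite mulrA; rewrite -mulr_suml uA eqxx mul1r.
by under eq_bigr do rewrite mulrA; rewrite -mulr_suml uA eq_sym (negbTE lk) mul0r.
Qed.

Lemma derive_momentum i (x : R) : is_derive x 1 (momentum i)
  (\sum_j A i j * H x ^+ (q i + q j - 1) * psi j x).
Proof.
apply: is_derive_eqR (derive_momentum0 i x) _; rewrite -val_S.
(* By [span] it suffices to project on gamma and on each [u k]. The projected momenta have closed
   forms, whose derivatives are known from the linear system; uniqueness of derivatives transfers
   them. *)
apply/eqP; rewrite -subr_eq0; apply/eqP; move: i.
apply: span => [|k].
  have e1 : \sum_i gv i * dmomentum i x = g * (z1j p 0%N x + dl ^+ 2 * (val rkk x + val (rsrcP p u) x)).
    apply: (@is_derive_unique _ (fun x => \sum_i gv i * momentum i x) x).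
      by apply: is_derive_sumR => i; apply: is_deriveZR; exact: derive_momentum0.
    have -> : (fun x => \sum_i gv i * momentum i x) = fun x => g * (z0 x + dl ^+ 2 * P1 x).
      by apply/funext => y; exact: gv_momentum.
    refine (is_deriveZR g (is_deriveDR (derive_z0 x) (is_deriveZR _ (derive_P1 x)))).
  have -> : \sum_i gv i * (dmomentum i x - (\sum_j A i j * psi j x + dl ^+ 2 * val (rS p u i) x)) =
      \sum_i gv i * dmomentum i x - (\sum_i gv i * (\sum_j A i j * psi j x) +
         dl ^+ 2 * \sum_i gv i * val (rS p u i) x).
    rewrite mulr_sumr -big_split -sumrB/=; apply: eq_bigr => i _; ring.
  rewrite e1 gv_A_psi b_psi val_srcP; have gg := g0; field.
  exact: gg.
have e1 : \sum_i u k i * dmomentum i x = dl ^+ 2 * (p0j p u k 1%N x + dl * Z (vz k) 1%N x).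
  apply: (@is_derive_unique _ (fun x => \sum_i u k i * momentum i x) x).
    by apply: is_derive_sumR => i; apply: is_deriveZR; exact: derive_momentum0.
  have -> : (fun x => \sum_i u k i * momentum i x) =
      fun x => dl ^+ 2 * (p0j p u k 0%N x + dl * Z (vz k) 0%N x).
    by apply/funext => y; exact: u_momentum.
  exact: is_deriveZR (is_deriveDR (bjet_derive x (p0B p u k)) (is_deriveZR _ (Z_derive (vz k) x))).
have -> : \sum_i u k i * (dmomentum i x - (\sum_j A i j * psi j x + dl ^+ 2 * val (rS p u i) x)) =
    \sum_i u k i * dmomentum i x - (\sum_i u k i * (\sum_j A i j * psi j x) +
       dl ^+ 2 * \sum_i u k i * val (rS p u i) x).
  rewrite mulr_sumr -big_split -sumrB/=; apply: eq_bigr => i _; ring.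
rewrite e1 u_A_psi mulrDr.
have [_ _ _ /(_ k)[-> _ _]] := sZ x.
by rewrite -[reval _ _ _ _ _]/(val (rsig p u k) x) val_sig; ring.
Qed.

(** The remainder of phi_0' / dl^2 beyond the soliton part: the surface velocity minus the
    contributions of phi_1, ..., phi_N. *)
Definition rvrem : @rfun R (var n) (@vpar n) 0 false true :=
  radd (@rvar R (var n) (@vpar n) vn _ erefl)
    (rscale (-1) (@rlow _ _ _ 1 0 _ _ (rsum (fun j =>
      rmul erefl erefl (@rlow _ _ _ 1 1 _ _ (rpow (rH p) (q j))) (rchi p u j))))).

Definition vel x : R := - z0 x + dl ^+ 2 * val rvrem x.

Lemma velE x : vel x = Vs x - dl ^+ 2 * \sum_j H x ^+ q j * chi j x.
Proof.
rewrite /vel /rvrem rval_add rval_var rval_scale rval_low rval_sum val_Vs.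
rewrite (eq_bigr (fun j => H x ^+ q j * chi j x)); first by ring.
by move=> j _; rewrite rval_mul rval_low rval_pow.
Qed.

Lemma speed_neq0 : c != 0.
Proof.
have g1 : 0 < g := cg_gt0 hp0 hp.
have h : 0 <= 2 * g * dl ^+ 2 by rewrite mulr_ge0 ?sqr_ge0// mulr_ge0// ltW.
by apply: lt0r_neq0; move: h; set e := 2 * g * _; lra.
Qed.

Lemma mass_vel x : H x * vel x =
  - c * zeta x - dl ^+ 2 * \sum_j a j * H x ^+ (q j).+1 * chi j x.
Proof.
have h := mass0 x speed_neq0.
have -> : H x * vel x = H x * Vs x - dl ^+ 2 * \sum_j H x ^+ (q j).+1 * chi j x.
  rewrite velE mulrBr; congr (_ - _); rewrite mulrCA; congr (_ * _); rewrite mulr_sumr.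
  by apply: eq_bigr => j _; rewrite exprS mulrA.
have -> : H x * Vs x = dl ^+ 2 * \sum_j b j * H x ^+ (q j).+1 * chi j x - c * zeta x.
  by rewrite -h; ring.
have -> : \sum_j b j * H x ^+ (q j).+1 * chi j x =
    \sum_j H x ^+ (q j).+1 * chi j x - \sum_j a j * H x ^+ (q j).+1 * chi j x.
  by rewrite -sumrB; apply: eq_bigr => j _; rewrite /cb; ring.
ring.
Qed.

(** Replacing [H * vel] by means of [mass_vel] produces the products [a i * a j]; these turn the
    coefficients [1 / (q i + q j + 1)] into the entries of [M]. *)
Lemma momentum_flux i x :
  dl ^+ 2 * (a i * H x ^+ (q i).+1 * vel x +
    dl ^+ 2 * \sum_j ((q i + q j).+1%:R)^-1 * H x ^+ (q i + q j).+1 * chi j x) =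
  dl ^+ 2 * momentum i x - c * a i * (H x ^+ (q i).+1 - 1).
Proof.
rewrite momentumE.
have -> : H x ^+ (q i).+1 - 1 = dl ^+ 2 * zeta x * (G (q i) x + H x ^+ q i).
  rewrite exprSr; have := val_G (q i) x; have := val_H x.
  by move: (H x ^+ q i) (H x) (G (q i) x) (zeta x) => h1 h2 h3 h4 -> ->; ring.
have -> : a i * H x ^+ (q i).+1 * vel x = a i * H x ^+ q i * (H x * vel x).
  by rewrite exprSr; ring.
rewrite mass_vel.
have -> : \sum_j ((q i + q j).+1%:R)^-1 * H x ^+ (q i + q j).+1 * chi j x =
    \sum_j Mh i j * H x ^+ (q i + q j).+1 * chi j x +
    a i * H x ^+ q i * \sum_j a j * H x ^+ (q j).+1 * chi j x.
  rewrite mulr_sumr -big_split/=; apply: eq_bigr => j _.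
  by rewrite /cM -addnS exprD; ring.
ring.
Qed.

End Verification.

(** * Norms and the main theorem *)

Section JetNorms.
Context {R : realType}.
Local Notation jet := (@jet R).
Implicit Types (U : jet) (B x : R) (k : nat).

Lemma jet_derive1n U k : is_jet U -> derive1n k (U 0%N) = fun x => k`!%:R * U k x.
Proof.
move=> jU; elim: k => [|k IH].
  by rewrite derive1n0; apply/funext => x; rewrite mul1r.
rewrite derive1nS IH; apply/funext => x; rewrite factS mulnC natrM -mulrA.
exact: is_derive_derive1 (is_deriveZR _ (jU k x)).
Qed.

Lemma jet_Ck U k : is_jet U -> Ck k (U 0%N).
Proof.
move=> jU; split=> [j _ x|]; rewrite jet_derive1n//.
  by have [] := is_deriveZR (j`!%:R) (jU j x).
exact: is_derive_cont (fun x => is_deriveZR (k`!%:R) (jU k x)).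
Qed.

Lemma wnorm_le (f : R -> R) B : (forall x, `|f x| <= B * wt x) -> (wnorm f <= B%:E)%E.
Proof.
move=> h; apply: ge_ereal_sup => _ [x _ <-]; rewrite lee_fin.
have -> : B = expR `|x| * (B * wt x).
  by rewrite mulrCA /wt -expRD subrr expR0 mulr1.
by rewrite ler_pM2l ?expR_gt0.
Qed.

Definition normC k : R := \sum_(j < k.+1) j`!%:R * mw j.

Lemma normC_ge0 k : 0 <= normC k.
Proof. by apply: sumr_ge0 => j _; rewrite mulr_ge0 ?mw_ge0. Qed.

Lemma jet_wnormk U B k : is_jet U -> bd true B U ->
  (wnormk k (U 0%N) <= (normC k * B)%:E)%E.
Proof.
move=> jU hB; rewrite /wnormk /normC mulr_suml -sumEFin.
apply: lee_sum => j _; apply: wnorm_le => x; rewrite jet_derive1n// normrM normr_nat.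
rewrite -!mulrA ler_wpM2l//.
by apply: (le_trans (hB j x)); rewrite mulrCA mulrA.
Qed.

Lemma jet_Be_infty U B : is_jet U -> par false U -> bd true B U -> Be_infty (U 0%N).
Proof.
move=> jU pU hB k _; split; first by move=> x; rewrite pU mul1r.
  exact: jet_Ck.
exact: le_lt_trans (jet_wnormk k jU hB) (ltry _).
Qed.

Lemma jet_Bo_infty U B : is_jet U -> par true U -> bd true B U -> Bo_infty (U 0%N).
Proof.
move=> jU pU hB k _; split; first by move=> x; rewrite pU mulN1r.
  exact: jet_Ck.
exact: le_lt_trans (jet_wnormk k jU hB) (ltry _).
Qed.

Lemma is_derive_powR (f : R -> R) x df m : is_derive x 1 f df ->
  is_derive x 1 (fun y => f y ^+ m.+1) (m.+1%:R * f x ^+ m * df).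
Proof.
move=> d; elim: m => [|m IH].
  have -> : (fun y => f y ^+ 1) = f by apply/funext => y; rewrite expr1.
  by rewrite expr0 mulr1 mul1r.
have -> : (fun y => f y ^+ m.+2) = fun y => f y * f y ^+ m.+1.
  by apply/funext => y; rewrite exprS.
apply: is_derive_eqR (is_deriveMR d IH) _.
by rewrite -[m.+2%:R]natr1 !exprS; ring.
Qed.

End JetNorms.

(** * The solution in the original variables *)

Section Solution.
Context {R : realType} {n : nat}.
Variable p : 'I_n.+2 -> nat.
Hypotheses (hp0 : p ord0 = 0%N)
  (hp : forall i j : 'I_n.+2, (i < j)%N -> (p i < p j)%N).
Variables (u : 'I_n -> 'I_n.+1 -> R) (lam : 'I_n -> R).
Local Notation N := n.+1.
Local Notation q := (pj p).
Local Notation a := (@ca R n p).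
Local Notation A := (@cA R n p).
Local Notation g := (@cg R n p).
Hypotheses (lam_gt0 : forall k, 0 < lam k)
  (ub : forall k, \sum_i u k i * (@cb R n p) i = 0)
  (uA : forall k l, \sum_i u k i * (\sum_j A i j * u l j) = (k == l)%:R)
  (uM : forall k l, \sum_i u k i * (\sum_j (@cM R n p) i j * u l j) = lam k * (k == l)%:R)
  (span : forall G : 'I_N -> R, \sum_i (@cgv R n p) i * G i = 0 ->
     (forall k, \sum_i u k i * G i = 0) -> forall i, G i = 0).
Variables (dl M : R) (Z : var n -> @jet R).
Hypotheses (dl01 : 0 < dl <= 1) (M0 : 0 <= M) (gZ : good (@vpar n) M Z)
  (sZ : solves lam dl (fun v => reval (rforcing p u lam v) dl Z) Z).
Variable phi0 : R -> R.
Hypothesis dphi0 : forall x : R, is_derive x 1 phi0 (dl ^+ 2 * vel p u dl Z x).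

Local Notation val F := (rval F dl Z).
Local Notation c := (1 + 2 * g * dl ^+ 2).

Definition sol_eta (x : R) : R := dl ^+ 2 * val (rzeta p) x.
Definition sol_phi (j : 'I_n.+2) : R -> R :=
  if unlift ord0 j is Some i then fun x => dl ^+ 4 * val (rpsi p u i) x else phi0.
Definition dsol_phi (j : 'I_n.+2) (x : R) : R :=
  if unlift ord0 j is Some i then dl ^+ 4 * val (rchi p u i) x
  else dl ^+ 2 * vel p u dl Z x.

Let H x := val (rH p) x.

Lemma depthE x : depth sol_eta x = H x.
Proof. by rewrite /depth /sol_eta /H val_H. Qed.

Let d0 : dl != 0. Proof. by case/andP: dl01 => h _; rewrite gt_eqF. Qed.

Lemma is_derive_phi j (x : R) : is_derive x 1 (sol_phi j) (dsol_phi j x).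
Proof.
rewrite /sol_phi /dsol_phi; case: (unlift ord0 j) => [i|]; last exact: dphi0.
exact: is_deriveZR (derive_psi lam_gt0 dl01 gZ sZ i x).
Qed.

Lemma derive1_phi j : derive1 (sol_phi j) = dsol_phi j.
Proof. by apply/funext => x; exact: is_derive_derive1 (is_derive_phi j x). Qed.

Lemma dsol_phi_derivable j (x : R) : exists D, is_derive x 1 (dsol_phi j) D.
Proof.
rewrite /dsol_phi; case: (unlift ord0 j) => [i|].
  by exists (dl ^+ 4 * reval (rchi p u i) dl Z 1%N x); exact: is_deriveZR (val_derive dl01 M0 gZ _ x).
exists (dl ^+ 2 * (- z1j p 0%N x + dl ^+ 2 * reval (rvrem p u) dl Z 1%N x)).
apply: is_deriveZR; rewrite /vel.
exact: is_deriveDR (is_deriveNR (derive_z0 p x)) (is_deriveZR _ (val_derive dl01 M0 gZ _ x)).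
Qed.

Lemma eta_derive (x : R) : exists D, is_derive x 1 sol_eta D.
Proof.
by exists (dl ^+ 2 * reval (rzeta p) dl Z 1%N x); exact: is_deriveZR (val_derive dl01 M0 gZ _ x).
Qed.

Lemma derive1_eta (x : R) : is_derive x 1 sol_eta (derive1 sol_eta x).
Proof. by have [D dD] := eta_derive x; rewrite (is_derive_derive1 dD). Qed.

Lemma H_derive (x : R) : is_derive x 1 H (derive1 sol_eta x).
Proof.
have -> : H = fun x => 1 + sol_eta x by apply/funext => y; rewrite -depthE.
exact: is_derive_eqR (is_deriveDR (is_derive_cstR 1 x) (derive1_eta x)) (add0r _).
Qed.

Lemma flux_eq i j : IK_flux p sol_eta sol_phi i j =
  fun x => ((p i + p j).+1%:R)^-1 * H x ^+ (p i + p j).+1 * dsol_phi j x.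
Proof.
by apply/funext => x; rewrite /IK_flux derive1_phi depthE addn1.
Qed.

Lemma flux_derive i j (x : R) :
  is_derive x 1 (IK_flux p sol_eta sol_phi i j) (derive1 (IK_flux p sol_eta sol_phi i j) x).
Proof.
have [D dD] := dsol_phi_derivable j x.
rewrite flux_eq.
have d := is_deriveMR (is_deriveZR ((p i + p j).+1%:R)^-1 (is_derive_powR (p i + p j) (H_derive x))) dD.
by rewrite (is_derive_derive1 d).
Qed.

(** The single fluxes have unwieldy derivatives, but their sum has a closed form, whose derivative
    must be the sum by uniqueness. *)
Lemma sum_flux_derive i (F : R -> R) (x D : R) :
  (forall y, \sum_j IK_flux p sol_eta sol_phi i j y = F y) ->
  is_derive x 1 F D ->
  \sum_j derive1 (IK_flux p sol_eta sol_phi i j) x = D.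
Proof.
move=> e; have <- : (fun y => \sum_j IK_flux p sol_eta sol_phi i j y) = F.
  exact/funext.
apply: is_derive_unique; apply: is_derive_sumR => j; exact: flux_derive.
Qed.

Lemma dsol_phi0 x : dsol_phi ord0 x = dl ^+ 2 * vel p u dl Z x.
Proof. by rewrite /dsol_phi unlift_none. Qed.

Lemma dsol_phi_lift i x : dsol_phi (lift ord0 i) x = dl ^+ 4 * val (rchi p u i) x.
Proof. by rewrite /dsol_phi liftK. Qed.

Lemma sol_phi_lift i : sol_phi (lift ord0 i) = fun x => dl ^+ 4 * val (rpsi p u i) x.
Proof. by rewrite /sol_phi liftK. Qed.

Lemma sum_flux0 x : \sum_j IK_flux p sol_eta sol_phi ord0 j x = - c * sol_eta x.
Proof.
rewrite big_ord_recl flux_eq dsol_phi0 hp0 addn0 invr1 mul1r expr1.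
under eq_bigr do rewrite flux_eq dsol_phi_lift hp0 add0n.
have -> : \sum_(i < N) ((p (lift ord0 i)).+1%:R)^-1 * H x ^+ (p (lift ord0 i)).+1 *
    (dl ^+ 4 * val (rchi p u i) x) =
    dl ^+ 4 * \sum_j a j * H x ^+ (q j).+1 * val (rchi p u j) x.
  by rewrite mulr_sumr; apply: eq_bigr => j _; rewrite /ca /pj; ring.
have h := mass_vel hp0 hp ub sZ x.
have -> : H x * (dl ^+ 2 * vel p u dl Z x) = dl ^+ 2 * (H x * vel p u dl Z x) by ring.
by rewrite h /sol_eta /H; ring.
Qed.

Lemma sum_flux_lift i x : \sum_j IK_flux p sol_eta sol_phi (lift ord0 i) j x =
  dl ^+ 2 * momentum p u dl Z i x - c * a i * (H x ^+ (q i).+1 - 1).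
Proof.
rewrite -(momentum_flux hp0 hp ub sZ) big_ord_recl flux_eq dsol_phi0 hp0 addn0.
under eq_bigr do rewrite flux_eq dsol_phi_lift.
rewrite [RHS]mulrDr; congr (_ + _); first by rewrite /ca /pj /H; ring.
rewrite !mulr_sumr; apply: eq_bigr => j _.
by rewrite /pj /H; ring.
Qed.

Lemma mass_zero x : IK_mass p dl c sol_eta sol_phi ord0 x.
Proof.
rewrite /IK_mass hp0 expr0 mulr1.
under eq_bigr do rewrite /coefA hp0 mul0n mul0r mulr0 !mul0r subr0.
rewrite (sum_flux_derive sum_flux0 (is_deriveZR (- c) (derive1_eta x))).
by ring.
Qed.

Lemma mass_lift i x : IK_mass p dl c sol_eta sol_phi (lift ord0 i) x.
Proof.
rewrite /IK_mass sumrB.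
pose S := \sum_j A i j * H x ^+ (q i + q j - 1) * val (rpsi p u j) x.
have dm := derive_momentum hp0 hp lam_gt0 ub uA uM span dl01 M0 gZ sZ i x.
have dH := is_deriveBR (is_derive_powR (q i) (H_derive x)) (is_derive_cstR 1 x).
have dF := is_deriveBR (is_deriveZR (dl ^+ 2) dm) (is_deriveZR (c * a i) dH).
rewrite (sum_flux_derive (sum_flux_lift i) dF) subr0 -/S.
  rewrite depthE big_ord_recl [X in - (X + _)](_ : _ = 0) ?add0r; last first.
    by rewrite /coefA hp0 muln0 mul0r mulr0 !mul0r.
  have -> : \sum_(j < N) dl ^- 2 * coefA R p (lift ord0 i) (lift ord0 j) *
      H x ^+ (p (lift ord0 i) + p (lift ord0 j) - 1) * sol_phi (lift ord0 j) x = dl ^+ 2 * S.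
    rewrite /S mulr_sumr; apply: eq_bigr => j _.
    by rewrite sol_phi_lift /cA /pj; field.
  have e : a i * (q i).+1%:R = 1 by rewrite /ca mulVf// pnatr_eq0.
  have -> : c * a i * ((q i).+1%:R * H x ^+ q i * derive1 sol_eta x) =
     c * (a i * (q i).+1%:R) * H x ^+ q i * derive1 sol_eta x by ring.
  by rewrite e /pj; ring.
Qed.

Lemma bernoulli_sol x : IK_bernoulli p dl c sol_eta sol_phi x.
Proof.
have e1 : \sum_(j < N.+1) depth sol_eta x ^+ p j * derive1 (sol_phi j) x =
    dl ^+ 2 * val (rVs p) x.
  rewrite big_ord_recl derive1_phi dsol_phi0 hp0 expr0 mul1r velE mulrBr.
  rewrite mulrA -exprD [X in _ + X](_ : _ =
    dl ^+ 4 * \sum_j H x ^+ q j * val (rchi p u j) x); first by rewrite subrK.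
  rewrite mulr_sumr; apply: eq_bigr => j _.
  by rewrite derive1_phi dsol_phi_lift depthE /pj; ring.
have e2 : \sum_(j < N.+1) (p j)%:R * depth sol_eta x ^+ (p j - 1) * sol_phi j x =
    dl ^+ 4 * val (rWz p u) x.
  rewrite big_ord_recl hp0 !mul0r add0r /rWz -lock rval_sum mulr_sumr.
  apply: eq_bigr => j _.
  by rewrite rval_scale rval_mul rval_pow sol_phi_lift depthE /H /pj; ring.
rewrite /IK_bernoulli e1 e2 /sol_eta.
have h := bernoulli_scaled sZ x.
transitivity (dl ^+ 2 * (c * val (rVs p) x + val (rzeta p) x +
  2^-1 * (dl ^+ 2 * val (rVs p) x ^+ 2 + dl ^+ 4 * val (rWz p u) x ^+ 2))).
  by field.
by rewrite h mulr0.
Qed.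

Lemma sol_IK : IK_solution p dl c sol_eta sol_phi.
Proof.
split.
- by move=> x; have [] := derive1_eta x.
- by move=> j x; have [] := is_derive_phi j x.
- by move=> j x; rewrite derive1_phi; have [D []] := dsol_phi_derivable j x.
- move=> i x; case: (unliftP ord0 i) => [j|] ->; [exact: mass_lift|exact: mass_zero].
- exact: bernoulli_sol.
Qed.

End Solution.

(** * Distance to the soliton *)

Section Estimates.
Context {R : realType} {n : nat}.
Variable p : 'I_n.+2 -> nat.
Variables (u : 'I_n -> 'I_n.+1 -> R).
Local Notation g := (@cg R n p).
Local Notation gv := (@cgv R n p).

Definition rpsirem j : @rfun R (var n) (@vpar n) 0 true true :=
  radd (rscale (gv j) rkk)
    (rsum (fun k => rscale (u k j) (@rvar R (var n) (@vpar n) (vw k) _ erefl))).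

Lemma val_psirem j dl Z x : rval (rpsi p u j) dl Z x =
  gv j * z1j p 0%N x + dl ^+ 2 * rval (rpsirem j) dl Z x.
Proof.
by rewrite /rpsi -lock rval_add rval_pert rval_jet.
Qed.

Lemma sol_eta_rem dl (Z : var n -> @jet R) :
  (fun x => sol_eta p dl Z x - 4 * g * dl ^+ 2 * sech x ^+ 2) =
  jscale (dl ^+ 4) (Z vr) 0%N.
Proof.
apply/funext => x; rewrite /sol_eta val_zeta sech_sqr -/(sech2 x) /jscale; ring.
Qed.

Lemma sol_phi_rem phi0 j dl (Z : var n -> @jet R) :
  (fun x => sol_phi p u dl Z phi0 (lift ord0 j) x
     + 8 * g * gv j * dl ^+ 4 * sech x ^+ 2 * tanh x) =
  jscale (dl ^+ 6) (reval (rpsirem j) dl Z) 0%N.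
Proof.
apply/funext => x; rewrite sol_phi_lift val_psirem z1j0 sech_sqr -/(sech2 x).
by rewrite /jscale -[reval _ _ _ _ _]/(rval (rpsirem j) dl Z x); ring.
Qed.

Lemma vel_jet dl (Z : var n -> @jet R) :
  (fun x => dl ^+ 2 * vel p u dl Z x) =
  jadd (jscale (- dl ^+ 2) (z0j p)) (jscale (dl ^+ 4) (reval (rvrem p u) dl Z)) 0%N.
Proof.
apply/funext => x; rewrite /vel /jadd /jscale z0j0.
by rewrite -[reval _ _ _ _ _]/(rval (rvrem p u) dl Z x); ring.
Qed.

Lemma phi0_rem (phi0 : R -> R) dl (Z : var n -> @jet R) :
  (forall x : R, is_derive x 1 phi0 (dl ^+ 2 * vel p u dl Z x)) ->
  derive1 (fun x => phi0 x + 4 * g * dl ^+ 2 * tanh x) =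
  jscale (dl ^+ 4) (reval (rvrem p u) dl Z) 0%N.
Proof.
move=> h; apply/funext => x.
have d := is_deriveDR (h x) (is_deriveZR (4 * g * dl ^+ 2) (is_derive_tanh x)).
rewrite (is_derive_derive1 d) /vel -/(sech2 x) /jscale.
by rewrite -[reval _ _ _ _ _]/(rval (rvrem p u) dl Z x); ring.
Qed.

End Estimates.

Theorem theorem1p1 (R : realType) (N : nat) (hN : (1 <= N)%N)
    (p : 'I_N.+1 -> nat) (hp0 : p ord0 = 0%N)
    (hp : forall i j : 'I_N.+1, (i < j)%N -> (p i < p j)%N) :
  exists (delta0 : R) (c : R -> R) (eta : R -> R -> R)
         (phi : R -> 'I_N.+1 -> R -> R),
    [/\ 0 < delta0,
        forall delta : R, 0 < delta <= delta0 ->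
          [/\ IK_solution p delta (c delta) (eta delta) (phi delta),
              Be_infty (eta delta),
              Be_infty (derive1 (phi delta ord0)),
              forall j : 'I_N, Bo_infty (phi delta (lift ord0 j)) &
              c delta = 1 + 2 * gamma R p * delta ^+ 2] &
        forall k : nat, exists C : R,
          forall delta : R, 0 < delta <= delta0 ->
            (wnormk k (fun x => eta delta x
                         - 4 * gamma R p * delta ^+ 2 * sech x ^+ 2)%R
             + wnormk k (derive1 (fun x => phi delta ord0 x
                         + 4 * gamma R p * delta ^+ 2 * tanh x)%R)
             <= (C * delta ^+ 4)%:E)%E /\
            forall j : 'I_N,
              (wnormk k (fun x => phi delta (lift ord0 j) x
                         + 8 * gamma R p * gammav R p j 0 * delta ^+ 4
                           * sech x ^+ 2 * tanh x)%R
               <= (C * delta ^+ 6)%:E)%E].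
Proof.
case: N hN p hp0 hp => // n _ p hp0 hp.
have [u [lam [lam0 ub uA uM span]]] := @fast_modes R n p hp0 hp.
have [dl0 [M [/andP[dl00 dl01] M0 Hsol]]] := forcing_family_solution lam0 (rforcing p u lam).
(* Outside (0, dl0] the family takes the dummy value 0, on which nothing is claimed. *)
have /choice[Zf HZ] : forall dl, exists Z, 0 < dl <= dl0 ->
    good (@vpar n) M Z /\ solves lam dl (fun v => reval (rforcing p u lam v) dl Z) Z.
  move=> dl; case: (pselect (0 < dl <= dl0)) => h.
    by have [Z h1 h2] := Hsol dl h; exists Z.
  by exists (fun=> jcst 0) => /h.
have h01 dl : 0 < dl <= dl0 -> 0 < dl <= 1.
  by move=> /andP[-> h]; apply: le_trans dl01.
have reg m e d (F : @rfun R (var n) (@vpar n) m e d) : exists2 L, 0 <= L &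
    forall dl, 0 < dl <= dl0 -> [/\ is_jet (reval F dl (Zf dl)),
      par e (reval F dl (Zf dl)) & bd d L (reval F dl (Zf dl))].
  have [L L0 h] := regular_reval F M0; exists L => // dl hd.
  by have [gZ _] := HZ dl hd; have [h1 h2 h3 _] := h dl _ (h01 dl hd) gZ; split.
(* phi_0 itself need not decay; it is any primitive of the velocity, and only its derivative is
   estimated. *)
have /choice[ph Hph] : forall dl, exists f : R -> R, 0 < dl <= dl0 ->
    forall x : R, is_derive x 1 f (dl ^+ 2 * vel p u dl (Zf dl) x).
  move=> dl; case: (pselect (0 < dl <= dl0)) => h; last by exists (fun=> 0) => /h.
  have [|f [_ hf]] := @primitive R (fun x => dl ^+ 2 * vel p u dl (Zf dl) x); last by exists f.
  rewrite vel_jet; have [L _ /(_ dl h)[hj _ _]] := reg _ _ _ (rvrem p u).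
  have [j0 _ _] := @z0B R n p.
  exact: (@jet_cont _ _ 0%N (is_jet_add (is_jet_scale _ j0) (is_jet_scale _ hj))).
exists dl0, (fun d => 1 + 2 * cg p * d ^+ 2), (fun d => sol_eta p d (Zf d)),
  (fun d => sol_phi p u d (Zf d) (ph d)); split=> //.
- move=> dl hd; have [gZ sZ] := HZ dl hd; have dphi := Hph dl hd.
  split=> //.
  + refine (sol_IK hp0 hp lam0 ub uA uM span (h01 dl hd) M0 gZ sZ dphi).
  + have [L _ /(_ dl hd)[h1 h2 h3]] := reg _ _ _ (rzeta p).
    exact: (jet_Be_infty (is_jet_scale (dl ^+ 2) h1) (par_scale _ h2) (bd_scale _ h3)).
  + have [L _ /(_ dl hd)[h1 h2 h3]] := reg _ _ _ (rvrem p u).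
    have -> : derive1 (sol_phi p u dl (Zf dl) (ph dl) ord0) =
        fun x => dl ^+ 2 * vel p u dl (Zf dl) x.
      apply/funext => x; rewrite /sol_phi unlift_none.
      exact: is_derive_derive1 (dphi x).
    rewrite vel_jet; have [j0 p0 _] := @z0B R n p; have [B _ b0] := bounded_jet_bd (@z0B R n p).
    apply: (jet_Be_infty (B := `|- dl ^+ 2| * B + `|dl ^+ 4| * L)).
    * exact: is_jet_add (is_jet_scale _ j0) (is_jet_scale _ h1).
    * exact: par_add (par_scale _ p0) (par_scale _ h2).
    * exact: bd_add (bd_scale _ b0) (bd_scale _ h3).
  + move=> j; rewrite sol_phi_lift.
    have [L _ /(_ dl hd)[h1 h2 h3]] := reg _ _ _ (rpsi p u j).
    exact: (jet_Bo_infty (is_jet_scale (dl ^+ 4) h1) (par_scale _ h2) (bd_scale _ h3)).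
- move=> k; have [Lv Lv0 hv] := reg _ _ _ (rvrem p u).
  have /choice[L hL] : forall j, exists L, 0 <= L /\
      forall dl, 0 < dl <= dl0 -> [/\ is_jet (reval (rpsirem p u j) dl (Zf dl)),
      par true (reval (rpsirem p u j) dl (Zf dl)) & bd true L (reval (rpsirem p u j) dl (Zf dl))].
    by move=> j; have [L L0 h] := reg _ _ _ (rpsirem p u j); exists L.
  pose LL := \sum_j L j.
  have LL0 : 0 <= LL by apply: sumr_ge0 => j _; case: (hL j).
  (* [M] bounds the remainder [r] of eta, [Lv] that of phi_0', and [LL] those of all phi_j at once.
     The order [k] enters through [normC k] alone. *)
  exists (normC k * (M + Lv + LL)) => dl hd; have [gZ sZ] := HZ dl hd.
  have C0 := @normC_ge0 R k; have d0 m : 0 <= dl ^+ m.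
    by case/andP: hd => h _; rewrite exprn_ge0// ltW.
  split.
    have [jr _ br] := gZ vr; have [jv _ bv] := hv dl hd.
    rewrite -/(cg p) sol_eta_rem.
    have -> : sol_phi p u dl (Zf dl) (ph dl) ord0 = ph dl by rewrite /sol_phi unlift_none.
    rewrite (phi0_rem (Hph dl hd)).
    have e1 := jet_wnormk k (is_jet_scale (dl ^+ 4) jr) (bd_scale _ br).
    have e2 := jet_wnormk k (is_jet_scale (dl ^+ 4) jv) (bd_scale _ bv).
    apply: (le_trans (leeD e1 e2)); rewrite -EFinD lee_fin (ger0_norm (d0 4)).
    have : 0 <= normC k * LL * dl ^+ 4 by exact: mulr_ge0 (mulr_ge0 C0 LL0) (d0 4%N).
    lra.
  move=> j; have [Lj0 /(_ dl hd)[h1 _ h3]] := hL j.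
  rewrite -/(cg p) -/(cgv p j) sol_phi_rem.
  apply: (le_trans (jet_wnormk k (is_jet_scale (dl ^+ 6) h1) (bd_scale _ h3))).
  rewrite lee_fin (ger0_norm (d0 6)).
  have : L j <= LL.
    by rewrite /LL (bigD1 j)//= lerDl sumr_ge0// => i _; case: (hL i).
  move=> hLj; rewrite [dl ^+ 6 * _]mulrC mulrA ler_wpM2r// ler_wpM2l//; lra.
Qed.
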